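(* Let $n\ge 2$ and $m\ge 3$ be integers, and suppose that there exists a form $Q\in X_n^m$ whose associated form $\mathbf{Q}\in\mathcal{Q}_n^{n(m-2)}$ is stable. Then for every $\mathrm{I}\in\mathfrak{I}_n^m=\mathbb{C}[X_n^m]^{\mathrm{GL}(n,\mathbb{C})}$ there exists $\mathbf{I}\in\mathcal{I}_n^{n(m-2)}$ such that the composition $\mathbf{I}\circ\Phi$ is a regular function on $X_n^m$ and coincides with $\mathrm{I}$. (Here $\mathbf{I}\circ\Phi$ is understood as a rational function on $X_n^m$, so that in particular $\mathbf{I}$ is required to be defined at at least one point of $\Phi(X_n^m)$; it is not required that $\mathbf{I}$ be defined at every point of $\Phi(X_n^m)$.)
   Context: All topological notions refer to the Zariski topology. $\mathcal{Q}_n^m$ is the complex vector space of forms (homogeneous polynomials) of degree $m$ on $\mathbb{C}^n$. The discriminant $\Delta$ satisfies: for a form $Q$ of degree at least $2$, $\Delta(Q)\neq 0$ if and only if the first-order partial derivatives $Q_j:=\partial Q/\partial z_j$, $j=1,\dots,n$, have no common zero in $\mathbb{C}^n\setminus\{0\}$. For $m\ge 3$, $X_n^m:=\{Q\in\mathcal{Q}_n^m:\Delta(Q)\ne 0\}$, an affine variety. Associated form: for $Q\in X_n^m$ let $M(Q):=\mathbb{C}[z_1,\dots,z_n]/J(Q)$, where $J(Q)$ is the ideal generated by $Q_1,\dots,Q_n$ (the Milnor algebra). It is a local Artinian Gorenstein algebra; with $\mathfrak{m}$ its maximal ideal, $\mathrm{Soc}(M(Q)):=\{x\in\mathfrak{m}:x\mathfrak{m}=0\}$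 is one-dimensional, equals $\mathfrak{m}^{n(m-2)}$, and is spanned by the element $e_0$ represented by the Hessian determinant $\mathrm{Hess}(Q)=\det(\partial^2Q/\partial z_i\partial z_j)$. Let $\omega:\mathrm{Soc}(M(Q))\to\mathbb{C}$ be the linear isomorphism with $\omega(e_0)=1$, and let $e_j$ be the element of $M(Q)$ represented by $z_j$. The associated form of $Q$ is $\mathbf{Q}\in\mathcal{Q}_n^{n(m-2)}$, $\mathbf{Q}(z):=\omega\left((z_1e_1+\dots+z_ne_n)^{n(m-2)}\right)$ for $z=(z_1,\dots,z_n)\in\mathbb{C}^n$. The map $\Phi:X_n^m\to\mathcal{Q}_n^{n(m-2)}$, $Q\mapsto\mathbf{Q}$, is a morphism of affine varieties. Invariants: $\mathrm{GL}(n,\mathbb{C})$ acts on $\mathcal{Q}_n^m$ by $(C,Q)\mapsto Q_C$, $Q_C(z):=Q(z(C^{-1})^T)$, with $z$ a row vector. A relative invariant of forms of degree $m$ on $\mathbb{C}^n$ is a polynomial $I:\mathcal{Q}_n^m\to\mathbb{C}$ for which there is an integer $\ell\ge0$ (the weight) with $I(Q)=(\det C)^{\ell}I(Q_C)$ for all $Q\in\mathcal{Q}_n^m$, $C\in\mathrm{GL}(n,\mathbb{C})$. $\mathcal{I}_n^m$ is the field of absolute invariants: rational functions on $\mathcal{Q}_n^m$ of the form $I/\tilde I$ with $I,\tilde I$ relative invariants of equal weights and $\tilde I\not\equiv0$ (equivalently, the field of $\mathrm{GL}(n,\mathbb{C})$-invariant rational functions on $\mathcal{Q}_n^m$). $\mathfrak{I}_n^m:=\mathbb{C}[X_n^m]^{\mathrm{GL}(n,\mathbb{C})}$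 is the algebra of $\mathrm{GL}(n,\mathbb{C})$-invariant regular functions on $X_n^m$. Stability (for forms of any degree $d$ on $\mathbb{C}^n$): $Q_0\in\mathcal{Q}_n^d$ is stable if (i) its isotropy subgroup under the $\mathrm{GL}(n,\mathbb{C})$-action is finite, and (ii) there exists a non-constant relative invariant $I$ on $\mathcal{Q}_n^d$ such that $I(Q_0)\neq0$ and the $\mathrm{GL}(n,\mathbb{C})$-orbit of $Q_0$ is closed in the affine variety $\{Q\in\mathcal{Q}_n^d:I(Q)\neq0\}$. *)

(* Defs.v *)
From HB Require Import structures.
From mathcomp Require Import all_boot all_order all_algebra.
From mathcomp Require Import mpoly.
From mathcomp Require Import boolp classical_sets functions cardinality reals.
From mathcomp Require Import complex.

Set Implicit Arguments.
Unset Strict Implicit.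
Unset Printing Implicit Defensive.

Import GRing.Theory.
Local Open Scope ring_scope.
Local Open Scope classical_set_scope.
Local Open Scope quotient_scope.

Local Notation "p %:F" := (@FracField.tofrac _ p) : ring_scope.

(* A form of degree d in n variables is a polynomial F : {mpoly R[i][n]} with *)
(* F \is d.-homog; R[i], for R : realType, is the field of complex numbers.   *)

(** ** Polynomial functions and the Zariski topology on the space of forms *)

Section Forms.
Variables (R : realType) (n d : nat).
Local Notation C := R[i].

Definition monomials : {set 'X_{1..n < d.+1}} :=
  [set a : 'X_{1..n < d.+1} | mdeg a == d].

Definition form_dim : nat := #|monomials|.

Definition coords (F : {mpoly C[n]}) : 'I_form_dim -> C :=
  fun k => F@_(bmnm (enum_val k)).

(* The monomials form a basis of the space of forms of degree d, so the       *)
(* polynomial functions on this space are the polynomials in the coordinates. *)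
Definition pfun_at (I : {mpoly C[form_dim]}) (F : {mpoly C[n]}) : C :=
  I.@[coords F].

Definition zclosed (Z : set {mpoly C[n]}) : Prop :=
  exists S : set {mpoly C[form_dim]},
    Z = [set F | F \is d.-homog /\ forall I, S I -> pfun_at I F = 0].

Definition zopen (U : set {mpoly C[n]}) : Prop :=
  U `<=` [set F | F \is d.-homog] /\
  zclosed ([set F | F \is d.-homog] `\` U).

Definition zclosed_in (Y A : set {mpoly C[n]}) : Prop :=
  exists2 Z, zclosed Z & A = Z `&` Y.

(* The rational function r is defined at F, with value c. Any representation  *)
(* of r as a fraction is allowed, so the domain is the largest possible one.  *)
Definition rat_value (r : {fraction {mpoly C[form_dim]}}) (F : {mpoly C[n]})
    (c : C) : Prop :=
  exists p q : {mpoly C[form_dim]},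
    [/\ r = p%:F / q%:F, pfun_at q F != 0 & c = pfun_at p F / pfun_at q F].

(** ** The action of the general linear group, invariants, stability *)

(* Substitution of the row vector z (A^-1)^T for z. *)
Definition glact (A : 'M[C]_n) (F : {mpoly C[n]}) : {mpoly C[n]} :=
  F \mPo [tuple \sum_(j < n) ((invmx A)^T j i) *: 'X_j | i < n].

Definition rel_invariant (l : nat) (I : {mpoly C[form_dim]}) : Prop :=
  forall (F : {mpoly C[n]}) (A : 'M[C]_n), F \is d.-homog -> A \in unitmx ->
    pfun_at I F = (\det A) ^+ l * pfun_at I (glact A F).

Definition abs_invariant (r : {fraction {mpoly C[form_dim]}}) : Prop :=
  exists (l : nat) (I J : {mpoly C[form_dim]}),
    [/\ rel_invariant l I, rel_invariant l J, J != 0 & r = I%:F / J%:F].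

Definition isotropy (F : {mpoly C[n]}) : set 'M[C]_n :=
  [set A | A \in unitmx /\ glact A F = F].

Definition glorbit (F : {mpoly C[n]}) : set {mpoly C[n]} :=
  [set glact A F | A in [set A : 'M[C]_n | A \in unitmx]].

Definition stable (F : {mpoly C[n]}) : Prop :=
  finite_set (isotropy F) /\
  exists I : {mpoly C[form_dim]},
    [/\ exists l, rel_invariant l I,
        forall c : C, I != c%:MP,
        pfun_at I F != 0 &
        zclosed_in [set G | G \is d.-homog /\ pfun_at I G != 0] (glorbit F)].

End Forms.

(** ** Nondegenerate forms *)

(* X_n^m for m >= 3. Nonvanishing of the discriminant is expressed by the     *)
(* property that characterizes it: the partial derivatives have no common     *)
(* zero except the origin.                                                    *)
Record ndform (R : realType) (n m : nat) := NDForm {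
  ndform_val :> {mpoly R[i][n]};
  ndform_homog : ndform_val \is m.-homog;
  ndform_deg : (3 <= m)%N;
  ndform_disc : forall z : 'I_n -> R[i],
    (forall j, (ndform_val^`M(j)).@[z] = 0) -> forall j, z j = 0
}.

Section NDForms.
Variables (R : realType) (n m : nat).
Local Notation C := R[i].
Local Notation X := (ndform R n m).

(* Regular functions on the Zariski open subset X of the space of forms:      *)
(* locally quotients of polynomial functions.                                 *)
Definition regular_fun (f : X -> C) : Prop :=
  forall Q0 : X, exists U : set {mpoly C[n]},
    [/\ zopen m U, U Q0 &
      exists p q : {mpoly C[form_dim n m]}, forall Q : X, U Q ->
        pfun_at q Q != 0 /\ f Q = pfun_at p Q / pfun_at q Q].

Definition gl_invariant (f : X -> C) : Prop :=
  forall (Q Q' : X) (A : 'M[C]_n), A \in unitmx ->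
    ndform_val Q' = glact A Q -> f Q' = f Q.

(** ** The Milnor algebra *)

Definition jacobian_ideal (Q : X) : {pred {mpoly C[n]}} :=
  fun p => `[< exists g : 'I_n -> {mpoly C[n]},
                 p = \sum_(j < n) g j * Q^`M(j) >].

Lemma jacobian_ideal_closed (Q : X) : idealr_closed (jacobian_ideal Q).
Proof.
split.
- by apply/asboolP; exists (fun=> 0); rewrite big1 // => j _; rewrite mul0r.
- apply/asboolPn => -[g /(congr1 (mcoeff 0%MM))].
  rewrite mcoeff1 eqxx raddf_sum big1 => [/eqP|j _]; first by rewrite oner_eq0.
  rewrite /= rmorphM /= mcoeff_deriv add0m.
  rewrite (dhomog_nemf_coeff (ndform_homog Q)) ?mul0rn ?mulr0 //.
  by rewrite /= mdeg1 ltn_eqF // (leq_trans _ (ndform_deg Q)).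
- move=> a p q /asboolP [g ->] /asboolP [h ->]; apply/asboolP.
  exists (fun j => a * g j + h j).
  by rewrite mulr_sumr -big_split; apply: eq_bigr => j _; rewrite mulrDl mulrA.
Qed.

HB.instance Definition _ (Q : X) :=
  isIdealr.Build {mpoly C[n]} (jacobian_ideal Q) (jacobian_ideal_closed Q).

Definition milnor (Q : X) : comNzRingType := {ideal_quot (jacobian_ideal Q)}.

Definition milnor_pi (Q : X) (p : {mpoly C[n]}) : milnor Q :=
  \pi_({ideal_quot (jacobian_ideal Q)}) p.

(* The Milnor algebra is local: its maximal ideal consists of the nonunits. *)
Definition milnor_max (Q : X) : set (milnor Q) :=
  [set x | ~ exists y, y * x = 1].

Definition milnor_soc (Q : X) : set (milnor Q) :=
  [set x | milnor_max x /\ forall y, milnor_max y -> x * y = 0].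

Definition hessian (F : {mpoly C[n]}) : {mpoly C[n]} :=
  \det (\matrix_(i < n, j < n) F^`M(i)^`M(j)).

(* w restricts to the linear isomorphism from the socle to C that maps the    *)
(* class of the Hessian to 1; its values outside the socle are irrelevant.    *)
(* The scalar a acts on the Milnor algebra as the class of a%:MP.             *)
Definition is_omega (Q : X) (w : milnor Q -> C) : Prop :=
  [/\ forall (a : C) (x y : milnor Q), milnor_soc x -> milnor_soc y ->
        w (milnor_pi Q a%:MP * x + y) = a * w x + w y,
      set_bij (@milnor_soc Q) setT w &
      w (milnor_pi Q (hessian Q)) = 1].

(** ** The associated form *)

Definition is_assoc_form (Q : X) (F : {mpoly C[n]}) : Prop :=
  F \is (n * (m - 2)).-homog /\
  exists2 w : milnor Q -> C, is_omega w &
    forall z : 'I_n -> C,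
      F.@[z] = w ((\sum_(j < n) milnor_pi Q (z j)%:MP * milnor_pi Q 'X_j)
                    ^+ (n * (m - 2))).

(* The form F with is_assoc_form Q F is unique; xget selects it. *)
Definition assoc_form (Q : X) : {mpoly C[n]} := xget 0 [set F | is_assoc_form Q F].

(* The rational function obtained by composing r with the associated form map *)
(* is defined at some point of X, and is the function f on X.                 *)
Definition comp_assoc_eq (r : {fraction {mpoly C[form_dim n (n * (m - 2))]}})
    (f : X -> C) : Prop :=
  (exists (Q : X) (c : C), rat_value r (assoc_form Q) c) /\
  (forall (Q : X) (c : C), rat_value r (assoc_form Q) c -> c = f Q).

End NDForms.

(* Main.v *)
(* Write [N = n (m - 2)]. On forms with nonzero associated form, [Q |-> Phi Q] is a      *)
(* rational map, equivariant up to the action of an automorphism of GL_n. If [Phi Q =   *)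
(* Phi Q'] then, Milnor algebras being Gorenstein, [Q] and [Q'] have the same Jacobian  *)
(* ideal, so the gradient of [Q'] is a constant matrix times that of [Q]. By Euler's    *)
(* formula the pencil [Q + t (Q' - Q)] is then tangent to the orbits, hence the         *)
(* invariant [f] is constant along it: [f] is constant on the fibres of [Phi].          *)
(* In characteristic 0 it follows that generically [f = (p / q) o Phi] for some         *)
(* polynomials [p] and [q]. Stability of one associated form implies that the orbit of  *)
(* a generic associated form is closed in the locus [I <> 0] of an invariant. By the    *)
(* Nullstellensatz, some Reynolds average (computed by Cayley's Omega process) [J1] of  *)
(* a multiple of a translate of [q] does not vanish on that orbit, and the same average *)
(* [I1] of [p] satisfies [I1 (Phi Q) = f Q * J1 (Phi Q)].                               *)

Require Import Defs.
From HB Require Import structures.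
From mathcomp Require Import all_boot all_order all_algebra.
From mathcomp Require Import ssrcomplements mpoly.
From mathcomp Require Import boolp classical_sets functions cardinality reals.
From mathcomp Require Import complex.
From mathcomp Require Import ring lra zify closed_field.

Set Implicit Arguments.
Unset Strict Implicit.
Unset Printing Implicit Defensive.

Import Order.TTheory GRing.Theory Num.Theory.
Local Open Scope ring_scope.

(** ** Polynomial functions *)

(** Call a form [good] if its Milnor algebra carries the socle functional described by [gor]. If one
    good form exists, the good forms contain a nonempty open set ([good_generic]). On good forms the
    associated form is [Phi]; its coefficients are multinomial numbers times the values of the
    functional on monomials, hence locally rational in the form. The invariant [f] is pushed down
    along [Phi] in three stages.

    Fibres. By Gorenstein duality the functional in degree [N] determines the Jacobian ideal, so
    [Phi Q = Phi Q'] makes the gradient of [Q'] an invertible constant matrix times the gradient of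
    [Q] ([Phi_grad_related]). By Euler's formula [Q' - Q] is then a Lie derivative of the general
    member of the pencil through [Q] and [Q'], so [f] does not change along it ([pencil_constant],
    [f_fibre]).

    Rationality. Over the coordinates of [Phi], the function [f] satisfies a relation of minimal
    degree. By Chevalley's theorem all roots of a general specialization are values of [f] on one
    fibre, and in characteristic 0 they are simple; so the degree is one ([graph_rational]). This
    yields [p] and [q] with [p (Phi Q) = f Q * q (Phi Q)] ([exists_rational]), not yet invariant.

    Averaging. Cayley's operator applied to the function of [g] given by [b (F o g) * q (F o g o h)]
    produces a relative invariant of [F]. Since [Phi] is equivariant up to an automorphism of the
    group, the factor [f Q] comes out, and the averages of [p] and [q] remain proportional
    ([proportional_translate]). It remains to choose [b] and [h] so that the average of [q] is
    nonzero at some associated form. If the orbit of [F] is closed in the locus where an invariant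
    [I] is nonzero, the Nullstellensatz puts a power of [I] into the ideal generated by the
    translates of [q] and the equations of the orbit; the average of this relation is nonzero, so
    one of its terms is ([separate_orbit]). Closedness is given only at the stable form. There the
    orbit map has injective differential ([finite_stabilizer_lie]), so some average [J] of a
    Jacobian determinant is nonzero ([full_orbit_invariant]). Where [J] is nonzero orbits have full
    dimension, so none lies in the boundary of another ([orbit_closure]): orbits of general
    associated forms are closed where [I * J] is nonzero.

    At a form that is not good [Phi] is 0. If the quotient of invariants is defined there,
    contracting an orbit to 0 shows that [f] is constant ([invariant_descent]). *)

Section PolynomialFunctions.
Variable C : numClosedFieldType.

Lemma poly_nonroot (p : {poly C}) (s : seq C) :
  p != 0 -> exists x, p.[x] != 0 /\ x \notin s.
Proof.
move=> p0; have: p * \prod_(a <- s) ('X - a%:P) != 0.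
  rewrite mulf_neq0 // prodf_seq_neq0; apply/allP => a _ /=.
  by rewrite polyXsubC_eq0.
case/closed_nonrootP => x; rewrite /root hornerM mulf_eq0 negb_or => /andP[px].
rewrite -/(root _ x) root_prod_XsubC => xs; by exists x.
Qed.

Definition vcons l (u : 'I_l -> C) (t : C) (i : 'I_l.+1) : C :=
  if unlift ord_max i is Some j then u j else t.

Lemma vcons_max l (u : 'I_l -> C) t : vcons u t ord_max = t.
Proof. by rewrite /vcons unlift_none. Qed.

Lemma vcons_widen l (u : 'I_l -> C) t j : vcons u t (widen_ord (leqnSn l) j) = u j.
Proof.
rewrite /vcons; have -> : widen_ord (leqnSn l) j = lift ord_max j.
  by apply: val_inj; rewrite /= /bump leqNgt ltn_ord.
by rewrite liftK.
Qed.

(** Relations with one distinguished variable are kept as polynomials over [{mpoly C[l]}];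
    specializing the coefficients leaves a univariate polynomial whose roots can be discussed. *)
Definition pev l (p : {poly {mpoly C[l]}}) (u : 'I_l -> C) : {poly C} :=
  map_poly (meval u) p.

Lemma muni_eval l (P : {mpoly C[l.+1]}) u t :
  (pev (muni P) u).[t] = P.@[vcons u t].
Proof.
rewrite /pev muniE raddf_sum horner_sum [in RHS]mevalE; apply: eq_bigr => m _ /=.
rewrite map_polyZ /= map_polyXn hornerZ hornerXn mevalZ mevalX big_ord_recr /=.
rewrite vcons_max mulrA; congr (_ * _ * _); apply: eq_bigr => i _.
by rewrite mnmE vcons_widen.
Qed.

Lemma muni_eq0 l (P : {mpoly C[l.+1]}) : muni P = 0 -> P = 0.
Proof.
move=> h; apply/mpolyP => m; rewrite mcoeff0.
have := congr1 (fun q : {poly {mpoly C[l]}} =>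
  (q`_(m ord_max))@_[multinom m (widen_ord (leqnSn l) i) | i < l]) h.
rewrite coef0 mcoeff0 muniE coef_sum raddf_sum /=.
case: (boolP (m \in msupp P)) => [mP|/memN_msupp_eq0 -> //].
rewrite (bigD1_seq m) ?msupp_uniq //= !coefZ coefXn eqxx mulr1 mcoeffZ mcoeffX eqxx.
rewrite mulr1 big1 ?addr0 // => m' ne.
rewrite coefZ coefXn; case: eqP => [e|]; last by rewrite mulr0 mcoeff0.
rewrite mulr1 mcoeffZ mcoeffX; case: eqP => [e'|]; last by rewrite mulr0.
case/eqP: ne; apply/mnmP => i.
case: (unliftP ord_max i) => [j ->|->]; last by [].
have -> : lift ord_max j = widen_ord (leqnSn l) j.
  by apply: val_inj; rewrite /= /bump leqNgt ltn_ord.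
by have /mnmP/(_ j) := e'; rewrite !mnmE.
Qed.

Lemma mpoly_nonroot l (P : {mpoly C[l]}) : P != 0 -> exists v, P.@[v] != 0.
Proof.
elim: l P => [|l IH] P P0.
  exists (fun=> 0); rewrite (nvar0_mpolyC P) mevalC.
  by rewrite -(mpolyC_eq0 0) -nvar0_mpolyC.
have: muni P != 0 by apply: contra_neq P0 => /muni_eq0.
rewrite -lead_coef_eq0 => /IH[u hu].
have: pev (muni P) u != 0.
  apply: contra_neq hu => /(congr1 (fun q : {poly C} => q`_(size (muni P)).-1)).
  by rewrite coef_map coef0.
case/closed_nonrootP => t; rewrite /root muni_eval => h; by exists (vcons u t).
Qed.

Lemma mpoly_eval_inj l (P Q : {mpoly C[l]}) : (forall v, P.@[v] = Q.@[v]) -> P = Q.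
Proof.
move=> h; apply/eqP; rewrite -subr_eq0; apply/negPn/negP => /mpoly_nonroot[v].
by rewrite mevalB h subrr eqxx.
Qed.

(** A nonempty principal open set is dense. This extends identities from invertible matrices, or
    from generic forms, to all of them. *)
Lemma mpoly_ext0 l (P w : {mpoly C[l]}) :
  w != 0 -> (forall v, w.@[v] != 0 -> P.@[v] = 0) -> P = 0.
Proof.
move=> w0 h; apply/eqP; apply: contraT => P0.
have /mpoly_nonroot[v] : P * w != 0 by rewrite mulf_neq0.
by rewrite mevalM mulf_eq0 negb_or => /andP[Pv /h e]; rewrite e eqxx in Pv.
Qed.

(** * Polynomial functions, and fractions over powers of a fixed polynomial *)

Definition polyfun l (f : ('I_l -> C) -> C) : Prop :=
  exists P : {mpoly C[l]}, forall v, f v = P.@[v].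

Section Polyfun.
Variable l : nat.
Implicit Types f g : ('I_l -> C) -> C.

Lemma polyfun_ext f g : (forall v, f v = g v) -> polyfun f -> polyfun g.
Proof. by move=> e [P hP]; exists P => v; rewrite -e. Qed.
Lemma polyfun_cst c : @polyfun l (fun=> c).
Proof. by exists c%:MP => v; rewrite mevalC. Qed.
Lemma polyfun_var i : @polyfun l (fun v => v i).
Proof. by exists 'X_i => v; rewrite mevalXU. Qed.
Lemma polyfun_meval (P : {mpoly C[l]}) : polyfun (fun v => P.@[v]).
Proof. by exists P. Qed.
Lemma polyfunD f g : polyfun f -> polyfun g -> polyfun (fun v => f v + g v).
Proof. by move=> [P hP] [Q hQ]; exists (P + Q) => v; rewrite mevalD hP hQ. Qed.
Lemma polyfunM f g : polyfun f -> polyfun g -> polyfun (fun v => f v * g v).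
Proof. by move=> [P hP] [Q hQ]; exists (P * Q) => v; rewrite mevalM hP hQ. Qed.
Lemma polyfunZ c f : polyfun f -> polyfun (fun v => c * f v).
Proof. by move=> hf; apply: polyfunM hf; apply: polyfun_cst. Qed.
Lemma polyfunMn f k : polyfun f -> polyfun (fun v => f v *+ k).
Proof. by move=> [P hP]; exists (P *+ k) => v; rewrite mevalMn hP. Qed.
Lemma polyfunX f k : polyfun f -> polyfun (fun v => f v ^+ k).
Proof. by move=> [P hP]; exists (P ^+ k) => v; rewrite rmorphXn /= hP. Qed.
Lemma polyfun_sum (I : Type) (r : seq I) (Q : pred I) (F : I -> ('I_l -> C) -> C) :
  (forall i, Q i -> polyfun (F i)) -> polyfun (fun v => \sum_(i <- r | Q i) F i v).
Proof.
move=> h; elim: r => [|i r IH].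
  by apply: polyfun_ext (polyfun_cst 0) => v; rewrite big_nil.
apply: (@polyfun_ext (fun v => (if Q i then F i v else 0) + \sum_(j <- r | Q j) F j v)).
  by move=> v; rewrite big_cons; case: (Q i); rewrite ?add0r.
apply: polyfunD => //; case: (boolP (Q i)) => [/h //|_]; exact: polyfun_cst.
Qed.
Lemma polyfun_prod (I : Type) (r : seq I) (Q : pred I) (F : I -> ('I_l -> C) -> C) :
  (forall i, Q i -> polyfun (F i)) -> polyfun (fun v => \prod_(i <- r | Q i) F i v).
Proof.
move=> h; elim: r => [|i r IH].
  by apply: polyfun_ext (polyfun_cst 1) => v; rewrite big_nil.
apply: (@polyfun_ext (fun v => (if Q i then F i v else 1) * \prod_(j <- r | Q j) F j v)).
  by move=> v; rewrite big_cons; case: (Q i); rewrite ?mul1r.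
apply: polyfunM => //; case: (boolP (Q i)) => [/h //|_]; exact: polyfun_cst.
Qed.
Lemma polyfun_det r (M : ('I_l -> C) -> 'M[C]_r) :
  (forall i j, polyfun (fun v => M v i j)) -> polyfun (fun v => \det (M v)).
Proof.
move=> h; rewrite /determinant; apply: polyfun_sum => s _; apply: polyfunZ.
by apply: polyfun_prod => i _; apply: h.
Qed.
Lemma polyfun_comp k (P : {mpoly C[k]}) (g : 'I_k -> ('I_l -> C) -> C) :
  (forall i, polyfun (g i)) -> polyfun (fun v => P.@[fun i => g i v]).
Proof.
move=> h; apply: (@polyfun_ext (fun v =>
   \sum_(m <- msupp P) P@_m * \prod_(i < k) g i v ^+ m i)).
  by move=> v; rewrite mevalE.
apply: polyfun_sum => m _; apply: polyfunZ; apply: polyfun_prod => i _.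
exact: polyfunX.
Qed.
Lemma polyfun_mulmx a b c (M : ('I_l -> C) -> 'M[C]_(a, b))
    (N : ('I_l -> C) -> 'M[C]_(b, c)) :
  (forall i j, polyfun (fun v => M v i j)) -> (forall i j, polyfun (fun v => N v i j)) ->
  forall i j, polyfun (fun v => (M v *m N v) i j).
Proof.
move=> hM hN i j; apply: (@polyfun_ext (fun v => \sum_k M v i k * N v k j)).
  by move=> v; rewrite mxE.
by apply: polyfun_sum => k _; apply: polyfunM.
Qed.
Lemma polyfun_adj r (M : ('I_l -> C) -> 'M[C]_r) :
  (forall i j, polyfun (fun v => M v i j)) ->
  forall i j, polyfun (fun v => (\adj (M v)) i j).
Proof.
move=> h i j; apply: (@polyfun_ext (fun v =>
   (-1) ^+ (j + i) * \det (row' j (col' i (M v))))).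
  by move=> v; rewrite mxE.
apply: polyfunZ; apply: polyfun_det => a b.
by apply: polyfun_ext (h (lift j a) (lift i b)) => v; rewrite !mxE.
Qed.

(* Functions that become polynomial after multiplication by a power of [w]. *)
Definition ratfun (w : {mpoly C[l]}) f : Prop :=
  exists (B : {mpoly C[l]}) (K : nat),
    forall v, w.@[v] != 0 -> f v = B.@[v] / w.@[v] ^+ K.

Lemma ratfun_ext w f g :
  (forall v, w.@[v] != 0 -> f v = g v) -> ratfun w f -> ratfun w g.
Proof. by move=> e [B [K h]]; exists B, K => v wv; rewrite -e // h. Qed.
Lemma ratfun_poly w f : polyfun f -> ratfun w f.
Proof. by case=> P h; exists P, 0%N => v _; rewrite expr0 divr1. Qed.
Lemma ratfunD w f g : ratfun w f -> ratfun w g -> ratfun w (fun v => f v + g v).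
Proof.
move=> [B [K h]] [B' [K' h']]; exists (B * w ^+ K' + B' * w ^+ K), (K + K')%N => v wv.
rewrite h // h' // mevalD !mevalM !rmorphXn /= addf_div ?expf_neq0 // exprD //.
Qed.
Lemma ratfunM w f g : ratfun w f -> ratfun w g -> ratfun w (fun v => f v * g v).
Proof.
move=> [B [K h]] [B' [K' h']]; exists (B * B'), (K + K')%N => v wv.
by rewrite h // h' // mevalM exprD mulf_div.
Qed.
Lemma ratfun_comp w k (P : {mpoly C[k]}) (g : 'I_k -> ('I_l -> C) -> C) :
  (forall i, ratfun w (g i)) -> ratfun w (fun v => P.@[fun i => g i v]).
Proof.
move=> h; elim/mpolyind: P => [|c m P _ _ IH].
  by apply: (@ratfun_ext w (fun=> 0)) => [v _|]; [rewrite meval0|apply/ratfun_poly/polyfun_cst].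
apply: (@ratfun_ext w (fun v => c * \prod_(i < k) g i v ^+ m i + P.@[fun i => g i v])).
  by move=> v _; rewrite mevalD mevalZ mevalX.
apply: ratfunD => //; apply: ratfunM; first exact/ratfun_poly/polyfun_cst.
elim: (index_enum _) => [|i r IHr].
  by apply: (@ratfun_ext w (fun=> 1)) => [v _|]; [rewrite big_nil|apply/ratfun_poly/polyfun_cst].
apply: (@ratfun_ext w (fun v => g i v ^+ m i * \prod_(j <- r) g j v ^+ m j)).
  by move=> v _; rewrite big_cons.
apply: ratfunM => //; elim: (m i) => [|e IHe].
  by apply: (@ratfun_ext w (fun=> 1)) => [v _|]; [rewrite expr0|apply/ratfun_poly/polyfun_cst].
by apply: (@ratfun_ext w (fun v => g i v * g i v ^+ e)) => [v _|]; [rewrite exprS|apply: ratfunM].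
Qed.
Lemma ratfun_ext0 w w2 f : ratfun w f -> w2 != 0 ->
  (forall v, w.@[v] != 0 -> w2.@[v] != 0 -> f v = 0) ->
  forall v, w.@[v] != 0 -> f v = 0.
Proof.
move=> [B [K h]] w20 f0 v wv.
have w0 : w != 0 by apply: contraNneq wv => ->; rewrite meval0.
have -> := h _ wv; suff -> : B = 0 by rewrite meval0 mul0r.
apply: (@mpoly_ext0 _ _ (w * w2)); first by rewrite mulf_neq0.
move=> u; rewrite mevalM mulf_eq0 negb_or => /andP[wu w2u].
have := f0 _ wu w2u; rewrite h // => /eqP; rewrite mulf_eq0 invr_eq0 expf_eq0.
by rewrite (negbTE wu) andbF orbF => /eqP.
Qed.
Lemma ratfun_nonzero w f v : ratfun w f -> w.@[v] != 0 -> f v != 0 ->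
  exists2 B : {mpoly C[l]}, B.@[v] != 0 & forall u, B.@[u] != 0 -> w.@[u] != 0 /\ f u != 0.
Proof.
move=> [B [K h]] wv; rewrite h // mulf_eq0 negb_or => /andP[Bv _].
exists (B * w); first by rewrite mevalM mulf_neq0.
move=> u; rewrite mevalM mulf_eq0 negb_or => /andP[Bu wu]; split=> //.
by rewrite h // mulf_neq0 // invr_eq0 expf_neq0.
Qed.
End Polyfun.

End PolynomialFunctions.

(** ** The Nullstellensatz over an uncountable field *)

Section Nullstellensatz.
Variable C : numClosedFieldType.

(** There are more polynomials than monomials of degree below [D], so the matrix of coefficients has
    a nonzero left kernel. *)
Lemma mpoly_lin_dep l r D (f : 'I_r -> {mpoly C[l]}) :
  (forall i, msize (f i) <= D)%N -> (#|{: 'X_{1..l < D}}| < r)%N ->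
  exists v : 'I_r -> C, (exists i, v i != 0) /\ \sum_i v i *: f i = 0.
Proof.
move=> hD hr; pose A : 'M[C]_(r, #|{: 'X_{1..l < D}}|) :=
  \matrix_(i, j) (f i)@_(bmnm (enum_val j)).
have: kermx A != 0.
  rewrite -mxrank_eq0 mxrank_ker subn_eq0 -ltnNge.
  exact: leq_ltn_trans (rank_leq_col _) hr.
case/rowV0Pn => v /sub_kermxP vA v0; exists (fun i => v 0 i); split.
  apply: contrapT => h; case/eqP: v0; apply/rowP => i; rewrite mxE.
  by apply: contrapT => /eqP vi; apply: h; exists i.
apply/mpolyP => m; rewrite mcoeff0 raddf_sum /=.
case: (ltnP (mdeg m) D) => [mD|mD]; last first.
  rewrite big1 // => i _; rewrite mcoeffZ memN_msupp_eq0 ?mulr0 //.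
  by apply/msize_mdeg_ge/(leq_trans (hD i)).
have /rowP/(_ (enum_rank (BMultinom mD))) := vA; rewrite !mxE => e; rewrite -[RHS]e.
by apply: eq_bigr => i _; rewrite mcoeffZ mxE enum_rankK.
Qed.

Definition is_ideal l (a : {mpoly C[l]} -> Prop) :=
  [/\ a 0, forall p q, a p -> a q -> a (p + q) & forall p q, a p -> a (q * p)].

Lemma ideal_sum l (a : {mpoly C[l]} -> Prop) (I : Type) (r : seq I) (F : I -> {mpoly C[l]}) :
  is_ideal a -> (forall i, a (F i)) -> a (\sum_(i <- r) F i).
Proof.
by move=> [a0 aD aM] h; elim: r => [|i r IH]; rewrite ?big_nil ?big_cons //; apply: aD.
Qed.

Definition uncountable := forall u : nat -> C, exists c, forall k, u k <> c.

(** Otherwise each fibre is covered by a finite list, and these countably many lists together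
    enumerate the field. *)
Lemma large_fiber (T : countType) (g : C -> T) (M : T -> nat) : uncountable ->
  exists (t : T) (s : seq C), [/\ uniq s, size s = M t & forall c, c \in s -> g c = t].
Proof.
move=> hC; apply: contrapT => hno.
have hfin t : exists s : seq C, forall c, g c = t -> c \in s.
  apply: contrapT => h; apply: hno; exists t.
  elim: (M t) => [|k [s [us ss hs]]]; first by exists [::].
  have [c [gc cs]] : exists c, g c = t /\ c \notin s.
    apply: contrapT => h'; apply: h; exists s => c gc.
    by apply: contrapT => /negP cs; apply: h'; exists c.
  exists (c :: s); split; rewrite /= ?cs ?ss // => b.
  by rewrite inE => /orP[/eqP -> //|/hs].
have /choice[L hL] := hfin.
have [c hc] := hC (fun k => if unpickle k is Some (t, i) then nth 0 (L t) i else 0).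
have := hL _ _ (erefl (g c)); move/(nthP 0) => [i _ hi].
by apply: (hc (pickle (g c, i))); rewrite pickleK.
Qed.

Section Step.
Variables (l : nat) (a : {mpoly C[l]} -> Prop) (I : {mpoly C[l]}) (i : 'I_l).
Hypotheses (ha : is_ideal a) (hC : uncountable).

Definition add_coord (c : C) (P : {mpoly C[l]}) : Prop :=
  exists2 p, a p & exists u, P = p + u * ('X_i - c%:MP).

Lemma add_coord_ideal c : is_ideal (add_coord c).
Proof.
case: ha => a0 aD aM; split.
- by exists 0 => //; exists 0; rewrite mul0r addr0.
- move=> p q [p' hp [u ->]] [q' hq [v ->]]; exists (p' + q'); first exact: aD.
  by exists (u + v); rewrite mulrDl addrACA.
- move=> p q [p' hp [u ->]]; exists (q * p'); first exact: aM.
  by exists (q * u); rewrite mulrDr mulrA.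
Qed.

(* If every [X_i - c] were invertible modulo [a] after inverting [I], then uncountably
   many of the inverses would have bounded degree, hence be linearly dependent. *)
Lemma add_coord_avoid : (forall k, ~ a (I ^+ k)) ->
  exists c, forall k, ~ add_coord c (I ^+ k).
Proof.
case: (ha) => a0 aD aM hI; apply: contrapT => hno.
have /choice[F hF] : forall c, exists ku : nat * {mpoly C[l]},
    a (I ^+ ku.1 - ku.2 * ('X_i - c%:MP)).
  move=> c; apply: contrapT => h; apply: hno; exists c => k [p hp [u e]].
  by apply: h; exists (k, u); rewrite /= e addrK.
pose g c := ((F c).1, msize (F c).2).
have [[j D] [s [us ss hs]]] :=
  large_fiber g (fun t => (#|{: 'X_{1..l < t.2}}|).+1) hC.
pose t (r : 'I_(size s)) := s`_r.
have hg r : g (t r) = (j, D) by apply/hs/mem_nth.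
have [||v [[r0 vr0] hv]] := @mpoly_lin_dep l (size s) D (fun r => (F (t r)).2) _ _.
- by move=> r; have [_ ->] := hg r.
- by rewrite ss.
(* The numerator of the sum of the fractions [v r / (X - t r)]. It is nonzero because only the term
   [r0] survives at [t r0]. *)
pose G : {poly C} := \sum_(r < size s) v r *: \prod_(q < size s | q != r) ('X - (t q)%:P).
have G0 : G != 0.
  apply: contraNneq vr0 => /(congr1 (fun p => p.[t r0])).
  rewrite horner0 horner_sum (bigD1 r0) //= [X in _ + X]big1 => [|r rr0]; last first.
    rewrite hornerZ horner_prod (bigD1 r0) 1?eq_sym //= hornerXsubC subrr mul0r mulr0 //.
  rewrite addr0 hornerZ horner_prod => /eqP; rewrite mulf_eq0 => /orP[//|].
  rewrite prodf_seq_eq0 => /hasP[q _ /andP[qr]]; rewrite hornerXsubC subr_eq0.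
  by rewrite /t nth_uniq // => /eqP/val_inj e; rewrite e eqxx in qr.
pose ev (p : {poly C}) : {mpoly C[l]} := (map_poly (@mpolyC l C) p).['X_i].
have evM p q : ev (p * q) = ev p * ev q by rewrite /ev rmorphM hornerM.
have evX c : ev ('X - c%:P) = 'X_i - c%:MP.
  by rewrite /ev rmorphB /= map_polyX map_polyC hornerXsubC.
have evp (Q : pred 'I_(size s)) :
    ev (\prod_(q | Q q) ('X - (t q)%:P)) = \prod_(q | Q q) ('X_i - (t q)%:MP).
  rewrite /ev rmorph_prod horner_prod; apply: eq_bigr => q _.
  by rewrite -evX.
(* Modulo [a], [I ^+ j] may be replaced in the term [r] by [u_r * ('X_i - t r)], where [u_r] is the
   approximate inverse [(F (t r)).2]. The sum then becomes the product of all the factors times the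
   vanishing combination [hv]. *)
have aG : a (I ^+ j * ev G).
  have -> : I ^+ j * ev G = \sum_(r < size s)
      (v r *: \prod_(q < size s | q != r) ('X_i - (t q)%:MP)) *
        (I ^+ (F (t r)).1 - (F (t r)).2 * ('X_i - (t r)%:MP)).
    rewrite /ev raddf_sum horner_sum mulr_sumr.
    under [RHS]eq_bigr => r _ do rewrite mulrBr.
    rewrite sumrB [X in _ = _ - X](_ : _ = 0) ?subr0.
      apply: eq_bigr => r _; have [-> _] := hg r.
      rewrite /= map_polyZ /= hornerZ -/(ev _) evp mulrC.
      by rewrite mul_mpolyC.
    transitivity ((\sum_r v r *: (F (t r)).2) * \prod_q ('X_i - (t q)%:MP)).
      rewrite mulr_suml; apply: eq_bigr => r _.
      rewrite [in RHS](bigD1 r) //= -!scalerAl; congr (_ *: _).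
      by rewrite mulrC -mulrA.
    by rewrite hv mul0r.
  by apply: ideal_sum => // r; apply: aM; apply: hF.
have [bs hbs] := closed_field_poly_normal G.
have : a (I ^+ j * \prod_(b <- bs) ('X_i - b%:MP)).
  have -> : \prod_(b <- bs) ('X_i - b%:MP) = ev ((lead_coef G)^-1%:P * G).
    rewrite mul_polyC {2}hbs scalerA mulVf ?lead_coef_eq0 // scale1r.
    by rewrite /ev rmorph_prod horner_prod; apply: eq_bigr => b _; rewrite -evX.
  by rewrite evM mulrCA; apply: aM.
(* [G] splits into linear factors, and each factor ['X_i - b] can be removed by its approximate
   inverse at the cost of a further power of [I]. In the end a power of [I] would lie in [a]. *)
suff key : forall (cs : seq C) e, ~ a (I ^+ e * \prod_(b <- cs) ('X_i - b%:MP)).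
  exact: key.
elim=> [|b cs IH] e.
  by rewrite big_nil mulr1; apply: hI.
rewrite big_cons => h; apply: (IH (e + (F b).1)%N); rewrite exprD.
set P := \prod_(c <- cs) _ in h *.
have := aD _ _ (aM _ (F b).2 h) (aM _ (I ^+ e * P) (hF b)).
congr a; rewrite mulrBr; set X := 'X_i - _; set u := (F b).2.
have -> : u * (I ^+ e * (X * P)) = I ^+ e * P * (u * X).
  by ring.
by rewrite addrC subrK mulrAC.
Qed.
End Step.

(** If no power of [I] lies in [a], adjoin some ['X_i - c] for one coordinate after another while
    keeping this property. The enlarged ideal contains [P - P(x)] for a point [x], and no nonzero
    constant, so [x] is a zero of [a]; then [I] vanishes at [x] and lies in the ideal after all. *)
Theorem nullstellensatz l (a : {mpoly C[l]} -> Prop) (I : {mpoly C[l]}) :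
  uncountable -> is_ideal a ->
  (forall x, (forall P, a P -> P.@[x] = 0) -> I.@[x] = 0) -> exists k, a (I ^+ k).
Proof.
move=> hC ha hx; apply: contrapT => hno.
have {}hno k : ~ a (I ^+ k) by move=> h; apply: hno; exists k.
have [b [hb ab bI bX]] : exists b : {mpoly C[l]} -> Prop, [/\ is_ideal b,
   forall P, a P -> b P, forall k, ~ b (I ^+ k) &
   forall i, i \in index_enum 'I_l -> exists c, b ('X_i - c%:MP)].
  elim: (index_enum _) => [|i s [b [hb ab bI bX]]]; first by exists a.
  have [c hc] := add_coord_avoid i hb hC bI.
  have sub P : b P -> add_coord b i c P.
    by move=> bP; exists P => //; exists 0; rewrite mul0r addr0.
  exists (add_coord b i c); split=> //; first exact: add_coord_ideal.
  - by move=> P /ab/sub.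
  - move=> j; rewrite inE => /orP[/eqP ->|/bX[c' h]]; last by exists c'; apply: sub.
    by exists c; case: hb => b0 _ _; exists 0 => //; exists 1; rewrite mul1r add0r.
have /choice[x hX] : forall i, exists c, b ('X_i - c%:MP).
  by move=> i; apply: bX; rewrite mem_index_enum.
case: (hb) => b0 bD bM.
have bZ c p : b p -> b (c *: p) by rewrite -mul_mpolyC; apply: bM.
have bmul p q c d : b (p - c%:MP) -> b (q - d%:MP) -> b (p * q - (c * d)%:MP).
  move=> h1 h2; have := bD _ _ (bM _ q h1) (bM _ c%:MP h2); congr b.
  by rewrite !mulrBr rmorphM /= mulrC addrA [q * c%:MP]mulrC subrK.
have bcongr P : b (P - P.@[x]%:MP).
  elim/mpolyind: P => [|c m p _ _ IH]; first by rewrite meval0 subr0.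
  rewrite mevalD mevalZ rmorphD rmorphM /= opprD addrACA; apply: bD => //.
  rewrite mul_mpolyC -scalerBr; apply: bZ; rewrite mevalX mpolyXE_id.
  elim: (index_enum _) => [|i r IHr]; first by rewrite !big_nil subrr.
  rewrite !big_cons; apply: (bmul) => //.
  elim: (m i) => [|e IHe]; first by rewrite !expr0 subrr.
  by rewrite !exprS; apply: (bmul).
have b1 c : b c%:MP -> c = 0.
  move=> h; apply: contrapT => /eqP c0; apply: (bI 0%N); rewrite expr0.
  by have := bZ c^-1 _ h; rewrite -mul_mpolyC -rmorphM mulVf.
apply: (bI 1%N); rewrite expr1; have := bcongr I; rewrite hx ?subr0 // => P aP.
apply: b1; have := bD _ _ (ab _ aP) (bZ (-1) _ (bcongr P)); congr b.
by rewrite scaleN1r opprB addrC subrK.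
Qed.

End Nullstellensatz.

(** ** Images and fibres of rational maps *)

Section Chevalley.
Variable C : numClosedFieldType.

Lemma term_of_mpoly k s (p : {mpoly C[k]}) :
  exists t : GRing.term C, GRing.rterm t /\
    forall e, GRing.eval e t = p.@[fun i : 'I_k => e`_(s + i)].
Proof.
elim/mpolyind: p => [|c m p _ _ [t [rt ht]]].
  by exists (GRing.Const 0); split=> // e; rewrite meval0.
have [u [ru hu]] : exists u : GRing.term C, GRing.rterm u /\ forall e,
    GRing.eval e u = \prod_(i < k) e`_(s + i) ^+ m i.
  elim: (index_enum _) => [|i r [u [ru hu]]].
    by exists (GRing.Const 1); split=> // e; rewrite big_nil.
  exists (GRing.Mul (GRing.Exp (GRing.Var _ (s + i)) (m i)) u); split=> // e.
  by rewrite big_cons /= hu.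
exists (GRing.Add (GRing.Mul (GRing.Const c) u) t); split=> [|e] /=; first by rewrite ru.
by rewrite mevalD mevalZ mevalX hu ht.
Qed.

Definition env L (y : 'I_L -> C) : seq C := [seq y i | i <- enum 'I_L].

Lemma nth_env L (y : 'I_L -> C) (i : 'I_L) : (env y)`_i = y i.
Proof. by rewrite (nth_map i) ?size_enum_ord // nth_ord_enum. Qed.

Lemma size_env L (y : 'I_L -> C) : size (env y) = L.
Proof. by rewrite size_map size_enum_ord. Qed.

Lemma mpoly_of_term L (t : GRing.term C) : GRing.rterm t ->
  exists p : {mpoly C[L]}, forall y, GRing.eval (env y) t = p.@[y].
Proof.
elim: t => //=.
- move=> i _; case: (ltnP i L) => iL.
    by exists 'X_(Ordinal iL) => y; rewrite mevalXU -(nth_env y (Ordinal iL)).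
  by exists 0 => y; rewrite meval0 nth_default // size_env.
- by move=> c _; exists c%:MP => y; rewrite mevalC.
- by move=> c _; exists c%:R%:MP => y; rewrite mevalC.
- move=> t1 IH1 t2 IH2 /andP[/IH1[p hp] /IH2[q hq]].
  by exists (p + q) => y; rewrite mevalD hp hq.
- by move=> t IH /IH[p hp]; exists (- p) => y; rewrite mevalN hp.
- by move=> t IH k /IH[p hp]; exists (p *+ k) => y; rewrite mevalMn hp.
- move=> t1 IH1 t2 IH2 /andP[/IH1[p hp] /IH2[q hq]].
  by exists (p * q) => y; rewrite mevalM hp hq.
- by move=> t IH k /IH[p hp]; exists (p ^+ k) => y; rewrite rmorphXn /= hp.
Qed.

(** A quantifier-free formula is a Boolean combination of polynomial equations, so only the
    vanishing pattern of finitely many polynomials matters. *)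
Lemma qf_eval_mpoly L (f : GRing.formula C) : GRing.qf_form f -> GRing.rformula f ->
  exists s : seq {mpoly C[L]}, forall y y',
    (forall p, p \in s -> (p.@[y] == 0) = (p.@[y'] == 0)) ->
    GRing.qf_eval (env y) f = GRing.qf_eval (env y') f.
Proof.
have cat (s1 s2 : seq {mpoly C[L]}) (y y' : 'I_L -> C) :
    (forall p, p \in s1 ++ s2 -> (p.@[y] == 0) = (p.@[y'] == 0)) ->
    (forall p, p \in s1 -> (p.@[y] == 0) = (p.@[y'] == 0)) /\
    (forall p, p \in s2 -> (p.@[y] == 0) = (p.@[y'] == 0)).
  by move=> h; split=> p ps; apply: h; rewrite mem_cat ps ?orbT.
elim: f => //=.
- by move=> b _ _; exists [::].
- move=> t1 t2 _ /andP[/(mpoly_of_term L)[p hp] /(mpoly_of_term L)[q hq]].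
  exists [:: p - q] => y y' /(_ _ (mem_head _ _)); rewrite !hp !hq !mevalB.
  by rewrite !subr_eq0.
- move=> f1 IH1 f2 IH2 /andP[q1 q2] /andP[r1 r2].
  have [s1 h1] := IH1 q1 r1; have [s2 h2] := IH2 q2 r2.
  by exists (s1 ++ s2) => y y' /cat[/h1 -> /h2 ->].
- move=> f1 IH1 f2 IH2 /andP[q1 q2] /andP[r1 r2].
  have [s1 h1] := IH1 q1 r1; have [s2 h2] := IH2 q2 r2.
  by exists (s1 ++ s2) => y y' /cat[/h1 -> /h2 ->].
- move=> f1 IH1 f2 IH2 /andP[q1 q2] /andP[r1 r2].
  have [s1 h1] := IH1 q1 r1; have [s2 h2] := IH2 q2 r2.
  by exists (s1 ++ s2) => y y' /cat[/h1 -> /h2 ->].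
- by move=> f IH qf rf; have [s h] := IH qf rf; exists s => y y' /h ->.
Qed.

(** Variables [0 .. L - 1] of the formula hold the target point [y]; variables [L .. L + k - 1] hold
    the source point [x] and are quantified existentially. *)
Lemma image_formula k L (a : 'I_L -> {mpoly C[k]}) (w : {mpoly C[k]}) :
  exists f : GRing.formula C, GRing.rformula f /\ forall y : 'I_L -> C,
    GRing.holds (env y) f <->
    exists x, w.@[x] != 0 /\ forall i, y i * w.@[x] = (a i).@[x].
Proof.
have [tw [rw hw]] := term_of_mpoly L w.
have /choice[ta hta] := fun i => term_of_mpoly L (a i).
have [b [rb hb]] : exists b : GRing.formula C, GRing.rformula b /\ forall e,
    GRing.holds e b <-> forall i : 'I_L, i \in index_enum 'I_L ->
       e`_i * w.@[fun j : 'I_k => e`_(L + j)] = (a i).@[fun j : 'I_k => e`_(L + j)].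
  elim: (index_enum _) => [|i r [b [rb hb]]].
    by exists (GRing.Bool true); split.
  have [ri hi] := hta i.
  exists (GRing.And (GRing.Equal (GRing.Mul (GRing.Var _ i) tw) (ta i)) b).
  split=> [|e] /=; first by rewrite rw ri.
  rewrite hb hw hi; split=> [[h1 h2] j|h].
    by rewrite inE => /orP[/eqP ->|/h2].
  by split=> [|j jr]; apply: h; rewrite inE ?eqxx ?jr ?orbT.
pose body := GRing.And (GRing.Not (GRing.Equal tw (GRing.Const 0))) b.
exists (foldr GRing.Exists body (iota L k)); split.
  by elim: (iota _ _) => [|j r IH] //=; rewrite rw rb.
move=> y; rewrite -GRing.foldExistsP; split=> [[e' he' /= [w0 /hb he]]|[x [wx hx]]].
  exists (fun j => e'`_(L + j)); split; first by apply/eqP; rewrite -hw.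
  move=> i; rewrite -he ?mem_index_enum // -he' ?nth_env //.
  by rewrite inE /= mem_iota leqNgt ltn_ord.
exists (env y ++ env x).
  move=> i; rewrite inE /= mem_iota negb_and -ltnNge -leqNgt => /orP[iL|ik].
    by rewrite nth_cat size_env iL.
  rewrite !nth_default // ?size_cat !size_env //.
  by apply: leq_trans ik; apply: leq_addr.
have ex j : (env y ++ env x)`_(L + j) = (env x)`_j.
  by rewrite nth_cat size_env ltnNge leq_addr /= addKn.
have e2 (p : {mpoly C[k]}) : p.@[fun j : 'I_k => (env y ++ env x)`_(L + j)] = p.@[x].
  by apply: meval_eq => j; rewrite ex nth_env.
split=> /=; first by rewrite hw e2; apply/eqP.
by apply/hb => i _; rewrite !e2 -hx nth_cat size_env ltn_ord nth_env.
Qed.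

Section Image.
Variables (k L : nat) (a : 'I_L -> {mpoly C[k]}) (w : {mpoly C[k]}).
Hypothesis w0 : w != 0.
Let phi (x : 'I_k -> C) (i : 'I_L) : C := (a i).@[x] / w.@[x].

Lemma ratfun_image (P : {mpoly C[L]}) : ratfun w (fun x => P.@[phi x]).
Proof.
apply: ratfun_comp => i; exists (a i), 1%N => v _; by rewrite expr1.
Qed.

(** Irreducibility of affine space: two nonempty principal open sets meet. *)
Lemma ratfun_common (w' : {mpoly C[k]}) f g x1 x2 : ratfun w' f -> ratfun w' g ->
  w'.@[x1] != 0 -> f x1 != 0 -> w'.@[x2] != 0 -> g x2 != 0 ->
  exists x, [/\ w'.@[x] != 0, f x != 0 & g x != 0].
Proof.
move=> rf rg wx1 fx1 wx2 gx2.
have [B1 B1x h1] := ratfun_nonzero rf wx1 fx1.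
have [B2 B2x h2] := ratfun_nonzero rg wx2 gx2.
have [x] : exists x, (B1 * B2).@[x] != 0.
  apply: mpoly_nonroot; rewrite mulf_neq0 //.
    by apply: contraNneq B1x => ->; rewrite meval0.
  by apply: contraNneq B2x => ->; rewrite meval0.
rewrite mevalM mulf_eq0 negb_or => /andP[/h1[wx fx] /h2[_ gx]].
by exists x.
Qed.

Definition im_vanish (P : {mpoly C[L]}) := forall x, w.@[x] != 0 -> P.@[phi x] = 0.

(* The image of [phi] contains a nonempty open subset of its Zariski closure. *)
Lemma chevalley : exists h : {mpoly C[L]},
  ~ im_vanish h /\ forall y, h.@[y] != 0 -> (forall P, im_vanish P -> P.@[y] = 0) ->
    exists x, w.@[x] != 0 /\ y =1 phi x.
Proof.
have [f [rf hf]] := image_formula a w.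
pose cl := @solve_monicpoly C.
have wf := @ClosedFieldQE.wf_ex_elim C; have ok := ClosedFieldQE.holds_ex_elim cl.
pose g := GRing.quantifier_elim (@ClosedFieldQE.ex_elim C) f.
have /andP[qg rg] : GRing.qf_form g && GRing.rformula g by apply: GRing.quantifier_elim_wf.
have hg y : reflect (GRing.holds (env y) f) (GRing.qf_eval (env y) g).
  exact: (GRing.quantifier_elim_rformP wf ok).
have [s hs] := qf_eval_mpoly L qg rg.
(* The polynomials of [s] that vanish identically on the image also vanish on its closure; the
   product of the others is [h]. Where [h] is nonzero, points of the closure have the same pattern
   as the image point of [x0]. *)
have [h [x0 [wx0 hx0 hyp]]] : exists (h : {mpoly C[L]}) x0, [/\ w.@[x0] != 0,
    h.@[phi x0] != 0 & forall y, h.@[y] != 0 -> (forall P, im_vanish P -> P.@[y] = 0) ->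
    forall p, p \in s -> (p.@[y] == 0) = (p.@[phi x0] == 0)].
  elim: s {hs} => [|p s [h [x0 [wx0 hx0 IH]]]].
    have [x wx] := mpoly_nonroot w0.
    by exists 1, x; split=> //; rewrite ?meval1 ?oner_eq0.
  case: (pselect (im_vanish p)) => [pv|/existsNP[x1 hx1]].
    exists h, x0; split=> // y hy yv q; rewrite inE => /orP[/eqP ->|qs].
      by rewrite !pv // yv.
    exact: IH.
  have [wx1 /eqP px1] : w.@[x1] != 0 /\ p.@[phi x1] <> 0 by apply/not_implyP.
  have [x [wx hx px]] := ratfun_common (ratfun_image h) (ratfun_image p) wx0 hx0 wx1 px1.
  exists (h * p), x; split=> //; first by rewrite mevalM mulf_neq0.
  move=> y; rewrite mevalM mulf_eq0 negb_or => /andP[hy py] yv q.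
  rewrite inE => /orP[/eqP ->|qs]; first by rewrite (negbTE py) (negbTE px).
  by rewrite (IH y) // (IH (phi x)) // => P; apply.
exists h; split=> [/(_ _ wx0)/eqP|y hy yv]; first by rewrite (negbTE hx0).
have : GRing.holds (env y) f.
  apply/hg; rewrite (hs _ _ (hyp y hy yv)); apply/hg/hf; exists x0; split=> // i.
  by rewrite /phi divfK.
case/hf => x [wx hx]; exists x; split=> // i.
by rewrite /phi -hx mulfK.
Qed.
End Image.
End Chevalley.

(** * Algebraicity and rationality of one coordinate of an image over the others *)

Section ImageFibres.
Variable C : numClosedFieldType.

Section Fibres.
Variables (k L : nat) (a : 'I_L.+1 -> {mpoly C[k]}) (w : {mpoly C[k]}).
Hypothesis w0 : w != 0.

Definition graph_base (x : 'I_k -> C) (i : 'I_L) : C :=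
  (a (widen_ord (leqnSn L) i)).@[x] / w.@[x].
Definition graph_val (x : 'I_k -> C) : C := (a ord_max).@[x] / w.@[x].
Local Notation u := graph_base.
Local Notation v := graph_val.

Lemma graph_vcons x : (fun i => (a i).@[x] / w.@[x]) =1 vcons (u x) (v x).
Proof.
move=> i; case: (unliftP ord_max i) => [j ->|->]; last by rewrite vcons_max.
have -> : lift ord_max j = widen_ord (leqnSn L) j.
  by apply: val_inj; rewrite /= /bump leqNgt ltn_ord.
by rewrite vcons_widen.
Qed.

Implicit Types P Q : {poly {mpoly C[L]}}.

Definition vanishing_graph (P : {poly {mpoly C[L]}}) :=
  forall x, w.@[x] != 0 -> (pev P (u x)).[v x] = 0.
Definition vanishing_base (c : {mpoly C[L]}) :=
  forall x, w.@[x] != 0 -> c.@[u x] = 0.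
Local Notation vanW := vanishing_graph.
Local Notation nulc := vanishing_base.

Lemma pevM (P Q : {poly {mpoly C[L]}}) y : pev (P * Q) y = pev P y * pev Q y.
Proof. by rewrite /pev rmorphM. Qed.
Lemma pevD (P Q : {poly {mpoly C[L]}}) y : pev (P + Q) y = pev P y + pev Q y.
Proof. by rewrite /pev rmorphD. Qed.
Lemma pevB (P Q : {poly {mpoly C[L]}}) y : pev (P - Q) y = pev P y - pev Q y.
Proof. by rewrite /pev rmorphB. Qed.
Lemma pevZ c (P : {poly {mpoly C[L]}}) y : pev (c *: P) y = c.@[y] *: pev P y.
Proof. by rewrite /pev map_polyZ. Qed.

Lemma ratfun_graph P : ratfun w (fun x => (pev P (u x)).[v x]).
Proof.
have rv : ratfun w v by exists (a ord_max), 1%N => x _; rewrite expr1.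
have ru i : ratfun w (fun x => u x i).
  by exists (a (widen_ord (leqnSn L) i)), 1%N => x _; rewrite expr1.
elim/poly_ind: P => [|P c IH].
  apply: (@ratfun_ext _ _ _ (fun=> 0)) => [x _|].
    by rewrite /pev rmorph0 horner0.
  exact/ratfun_poly/polyfun_cst.
apply: (@ratfun_ext _ _ _ (fun x => (pev P (u x)).[v x] * v x + c.@[u x])).
  by move=> x _; rewrite /pev rmorphD rmorphM /= map_polyX map_polyC hornerMXaddC.
by apply: ratfunD; [apply: ratfunM|apply: ratfun_comp].
Qed.

(** The relations of the graph form a prime ideal, because the parameter space is irreducible. *)
Lemma vanishing_graphM P Q : vanW (P * Q) -> vanW P \/ vanW Q.
Proof.
move=> h; apply: contrapT => /not_orP[/existsNP[x1 hx1] /existsNP[x2 hx2]].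
have [wx1 /eqP p1] : w.@[x1] != 0 /\ (pev P (u x1)).[v x1] <> 0 by apply/not_implyP.
have [wx2 /eqP p2] : w.@[x2] != 0 /\ (pev Q (u x2)).[v x2] <> 0 by apply/not_implyP.
have [x [wx px qx]] := ratfun_common (ratfun_graph P) (ratfun_graph Q) wx1 p1 wx2 p2.
have := h x wx; rewrite pevM hornerM => /eqP.
by rewrite mulf_eq0 (negbTE px) (negbTE qx).
Qed.

Lemma vanishing_base_graph c : vanW c%:P <-> nulc c.
Proof.
split=> h x wx; have := h x wx; rewrite /pev map_polyC hornerC //.
Qed.

Lemma vanishing_baseM c d : nulc (c * d) -> nulc c \/ nulc d.
Proof.
by rewrite -!vanishing_base_graph polyCM; apply: vanishing_graphM.
Qed.

Lemma vanishing_baseX c e : nulc (c ^+ e) -> nulc c.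
Proof.
elim: e => [|e IH h].
  have [x wx] := mpoly_nonroot w0.
  by move=> /(_ x wx) /eqP; rewrite expr0 meval1 oner_eq0.
by move: h; rewrite exprS => /vanishing_baseM[//|/IH].
Qed.

Lemma chevalley_graph : exists h : {poly {mpoly C[L]}}, ~ vanW h /\
  forall y t, (pev h y).[t] != 0 -> (forall P, vanW P -> (pev P y).[t] = 0) ->
    exists x, [/\ w.@[x] != 0, y =1 u x & t = v x].
Proof.
have [h [h1 h2]] := chevalley a w0.
have eP (P : {mpoly C[L.+1]}) x :
    P.@[fun i => (a i).@[x] / w.@[x]] = (pev (muni P) (u x)).[v x].
  by rewrite muni_eval; apply: meval_eq; apply: graph_vcons.
exists (muni h); split=> [h3|y t ht hP].
  by apply: h1 => x wx; rewrite eP h3.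
have [||x [wx hx]] := h2 (vcons y t).
- by rewrite -muni_eval.
- by move=> P vP; rewrite -muni_eval hP // => x wx; rewrite -eP vP.
exists x; split=> // [i|].
  by rewrite -(vcons_widen y t) hx.
by rewrite -(vcons_max y t) hx.
Qed.

(** If all relations had coefficients vanishing on the base, whole vertical lines would satisfy
    them. By [chevalley_graph] all but finitely many points of one such line would then lie in the
    image, against the finiteness of the values of [v] over a base point. *)
Lemma graph_algebraic :
  (forall x0, w.@[x0] != 0 -> exists s : seq C,
     forall x, w.@[x] != 0 -> u x =1 u x0 -> v x \in s) ->
  exists P, vanW P /\ exists i, ~ nulc P`_i.
Proof.
move=> hfin; apply: contrapT => hno.
have van0 P : vanW P -> forall x, w.@[x] != 0 -> pev P (u x) = 0.
  move=> hP x wx; apply/polyP => i; rewrite coef_map coef0.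
  apply: contrapT => hi; apply: hno; exists P; split=> //; exists i => /(_ x wx) //.
have [h [h1 h2]] := chevalley_graph.
have /existsNP[x0 hx0] := h1.
have [wx0 /eqP hh] : w.@[x0] != 0 /\ (pev h (u x0)).[v x0] <> 0 by apply/not_implyP.
have [s hs] := hfin _ wx0.
have h0 : pev h (u x0) != 0 by apply: contraNneq hh => ->; rewrite horner0.
have [t [ht /negP[]]] := poly_nonroot s h0.
have [P vP|x [wx ux ->]] := h2 _ _ ht; first by rewrite van0 // horner0.
by apply: hs => // i; rewrite ux.
Qed.

Lemma trim_base P : exists P' : {poly {mpoly C[L]}}, [/\ (size P' <= size P)%N,
  forall x, w.@[x] != 0 -> pev P' (u x) = pev P (u x) & P' = 0 \/ ~ nulc (lead_coef P')].
Proof.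
have [e] := ubnP (size P); elim: e P => // e IH P; rewrite ltnS => sP.
case: (pselect (nulc (lead_coef P))) => [hl|]; last by exists P; split=> //; right.
have [->|P0] := eqVneq P 0; first by exists 0; split=> //; left.
pose Q := P - lead_coef P *: 'X^((size P).-1).
have sQ : (size Q < size P)%N.
  rewrite -[X in (_ < X)%N]prednK ?size_poly_gt0 // ltnS.
  apply/leq_sizeP => j hj; rewrite coefB coefZ coefXn.
  move: hj; rewrite leq_eqVlt => /orP[/eqP <-|hj].
    by rewrite eqxx mulr1 lead_coefE subrr.
  rewrite gtn_eqF // mulr0 subr0 nth_default //.
  by rewrite -(prednK (n := size P)) ?size_poly_gt0.
have [P' [s1 h1 h2]] := IH Q (leq_trans sQ sP).
exists P'; split=> //; first exact: leq_trans s1 (ltnW sQ).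
by move=> x wx; rewrite h1 // pevB pevZ hl // scale0r subr0.
Qed.

(** Coefficients matter only through their values on the base. Trimming leading coefficients that
    vanish there makes the size behave as a degree over the function field of the base. *)
Lemma minimal_size (S : {poly {mpoly C[L]}} -> Prop) :
  (forall P P', S P -> (forall x, w.@[x] != 0 -> pev P' (u x) = pev P (u x)) -> S P') ->
  (exists P, S P /\ ~ (forall x, w.@[x] != 0 -> pev P (u x) = 0)) ->
  exists P, [/\ S P, ~ nulc (lead_coef P) & forall Q, S Q -> (size Q < size P)%N ->
     forall x, w.@[x] != 0 -> pev Q (u x) = 0].
Proof.
move=> hS [P [SP hP]].
have [e] := ubnP (size P); elim: e P SP hP => // e IH P SP hP; rewrite ltnS => sP.
have [P' [s1 h1 h2]] := trim_base P.
have SP' : S P' by apply: hS SP _.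
case: (pselect (exists Q, [/\ S Q, (size Q < size P')%N &
   ~ (forall x, w.@[x] != 0 -> pev Q (u x) = 0)])) => [[Q [SQ sQ hQ]]|hno].
  by apply: (IH Q) => //; apply: leq_trans sQ (leq_trans s1 sP).
exists P'; split=> //.
  case: h2 => // P'0; case: hP => x wx; by rewrite -h1 // P'0 /pev rmorph0.
move=> Q SQ sQ x wx; apply: contrapT => hx; apply: hno; exists Q; split=> // h.
by apply: hx; apply: h.
Qed.

(** In characteristic 0 the derivative of a relation of minimal positive degree has smaller degree
    and a leading coefficient that does not vanish on the base, so it is not a relation. *)
Lemma graph_separable : (exists P, vanW P /\ exists i, ~ nulc P`_i) ->
  exists mu, [/\ vanW mu, ~ nulc (lead_coef mu), (1 < size mu)%N, ~ vanW mu^`() &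
    forall Q, vanW Q -> (size Q < size mu)%N ->
      forall x, w.@[x] != 0 -> pev Q (u x) = 0].
Proof.
move=> [P0 [vP0 [i0 hi0]]].
have [||mu [vmu lmu mmin]] := @minimal_size vanW.
- by move=> P P' vP e x wx; rewrite e // vP.
- exists P0; split=> // h; apply: hi0 => x wx.
  by have := h x wx => /(congr1 (fun p : {poly C} => p`_i0)); rewrite coef_map coef0.
have smu : (1 < size mu)%N.
  rewrite ltnNge; apply/negP => /size1_polyC e; apply: lmu.
  by rewrite e lead_coefC -vanishing_base_graph -e.
exists mu; split=> // /mmin; rewrite lt_size_deriv -?size_poly_gt0 ?(ltnW smu) //.
move=> /(_ isT) hd; apply: lmu => x wx.
have := hd x wx => /(congr1 (fun p : {poly C} => p`_((size mu).-2))).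
rewrite coef_map coef0 coef_deriv /= raddfMn /= lead_coefE.
have -> : (size mu).-2.+1 = (size mu).-1 by case: (size mu) smu => [|[]].
move/eqP; rewrite mulrn_eq0; case: (size mu) smu => [|[]] //= ? _ /eqP //.
Qed.

(* [v] satisfies a relation of minimal degree over the base whose specializations are
   separable with all their roots in the image, so this degree is one. *)
Lemma graph_rational :
  (forall x0 x, w.@[x0] != 0 -> w.@[x] != 0 -> u x =1 u x0 -> v x = v x0) ->
  exists p q : {mpoly C[L]}, ~ nulc q /\
    forall x, w.@[x] != 0 -> q.@[u x] * v x = p.@[u x].
Proof.
move=> hone.
have [|mu [vmu lmu smu nmu mmin]] := graph_separable.
  apply: graph_algebraic => x0 wx0; exists [:: v x0] => x wx ux.
  by rewrite inE; apply/eqP; apply: hone.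
have [h0 [nh0 hh0]] := chevalley_graph.
have [h hE] : exists h, h = h0 * mu^`() by eexists.
have nh : ~ vanW h by rewrite hE => /vanishing_graphM[].
(* The ideal generated by [h] modulo the relations. Pseudo-division makes its minimal element [ka] a
   common divisor of [mu] and [h] up to factors from the base; as [mu] is a minimal relation and [h]
   is no relation, [ka] is a constant [r], congruent to a multiple of [h]. *)
pose idl (P : {poly {mpoly C[L]}}) := exists S, vanW (P - h * S).
have idlM P Q : idl P -> idl (Q * P).
  move=> [S hS]; exists (Q * S) => x wx; rewrite pevB !pevM.
  have := hS x wx; rewrite pevB pevM hornerD hornerN hornerM => e.
  by rewrite hornerD hornerN !hornerM mulrCA -mulrBr e mulr0.
have idlB P Q : idl P -> idl Q -> idl (P - Q).
  move=> [S hS] [T hT]; exists (S - T) => x wx;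
    rewrite !pevB !pevM !pevB !(hornerD, hornerN, hornerM).
  have := hS x wx; have := hT x wx; rewrite !pevB !pevM !(hornerD, hornerN, hornerM) => e1 e2.
  by rewrite -[RHS](subrr 0) -{1}e2 -e1; ring.
have idlh : idl h by exists 1 => x wx; rewrite mulr1 subrr /pev rmorph0 horner0.
have idlmu : idl mu by exists 0; rewrite mulr0 subr0.
have [||ka [ika lka kmin]] := @minimal_size idl.
- by move=> P P' [S hS] e; exists S => x wx; rewrite pevB e // -pevB hS.
- by exists h; split=> // hz; apply: nh => x wx; rewrite hz // horner0.
have ka0 : ka != 0.
  apply: contra_not_neq lka => -> x wx; by rewrite lead_coef0 meval0.
have lkaX e : ~ nulc (lead_coef ka ^+ e) by move=> /vanishing_baseX.
have div P : idl P -> forall x, w.@[x] != 0 ->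
    (lead_coef ka ^+ scalp P ka).@[u x] *: pev P (u x) = pev (P %/ ka) (u x) * pev ka (u x).
  move=> iP x wx; have e := Pdiv.Idomain.divp_eq P ka.
  have ir : idl (P %% ka).
    have -> : P %% ka = (lead_coef ka ^+ scalp P ka)%:P * P - P %/ ka * ka.
      by rewrite mul_polyC e addrAC subrr add0r.
    by apply: idlB; apply: idlM.
  have r0 := kmin _ ir (ltn_modpN0 _ ka0) x wx.
  by rewrite -pevZ e pevD r0 addr0 pevM.
have ska : size ka = 1%N.
  apply/eqP; rewrite eqn_leq size_poly_gt0 ka0 andbT leqNgt; apply/negP => ska.
  have [] := @vanishing_graphM (mu %/ ka) ka.
  - move=> x wx; rewrite pevM -(div _ idlmu x wx) hornerZ vmu // mulr0 //.
  - move/mmin; rewrite Pdiv.Idomain.size_divp // ltn_subrL.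
    rewrite -subn1 subn_gt0 ska (ltnW smu) => /(_ isT) hq.
    have [|/lkaX //|//] := @vanishing_baseM (lead_coef ka ^+ scalp mu ka) (lead_coef mu).
    move=> x wx; have := div _ idlmu x wx; rewrite hq // mul0r.
    move=> /(congr1 (fun p : {poly C} => p`_((size mu).-1))).
    by rewrite coefZ coef_map coef0 /= mevalM [in lead_coef mu]lead_coefE.
  - move=> vka; have [] := @vanishing_graphM (lead_coef ka ^+ scalp h ka)%:P h.
    + move=> x wx; rewrite mul_polyC pevZ (div _ idlh x wx) hornerM vka // mulr0 //.
    + by rewrite vanishing_base_graph => /lkaX.
    + by [].
have [r er] : exists r, ka = r%:P by exists ka`_0; apply/size1_polyC; rewrite ska.
have nr : ~ nulc r by move: lka; rewrite er lead_coefC.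
have [S hS] := ika.
have /existsNP[x0 hx0] : ~ nulc (lead_coef mu * r) by move=> /vanishing_baseM[].
have [wx0] : w.@[x0] != 0 /\ (lead_coef mu * r).@[u x0] <> 0 by apply/not_implyP.
rewrite mevalM => /eqP; rewrite mulf_eq0 negb_or => /andP[cx0 rx0].
pose m0 := pev mu (u x0).
have sm0 : size m0 = size mu by rewrite size_map_poly_id0.
have rootP t : m0.[t] = 0 -> t = v x0 /\ m0^`().[t] != 0.
  move=> mt; have vt P : vanW P -> (pev P (u x0)).[t] = 0.
    move=> vP; have e := Pdiv.Idomain.divp_eq P mu.
    have mu0 : mu != 0 by rewrite -size_poly_gt0 (ltnW smu).
    have vr : vanW (P %% mu).
      have -> : P %% mu = lead_coef mu ^+ scalp P mu *: P - P %/ mu * mu.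
        by rewrite e addrAC subrr add0r.
      by move=> x wx; rewrite pevB pevZ pevM !hornerE vP // vmu // !mulr0 subr0.
    have := congr1 (fun p => (pev p (u x0)).[t]) e.
    rewrite pevD pevM pevZ (mmin _ vr (ltn_modpN0 _ mu0)) // addr0 hornerM mt mulr0.
    by rewrite hornerZ rmorphXn => /eqP; rewrite mulf_eq0 expf_eq0 (negbTE cx0) andbF => /eqP.
  have := vt _ hS; rewrite pevB pevM er {1}/pev map_polyC !hornerE => /eqP.
  rewrite subr_eq0 => /eqP e; rewrite e in rx0.
  move: rx0; rewrite mulf_eq0 negb_or hE pevM hornerM mulf_eq0 negb_or.
  case/andP=> /andP[h0t mut] _; split; last by rewrite /m0 /pev deriv_map.
  have [x [wx ux ->]] := hh0 _ _ h0t vt; apply: hone => // i; by rewrite ux.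
have s2 : size mu = 2%N.
  apply/eqP; rewrite eqn_leq smu andbT leqNgt; apply/negP => s3.
  have [rs ers] := closed_field_poly_normal m0.
  have m00 : m0 != 0 by rewrite -size_poly_gt0 sm0 (ltnW smu).
  have srs : (1 < size rs)%N.
    have := congr1 (fun p : {poly C} => size p) ers.
    rewrite size_scale ?lead_coef_eq0 // size_prod_XsubC sm0 => e.
    by rewrite -ltnS -e.
  case: rs srs ers => [|t1 [|t2 rs]] // _ ers.
  have mt t : t \in [:: t1, t2 & rs] -> m0.[t] = 0.
    move=> tr; rewrite ers hornerZ; apply/eqP; rewrite mulf_eq0 orbC.
    by rewrite -/(root _ _) root_prod_XsubC tr.
  have mt1 : m0.[t1] = 0 by apply: (mt); rewrite inE eqxx.
  have mt2 : m0.[t2] = 0 by apply: (mt); rewrite !inE eqxx orbT.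
  have [e1 d1] := rootP _ mt1; have [e2 _] := rootP _ mt2.
  move: d1; rewrite {1}ers !big_cons e1 e2 derivZ !derivM derivXsubC.
  by rewrite !(hornerXsubC, hornerZ, hornerM, hornerD) subrr !(mul0r, mulr0, addr0) eqxx.
exists (- mu`_0), mu`_1; split.
  by move: lmu; rewrite lead_coefE s2.
move=> x wx; have := vmu x wx; rewrite /pev /map_poly s2.
rewrite poly_def !big_ord_recl big_ord0 !hornerE /= => e.
rewrite mevalN; apply/eqP; rewrite -subr_eq0 opprK; apply/eqP; rewrite -[RHS]e. ring.
Qed.

End Fibres.
End ImageFibres.

(** * Algebraic dependence of [k + 1] polynomials in [k] variables *)

Section Dependence.
Variable C : numClosedFieldType.
Variable k : nat.

Lemma card_bmultinom D : (#|{: 'X_{1..k < D}}| <= D ^ k)%N.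
Proof.
have lt (m : 'X_{1..k < D}) i : (bmnm m i < D)%N.
  by apply: leq_ltn_trans (bmdeg m); rewrite mdegE (bigD1 i) //= leq_addr.
pose F (m : 'X_{1..k < D}) := [ffun i => Ordinal (lt m i)].
have -> : (D ^ k = #|{: {ffun 'I_k -> 'I_D}}|)%N by rewrite card_ffun !card_ord.
apply: (@leq_card _ _ F).
move=> m1 m2 /ffunP e; apply/val_inj/mnmP => i.
by have := e i; rewrite !ffunE => -[].
Qed.

Lemma msize_mul_le (p q : {mpoly C[k]}) e1 e2 :
  (msize p <= e1.+1)%N -> (msize q <= e2.+1)%N -> (msize (p * q) <= (e1 + e2).+1)%N.
Proof.
have [->|p0] := eqVneq p 0; first by rewrite mul0r msize0.
have [->|q0] := eqVneq q 0; first by rewrite mulr0 msize0.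
by move=> h1 h2; rewrite msizeM //; move: (msize p) (msize q) h1 h2 => x y; lia.
Qed.

Lemma msize_exp_le (p : {mpoly C[k]}) e j :
  (msize p <= e.+1)%N -> (msize (p ^+ j) <= (e * j).+1)%N.
Proof.
move=> hp; elim: j => [|j IH]; first by rewrite expr0 msize1.
by rewrite exprS mulnS; apply: msize_mul_le.
Qed.

(* There are [M ^ k.+1] monomials of partial degrees less than [M] in the given [k.+1]
   polynomials, in a space of dimension at most [(M * E) ^ k]. *)
Lemma algebraic_dependence (f : 'I_k -> {mpoly C[k]}) (g : {mpoly C[k]}) :
  exists P : {poly {mpoly C[k]}}, P != 0 /\
    forall x, (pev P (fun i => (f i).@[x])).[g.@[x]] = 0.
Proof.
pose d := (\max_(i < k) msize (f i) + msize g)%N.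
have df i : (msize (f i) <= d.+1)%N.
  apply: leq_trans (@leq_bigmax _ (fun j => msize (f j)) i) _; by rewrite /d -addnS leq_addr.
have dg : (msize g <= d.+1)%N by apply: leq_trans (leq_addl _ _) (leqnSn _).
pose E := (k.+1 * d).+1; pose M := (E ^ k).+1.
pose T := ({ffun 'I_k -> 'I_M} * 'I_M)%type.
pose mon (t : T) := (\prod_(i < k) f i ^+ t.1 i) * g ^+ t.2.
have smon t : (msize (mon t) <= M * E)%N.
  have h1 : (msize (\prod_(i < k) f i ^+ t.1 i)%R <= (k * (d * M)).+1)%N.
    rewrite -[X in (X * _)%N](size_enum_ord k) -[index_enum _]enumT.
    elim: (enum 'I_k) => [|i r IH]; first by rewrite big_nil msize1.
    rewrite big_cons mulSn; apply: msize_mul_le => //.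
    apply: leq_trans (msize_exp_le _ (df i)) _.
    by rewrite ltnS leq_mul2l ltnW ?orbT.
  have h2 : (msize (g ^+ t.2) <= (d * M).+1)%N.
    apply: leq_trans (msize_exp_le _ dg) _.
    by rewrite ltnS leq_mul2l ltnW ?orbT.
  apply: leq_trans (msize_mul_le h1 h2) _.
  rewrite /E mulnS -addn1 addnC leq_add //; nia.
have [||c [[r0 cr0] hc]] := @mpoly_lin_dep C k #|{: T}| (M * E) (fun r => mon (enum_val r)).
- by move=> r; apply: smon.
- apply: leq_ltn_trans (card_bmultinom _) _.
  rewrite card_prod card_ffun !card_ord expnMn ltn_pmul2l ?expn_gt0 //.
pose cc (t : T) := c (enum_rank t).
pose P : {poly {mpoly C[k]}} :=
  \sum_(t : T) (cc t *: 'X_[[multinom (t.1 i : nat) | i < k]]) *: 'X^(t.2).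
exists P; split.
  apply: contraNneq cr0 => /(congr1 (fun p : {poly {mpoly C[k]}} =>
    (p`_((enum_val r0).2))@_[multinom ((enum_val r0).1 i : nat) | i < k])).
  rewrite coef0 mcoeff0 coef_sum raddf_sum /= (bigD1 (enum_val r0)) //=.
  rewrite coefZ coefXn eqxx mulr1 mcoeffZ mcoeffX eqxx mulr1 /cc enum_valK.
  rewrite big1 ?addr0 => [-> //|t tr].
  rewrite coefZ coefXn; case: eqP => [e2|]; last by rewrite mulr0 mcoeff0.
  rewrite mulr1 mcoeffZ mcoeffX; case: eqP => [e1|]; last by rewrite mulr0.
  case/eqP: tr; case: t e1 e2 => t1 t2 /= e1 e2.
  rewrite [enum_val r0]surjective_pairing; congr (_, _); last exact/esym/val_inj.
  apply/ffunP => i; apply: val_inj.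
  by have /mnmP/(_ i) := e1; rewrite !mnmE.
move=> x; have := congr1 (meval x) hc; rewrite meval0 raddf_sum /= => <-.
rewrite /pev raddf_sum horner_sum (reindex (fun r : 'I_#|{: T}| => enum_val r)) /=; last first.
  by exists enum_rank => t _; rewrite ?enum_valK ?enum_rankK.
apply: eq_bigr => r _; rewrite map_polyZ /= map_polyXn hornerZ hornerXn mevalZ mevalX.
rewrite mevalZ /cc enum_valK mevalM rmorphXn /= rmorph_prod /= mulrA.
by congr (_ * _ * _); apply: eq_bigr => i _; rewrite mnmE rmorphXn.
Qed.
End Dependence.

(** ** Cayley's Omega process *)

Section LinearSubstitution.
Variable C : numClosedFieldType.

Lemma mpoly_ring_ind k (P : {mpoly C[k]} -> Prop) :
  (forall c, P c%:MP) -> (forall i, P 'X_i) ->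
  (forall p q, P p -> P q -> P (p + q)) -> (forall p q, P p -> P q -> P (p * q)) ->
  forall p, P p.
Proof.
move=> hC hX hD hM; elim/mpolyind => [|c m p _ _ IH]; first by rewrite -mpolyC0.
apply: hD => //; rewrite -mul_mpolyC; apply: (hM) => //; rewrite mpolyXE_id.
elim: (index_enum _) => [|i r IHr]; first by rewrite big_nil -mpolyC1.
rewrite big_cons; apply: (hM) => //.
elim: (m i) => [|e IHe]; first by rewrite expr0 -mpolyC1.
by rewrite exprS; apply: (hM).
Qed.

(* Composition with the linear map [h]; thus [glact A = lsub (invmx A)]. *)
Definition lsub k (h : 'M[C]_k) (p : {mpoly C[k]}) : {mpoly C[k]} :=
  p \mPo [tuple \sum_(j < k) h i j *: 'X_j | i < k].

Lemma lsubE k (h : 'M[C]_k) (p : {mpoly C[k]}) :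
  lsub h p = p \mPo [tuple \sum_(j < k) h i j *: 'X_j | i < k].
Proof. by []. Qed.

Definition mapply k (h : 'M[C]_k) (x : 'I_k -> C) (i : 'I_k) : C := \sum_j h i j * x j.

Lemma lsub_eval k (h : 'M[C]_k) p x : (lsub h p).@[x] = p.@[mapply h x].
Proof.
rewrite /lsub comp_mpoly_meval; apply: meval_eq => i; rewrite tnth_mktuple raddf_sum /=.
by apply: eq_bigr => j _; rewrite mevalZ mevalXU.
Qed.

Lemma mapply_mul k (h g : 'M[C]_k) x : mapply (h *m g) x =1 mapply h (mapply g x).
Proof.
move=> i; rewrite /mapply; under eq_bigr do rewrite mxE mulr_suml.
rewrite exchange_big /=; apply: eq_bigr => j _; rewrite mulr_sumr.
by apply: eq_bigr => l _; rewrite mulrA.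
Qed.

Lemma mapply1 k (x : 'I_k -> C) : mapply 1%:M x =1 x.
Proof.
move=> i; rewrite /mapply (bigD1 i) //= mxE eqxx mul1r big1 ?addr0 // => j ji.
by rewrite mxE eq_sym (negbTE ji) mul0r.
Qed.

Lemma lsub_lsub k (h g : 'M[C]_k) p : lsub h (lsub g p) = lsub (g *m h) p.
Proof.
apply: mpoly_eval_inj => x; rewrite !lsub_eval; apply: meval_eq => i.
by rewrite mapply_mul.
Qed.

Lemma lsub1 k (p : {mpoly C[k]}) : lsub 1%:M p = p.
Proof. by apply: mpoly_eval_inj => x; rewrite lsub_eval; apply: meval_eq (mapply1 x). Qed.

Lemma lsubD k h (p q : {mpoly C[k]}) : lsub h (p + q) = lsub h p + lsub h q.
Proof. exact: rmorphD. Qed.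
Lemma lsubM k h (p q : {mpoly C[k]}) : lsub h (p * q) = lsub h p * lsub h q.
Proof. exact: rmorphM. Qed.
Lemma lsubXn k h (p : {mpoly C[k]}) e : lsub h (p ^+ e) = lsub h p ^+ e.
Proof. exact: rmorphXn. Qed.
Lemma lsubZ k h c (p : {mpoly C[k]}) : lsub h (c *: p) = c *: lsub h p.
Proof. exact: comp_mpolyZ. Qed.
Lemma lsubC k h c : lsub h c%:MP = c%:MP :> {mpoly C[k]}.
Proof. exact: comp_mpolyC. Qed.
Lemma lsub_sum k h (I : Type) (r : seq I) (P : pred I) (F : I -> {mpoly C[k]}) :
  lsub h (\sum_(i <- r | P i) F i) = \sum_(i <- r | P i) lsub h (F i).
Proof. exact: rmorph_sum. Qed.
Lemma lsubXU k (h : 'M[C]_k) i : lsub h 'X_i = \sum_j h i j *: 'X_j.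
Proof. by rewrite /lsub comp_mpolyXU -tnth_nth tnth_mktuple. Qed.

Opaque lsub.

Lemma lsub_deriv k (h : 'M[C]_k) p i :
  (lsub h p)^`M(i) = \sum_j h j i *: lsub h p^`M(j).
Proof.
elim/mpoly_ring_ind: p => [c|l|p q IHp IHq|p q IHp IHq].
- rewrite lsubC mderivC big1 // => j _; by rewrite mderivC -mpolyC0 lsubC scaler0.
- rewrite lsubXU raddf_sum /= (bigD1 i) //= mderivZ mderivX mnm1E eqxx.
  rewrite [X in _ + X]big1 => [|j ji]; last first.
    by rewrite mderivZ mderivX mnm1E (negbTE ji) scale0r scaler0.
  rewrite (bigD1 l) //= [X in _ = _ + X]big1 => [|j jl]; last first.
    by rewrite mderivX mnm1E eq_sym (negbTE jl) scale0r -mpolyC0 lsubC scaler0.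
  rewrite mderivX mnm1E eqxx !scale1r.
  have sub0 (b : 'I_k) : (U_(b) - U_(b))%MM = 0%MM :> 'X_{1..k}.
    by apply/mnmP => a; rewrite mnmBE subnn mnm0E.
  by rewrite !sub0 mpolyX0 -mpolyC1 lsubC.
- rewrite lsubD mderivD IHp IHq -big_split; apply: eq_bigr => j _ /=.
  by rewrite mderivD lsubD scalerDr.
- rewrite lsubM mderivM IHp IHq mulr_suml mulr_sumr -big_split.
  apply: eq_bigr => j _ /=.
  by rewrite mderivM lsubD !lsubM scalerDr -scalerAl -scalerAr.
Qed.

Lemma mcoeff0_eval k (p : {mpoly C[k]}) : p@_0%MM = p.@[fun=> 0].
Proof.
elim/mpoly_ring_ind: p => [c|l|p q IHp IHq|p q IHp IHq].
- by rewrite mcoeffC eqxx mulr1 mevalC.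
- by rewrite mevalXU mcoeffX mnm1_eq0.
- by rewrite mcoeffD mevalD IHp IHq.
- by rewrite rmorphM mevalM /= IHp IHq.
Qed.

(** * The apolar pairing: the differential operator [q(d)] applied to [p], at the origin *)

Section Fischer.
Variable k : nat.
Implicit Types p q : {mpoly C[k]}.

Definition fischer q p : C := \sum_(b <- msupp q) q@_b * (p^`M[b])@_0%MM.

Lemma fischerwE w q p : (msize q <= w)%N ->
  fischer q p = \sum_(b : 'X_{1..k < w}) q@_b * (p^`M[b])@_0%MM.
Proof.
move=> le_w; rewrite /fischer (big_mksub 'X_{1..k < w}) /=; first last.
- by move=> x /msize_mdeg_lt /leq_trans; apply.
- by rewrite msupp_uniq.
by rewrite big_rmcond //= => i /memN_msupp_eq0 ->; rewrite mul0r.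
Qed.

Lemma fischerD q1 q2 p : fischer (q1 + q2) p = fischer q1 p + fischer q2 p.
Proof.
pose w := (msize q1 + msize q2)%N.
have h : (msize (q1 + q2) <= w)%N.
  by apply: leq_trans (msizeD_le _ _) _; rewrite geq_max /w leq_addr leq_addl.
rewrite !(@fischerwE w) ?leq_addr ?leq_addl // -big_split; apply: eq_bigr => b _ /=.
by rewrite mcoeffD mulrDl.
Qed.

Lemma fischerZ c q p : fischer (c *: q) p = c * fischer q p.
Proof.
rewrite !(@fischerwE (msize q)) ?msizeZ_le // mulr_sumr; apply: eq_bigr => b _.
by rewrite mcoeffZ mulrA.
Qed.

Lemma fischer0 p : fischer 0 p = 0.
Proof. by rewrite -[0](scale0r 0) fischerZ mul0r. Qed.

Lemma fischer_suml (I : Type) (r : seq I) (F : I -> {mpoly C[k]}) p :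
  fischer (\sum_(i <- r) F i) p = \sum_(i <- r) fischer (F i) p.
Proof.
by elim: r => [|i r IH]; rewrite ?big_nil ?fischer0 // !big_cons fischerD IH.
Qed.

Lemma fischer_sumr (I : Type) (r : seq I) (F : I -> {mpoly C[k]}) q :
  fischer q (\sum_(i <- r) F i) = \sum_(i <- r) fischer q (F i).
Proof.
rewrite /fischer exchange_big /=; apply: eq_bigr => b _; rewrite -mulr_sumr; congr (_ * _).
by rewrite raddf_sum raddf_sum.
Qed.

Lemma fischerZr c q p : fischer q (c *: p) = c * fischer q p.
Proof.
by rewrite /fischer mulr_sumr; apply: eq_bigr => b _; rewrite mderivmZ mcoeffZ mulrCA.
Qed.

Lemma fischerX m p : fischer 'X_[m] p = (p^`M[m])@_0%MM.
Proof. by rewrite /fischer msuppX big_seq1 mcoeffX eqxx mul1r. Qed.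

Lemma fischerMX i q p : fischer ('X_i * q) p = fischer q p^`M(i).
Proof.
elim/mpolyind: q => [|c m q _ _ IH]; first by rewrite mulr0 !fischer0.
rewrite mulrDr !fischerD IH -scalerAr !fischerZ -mpolyXD !fischerX.
by rewrite mderivmDm mderivmU1m.
Qed.

(** Induction on the degree of a monomial: a variable on the left is a derivative on the right, and
    the chain rule [lsub_deriv] brings in the transpose. *)
Lemma fischer_adjoint (h : 'M[C]_k) q p :
  fischer q (lsub h p) = fischer (lsub h^T q) p.
Proof.
elim/mpolyind: q p => [|c m q _ _ IH] p; first by rewrite -mpolyC0 lsubC mpolyC0 !fischer0.
rewrite lsubD lsubZ !fischerD !fischerZ IH; congr (_ * _ + _) => {c q IH}.
have [e] := ubnP (mdeg m); elim: e m p => // e IH m p; rewrite ltnS => me.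
have [->|m0] := eqVneq m 0%MM.
  rewrite mpolyX0 -mpolyC1 lsubC mpolyC1 -mpolyX0 !fischerX !mderivm0m !mcoeff0_eval.
  rewrite lsub_eval; apply: meval_eq => i; rewrite /mapply big1 // => j _.
  by rewrite mulr0.
have [i mi] : exists i, m i != 0%N.
  by apply/existsP; apply: contraNT m0 => /existsPn h0; apply/eqP/mnmP => i;
    rewrite mnm0E; apply/eqP; have := h0 i; rewrite negbK.
have em : m = (U_(i) + (m - U_(i)))%MM.
  by rewrite addmC submK //; apply/mnm_lepP => j; rewrite mnm1E; case: eqP => // <-; rewrite lt0n.
have lt : (mdeg (m - U_(i)) < e)%N.
  by move: me; rewrite {1}em mdegD mdeg1 add1n.
rewrite em mpolyXD fischerMX lsub_deriv fischer_sumr lsubM lsubXU mulr_suml fischer_suml.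
by apply: eq_bigr => j _; rewrite mxE fischerZr IH // -scalerAl fischerZ fischerMX.
Qed.

(* Positivity: the form is a sum of squares weighted by factorials. *)
Lemma fischer_real_neq0 q : (forall m, q@_m \is Num.real) -> q != 0 -> fischer q q != 0.
Proof.
move=> qr q0; rewrite gt_eqF // /fischer.
have term b : q@_b * (q^`M[b])@_0%MM = q@_b ^+ 2 * (\prod_(i < k) (b i)`!)%:R.
  rewrite mcoeff_mderivm addm0 expr2 -mulrA mulr_natr; congr (_ * (_ *+ _)).
  by apply: eq_bigr => i _; rewrite ffactnn.
have pos b : 0 <= q@_b * (q^`M[b])@_0%MM.
  by rewrite term mulr_ge0 ?ler0n // real_exprn_even_ge0.
rewrite (bigD1_seq (mlead q)) ?msupp_uniq ?mlead_supp //=.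
rewrite ltr_pwDl ?sumr_ge0 // term pmulr_rgt0 ?ltr0n.
  by rewrite prodn_gt0 // => i; apply: fact_gt0.
by rewrite real_exprn_even_gt0 //= mleadc_eq0.
Qed.
End Fischer.

Section Omega.
Variable n : nat.

Definition pmat (x : 'I_(n * n) -> C) : 'M[C]_n := vec_mx (\row_k x k).
Definition pvec (g : 'M[C]_n) : 'I_(n * n) -> C := fun k => mxvec g 0 k.

Lemma pmatK g : pmat (pvec g) = g.
Proof.
rewrite -[RHS](mxvecK) /pmat; congr vec_mx; apply/rowP => k; by rewrite mxE.
Qed.

Lemma pmatE x i j : pmat x i j = x (mxvec_index i j).
Proof. by rewrite mxE mxE. Qed.

Lemma polyfun_pmat i j : polyfun (fun x => pmat x i j).
Proof.
by apply: polyfun_ext (@polyfun_var C _ (mxvec_index i j)) => x; rewrite pmatE.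
Qed.

(** Left multiplication by [h] on flattened matrices; the transpose passes from the row vectors of
    [lin_mx] to the column convention of [mapply]. *)
Definition lmat (h : 'M[C]_n) : 'M[C]_(n * n) := (lin_mx (mulmx h))^T.

Lemma mapply_lmat h x : mapply (lmat h) x =1 pvec (h *m pmat x).
Proof.
move=> k; rewrite /pvec /mapply -mul_rV_lin mxE; apply: eq_bigr => j _.
by rewrite !mxE mulrC.
Qed.

Lemma pmat_lmat h x : pmat (mapply (lmat h) x) = h *m pmat x.
Proof.
rewrite -[RHS]pmatK; apply/matrixP => i j; by rewrite !pmatE mapply_lmat.
Qed.

Lemma lmat_tr h : (lmat h)^T = lmat h^T.
Proof.
apply/matrixP => a b; case/mxvec_indexP: a => i j; case/mxvec_indexP: b => i' j'.
have E (f : 'M[C]_n) (i1 j1 i2 j2 : 'I_n) :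
    lin_mx (mulmx f) (mxvec_index i1 j1) (mxvec_index i2 j2) = f i2 i1 * (j1 == j2)%:R.
  have -> : lin_mx (mulmx f) (mxvec_index i1 j1) (mxvec_index i2 j2) =
      ((delta_mx 0 (mxvec_index i1 j1) : 'rV_(n * n)) *m lin_mx (mulmx f)) 0 (mxvec_index i2 j2).
    by rewrite -rowE [RHS]mxE.
  rewrite -mxvec_delta mul_vec_lin mxvecE mxE (bigD1 i1) //= big1 ?addr0.
    by rewrite mxE eqxx /= eq_sym.
  by move=> l li; rewrite mxE (negbTE li) mulr0.
by rewrite /lmat trmxK [RHS]mxE !E mxE eq_sym.
Qed.

Definition det_poly : {mpoly C[n * n]} :=
  \det (\matrix_(i < n, j < n) 'X_(mxvec_index i j)).

Lemma det_poly_eval x : det_poly.@[x] = \det (pmat x).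
Proof.
rewrite /det_poly -det_map_mx; congr (\det _); apply/matrixP => i j.
by rewrite !mxE /= mevalXU.
Qed.

Lemma det_poly_neq0 : det_poly != 0.
Proof.
apply/eqP => /(congr1 (meval (pvec 1%:M))).
by rewrite det_poly_eval pmatK det1 meval0 => /eqP; rewrite oner_eq0.
Qed.

Lemma det_poly_real s m : (det_poly ^+ s)@_m \is Num.real.
Proof.
apply/CrealP; rewrite -mcoeff_map_mpoly; congr (_@_m); rewrite rmorphXn /=; congr (_ ^+ s).
rewrite /det_poly -det_map_mx; congr (\det _); apply/matrixP => i j.
by rewrite !mxE /= map_mpolyX.
Qed.

(* Cayley's operator applied [s] times, evaluated at the origin. *)
Definition omega s (p : {mpoly C[n * n]}) : C := fischer (det_poly ^+ s) p.

(** The substitution moves to the other side of the pairing, where [det_poly] is only multiplied by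
    the determinant. *)
Lemma omega_lmat s h p : omega s (lsub (lmat h) p) = \det h ^+ s * omega s p.
Proof.
rewrite /omega fischer_adjoint lsubXn lmat_tr.
have -> : lsub (lmat h^T) det_poly = \det h *: det_poly.
  apply: mpoly_eval_inj => x.
  by rewrite lsub_eval mevalZ !det_poly_eval pmat_lmat det_mulmx det_tr.
by rewrite exprZn fischerZ.
Qed.

Lemma omega_det_neq0 s : omega s (det_poly ^+ s) != 0.
Proof.
apply: fischer_real_neq0; last by rewrite expf_neq0 // det_poly_neq0.
by move=> m; apply: det_poly_real.
Qed.

Lemma omegaZ s c p : omega s (c *: p) = c * omega s p.
Proof. exact: fischerZr. Qed.

Lemma omegaD s p q : omega s (p + q) = omega s p + omega s q.
Proof.
rewrite /omega /fischer -big_split; apply: eq_bigr => b _ /=.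
by rewrite mderivmD mcoeffD mulrDr.
Qed.

Lemma omega0 s : omega s 0 = 0.
Proof. by rewrite -(scale0r 0) omegaZ mul0r. Qed.

End Omega.
End LinearSubstitution.

Opaque pmat pvec lmat det_poly omega.

Transparent lsub pmat pvec lmat det_poly omega.

(** ** Forms and relative invariants *)

Section Forms.
Variables (C : numClosedFieldType) (n d : nat).
Local Notation fd := (form_dim n d).
Implicit Types F : {mpoly C[n]}.

Definition form_coords F (k : 'I_fd) : C := F@_(bmnm (enum_val k)).

Definition form_eval (P : {mpoly C[fd]}) F : C := P.@[form_coords F].

Lemma mdeg_monomial (k : 'I_fd) : mdeg (bmnm (enum_val k)) = d.
Proof. by have := enum_valP k; rewrite inE => /eqP. Qed.

Lemma monomialP (m : 'X_{1..n}) : mdeg m = d -> exists k : 'I_fd, bmnm (enum_val k) = m.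
Proof.
move=> md; have lt : (mdeg m < d.+1)%N by rewrite md.
have mA : BMultinom lt \in monomials n d by rewrite inE md.
by exists (enum_rank_in mA (BMultinom lt)); rewrite enum_rankK_in.
Qed.

Lemma monomial_inj (k l : 'I_fd) : bmnm (enum_val k) = bmnm (enum_val l) -> k = l.
Proof. by move=> /val_inj/enum_val_inj. Qed.

Definition form_of (v : 'I_fd -> C) : {mpoly C[n]} :=
  \sum_k v k *: 'X_[bmnm (enum_val k)].

Lemma form_of_homog v : form_of v \is d.-homog.
Proof.
by apply: rpred_sum => k _; rewrite rpredZ // dhomogX /= mdeg_monomial.
Qed.

Lemma coords_form_of v : form_coords (form_of v) =1 v.
Proof.
move=> k; rewrite /form_coords raddf_sum (bigD1 k) //= mcoeffZ mcoeffX eqxx mulr1.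
rewrite big1 ?addr0 // => l lk; rewrite mcoeffZ mcoeffX.
by case: eqP => [/monomial_inj e|]; [rewrite e eqxx in lk|rewrite mulr0].
Qed.

Lemma form_coords_inj F (G : {mpoly C[n]}) : F \is d.-homog -> G \is d.-homog ->
  form_coords F =1 form_coords G -> F = G.
Proof.
move=> hF hG e; apply/mpolyP => m; have [md|md] := eqVneq (mdeg m) d.
  by have [k <-] := monomialP md; apply: e.
by rewrite (dhomog_nemf_coeff hF) // (dhomog_nemf_coeff hG).
Qed.

Lemma form_of_coords F : F \is d.-homog -> form_of (form_coords F) = F.
Proof.
by move=> hF; apply: form_coords_inj => //; [apply: form_of_homog|apply: coords_form_of].
Qed.

Lemma form_eval_form_of (P : {mpoly C[fd]}) v : form_eval P (form_of v) = P.@[v].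
Proof. by apply: meval_eq; apply: coords_form_of. Qed.

Lemma dhomog_prodX (l : {mpoly C[n]} ^ n) (m : 'X_{1..n}) :
  (forall i, l i \is 1.-homog) -> \prod_(i < n) l i ^+ m i \is (mdeg m).-homog.
Proof.
move=> hl; rewrite mdegE; elim: (index_enum _) => [|i r IH].
  by rewrite !big_nil dhomog1.
rewrite !big_cons; apply: dhomogM => //.
by rewrite -[X in X.-homog]mul1n; apply: dhomogMn.
Qed.

Lemma lsub_homog e (h : 'M[C]_n) F : F \is e.-homog -> lsub h F \is e.-homog.
Proof.
move=> hF; rewrite [F]mpolyE lsub_sum; rewrite big_seq; apply: rpred_sum => m mF.
rewrite lsubZ rpredZ //; have <- := dhomog_mf hF mF.
rewrite lsubE comp_mpolyX; under eq_bigr do rewrite tnth_mktuple.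
have -> : \prod_(i < n) (\sum_(j < n) h i j *: 'X_j) ^+ m i =
    \prod_(i < n) ([ffun i => \sum_(j < n) h i j *: 'X_j] i : {mpoly C[n]}) ^+ m i.
  by apply: eq_bigr => i _; rewrite ffunE.
apply: dhomog_prodX => i; rewrite ffunE; apply: rpred_sum => j _.
by rewrite rpredZ // dhomogX /= mdeg1.
Qed.

Lemma lsub_invK (h : 'M[C]_n) F : h \in unitmx -> lsub h (lsub (invmx h) F) = F.
Proof. by move=> hu; rewrite lsub_lsub mulVmx // lsub1. Qed.

Lemma lsub_invKV (h : 'M[C]_n) F : h \in unitmx -> lsub (invmx h) (lsub h F) = F.
Proof. by move=> hu; rewrite lsub_lsub mulmxV // lsub1. Qed.

Definition coefpoly l (G : ('I_l -> C) -> {mpoly C[n]}) : Prop :=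
  forall m, polyfun (fun v => (G v)@_m).

Section Coefpoly.
Variable l : nat.
Implicit Types G H : ('I_l -> C) -> {mpoly C[n]}.
Lemma coefpoly_ext G H : (forall v, G v = H v) -> coefpoly G -> coefpoly H.
Proof. by move=> e h m; apply: polyfun_ext (h m) => v; rewrite e. Qed.
Lemma coefpoly_cst F : coefpoly (fun _ : 'I_l -> C => F).
Proof. by move=> m; apply: polyfun_cst. Qed.
Lemma coefpolyZ (c : ('I_l -> C) -> C) G :
  polyfun c -> coefpoly G -> coefpoly (fun v => c v *: G v).
Proof.
move=> hc hG m; apply: (@polyfun_ext _ _ (fun v => c v * (G v)@_m)).
  by move=> v; rewrite mcoeffZ.
exact: polyfunM.
Qed.
Lemma coefpolyM G H : coefpoly G -> coefpoly H -> coefpoly (fun v => G v * H v).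
Proof.
move=> hG hH m; pose N := (mdeg m).+1.
apply: (@polyfun_ext _ _ (fun v =>
  \sum_(k : 'X_{1..n < N, N} | m == (k.1 + k.2)%MM) ((G v)@_k.1 * (H v)@_k.2))).
  by move=> v; rewrite mcoeffM.
by apply: polyfun_sum => k _; apply: polyfunM.
Qed.
Lemma coefpoly_deriv G i : coefpoly G -> coefpoly (fun v => (G v)^`M(i)).
Proof.
move=> hG m; apply: (@polyfun_ext _ _ (fun v => (G v)@_(m + U_(i)) *+ (m i).+1)).
  by move=> v; rewrite mcoeff_deriv.
exact: polyfunMn.
Qed.
Lemma coefpoly_sum (I : Type) (r : seq I) (Q : pred I) (F : I -> ('I_l -> C) -> {mpoly C[n]}) :
  (forall i, coefpoly (F i)) -> coefpoly (fun v => \sum_(i <- r | Q i) F i v).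
Proof.
move=> h m; apply: (@polyfun_ext _ _ (fun v => \sum_(i <- r | Q i) (F i v)@_m)).
  by move=> v; rewrite raddf_sum.
by apply: polyfun_sum => i _; apply: h.
Qed.
Lemma coefpolyX G e : coefpoly G -> coefpoly (fun v => G v ^+ e).
Proof.
move=> hG; elim: e => [|e IH].
  by apply: (@coefpoly_ext (fun=> 1)) => [v|]; [rewrite expr0|apply: coefpoly_cst].
by apply: coefpoly_ext (coefpolyM hG IH) => v; rewrite exprS.
Qed.
Lemma coefpoly_prod (I : Type) (r : seq I) (Q : pred I) (F : I -> ('I_l -> C) -> {mpoly C[n]}) :
  (forall i, coefpoly (F i)) -> coefpoly (fun v => \prod_(i <- r | Q i) F i v).
Proof.
move=> h; elim: r => [|i r IH].
  by apply: (@coefpoly_ext (fun=> 1)) => [v|]; [rewrite big_nil|apply: coefpoly_cst].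
apply: (@coefpoly_ext (fun v => (if Q i then F i v else 1) * \prod_(j <- r | Q j) F j v)).
  by move=> v; rewrite big_cons; case: (Q i); rewrite ?mul1r.
by apply: coefpolyM => //; case: (Q i) => //; apply: coefpoly_cst.
Qed.
Lemma coefpoly_det r (M : ('I_l -> C) -> 'M[{mpoly C[n]}]_r) :
  (forall i j, coefpoly (fun v => M v i j)) -> coefpoly (fun v => \det (M v)).
Proof.
move=> h; rewrite /determinant; apply: coefpoly_sum => s; apply: coefpolyM.
  exact: coefpoly_cst.
by apply: coefpoly_prod => i; apply: h.
Qed.
End Coefpoly.

Lemma coefpoly_form_of : coefpoly form_of.
Proof.
apply: coefpoly_sum => k; apply: coefpolyZ; first exact: polyfun_var.
exact: coefpoly_cst.
Qed.

Lemma coefpoly_lsub F : coefpoly (fun x => lsub (pmat x) F).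
Proof.
apply: (@coefpoly_ext _ (fun x => \sum_(m <- msupp F) F@_m *:
    \prod_(i < n) (\sum_j pmat x i j *: 'X_j) ^+ m i)).
  move=> x; rewrite lsubE comp_mpolyEX; apply: eq_bigr => m _; rewrite comp_mpolyX.
  by congr (_ *: _); apply: eq_bigr => i _; rewrite tnth_mktuple.
apply: coefpoly_sum => m; apply: coefpolyZ; first exact: polyfun_cst.
apply: coefpoly_prod => i; apply: coefpolyX; apply: coefpoly_sum => j.
by apply: coefpolyZ; [apply: polyfun_pmat|apply: coefpoly_cst].
Qed.

(** The action is linear in the form and polynomial in the matrix, which need not be invertible
    here. *)
Lemma coords_lsub_poly : exists T : 'I_fd -> 'I_fd -> {mpoly C[n * n]},
  forall F, F \is d.-homog -> forall x k,
    form_coords (lsub (pmat x) F) k = \sum_a form_coords F a * (T a k).@[x].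
Proof.
have /choice[T hT] : forall a : 'I_fd, exists t : 'I_fd -> {mpoly C[n * n]}, forall (k : 'I_fd) x,
    (lsub (pmat x) 'X_[bmnm (enum_val a)])@_(bmnm (enum_val k)) = (t k).@[x].
  move=> a; have /choice[t ht] := fun k : 'I_fd =>
    coefpoly_lsub 'X_[bmnm (enum_val a)] (bmnm (enum_val k)).
  by exists t => k x; apply: ht.
exists T => F hF x k; rewrite -{1}(form_of_coords hF) /form_of lsub_sum.
rewrite {1}/form_coords raddf_sum; apply: eq_bigr => a _ /=.
by rewrite lsubZ mcoeffZ hT.
Qed.

Definition act_coef := projT1 (cid coords_lsub_poly).

(* The polynomial [g |-> P (F o g)] on matrices. *)
Definition orbit_poly (P : {mpoly C[fd]}) F : {mpoly C[n * n]} :=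
  P \mPo [tuple \sum_a form_coords F a *: act_coef a k | k < fd].

Lemma orbit_polyE P F x : F \is d.-homog ->
  (orbit_poly P F).@[x] = form_eval P (lsub (pmat x) F).
Proof.
move=> hF; rewrite /orbit_poly comp_mpoly_meval /form_eval; apply: meval_eq => k.
rewrite tnth_mktuple (projT2 (cid coords_lsub_poly)) // raddf_sum /=.
by apply: eq_bigr => a _; rewrite mevalZ.
Qed.

End Forms.
Arguments form_coords {C n} d F k.

(** * Reynolds averages and semi-invariants *)

Section OrbitCoef.
Variables (C : numClosedFieldType) (n d : nat).
Local Notation fd := (form_dim n d).
Implicit Types F G : {mpoly C[n]}.

Lemma coefpoly_orbit (P : {mpoly C[fd]}) : coefpoly (fun v => orbit_poly P (form_of (d := d) v)).
Proof.
pose G (v : 'I_fd -> C) : {mpoly C[n * n]} := \sum_(m <- msupp P) P@_m *: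
    \prod_(i < fd) (\sum_a v a *: act_coef C a i) ^+ m i.
have e v : G v = orbit_poly P (form_of (d := d) v).
  rewrite /orbit_poly comp_mpolyEX; apply: eq_bigr => m _; rewrite comp_mpolyX.
  congr (_ *: _); apply: eq_bigr => i _; rewrite tnth_mktuple.
  by congr (_ ^+ _); apply: eq_bigr => a _; rewrite coords_form_of.
apply: (coefpoly_ext e).
apply: coefpoly_sum => m; apply: coefpolyZ; first exact: polyfun_cst.
apply: coefpoly_prod => i; apply: coefpolyX; apply: coefpoly_sum => j.
by apply: coefpolyZ; [apply: polyfun_var|apply: coefpoly_cst].
Qed.

Lemma orbit_poly_add (P Q : {mpoly C[fd]}) F :
  orbit_poly (P + Q) F = orbit_poly P F + orbit_poly Q F.
Proof. exact: rmorphD. Qed.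

Opaque orbit_poly.

Lemma reynolds_poly s (P : {mpoly C[fd]}) : exists Q : {mpoly C[fd]},
  forall F, F \is d.-homog -> form_eval Q F = omega s (orbit_poly P F).
Proof.
have [Q hQ] : polyfun (fun v => omega s (orbit_poly P (form_of (d := d) v))).
  rewrite /omega /fischer; apply: polyfun_sum => b _; apply: polyfunZ.
  apply: (@polyfun_ext _ _ (fun v => (orbit_poly P (form_of (d := d) v))@_(b + 0) *+
     (\prod_(i < n * n) ((b + 0)%MM i)^_(b i)))).
    by move=> v; rewrite mcoeff_mderivm.
  by apply: polyfunMn; apply: coefpoly_orbit.
by exists Q => F hF; rewrite -{2}(form_of_coords hF) hQ.
Qed.

Definition reynolds s (P : {mpoly C[fd]}) := projT1 (cid (reynolds_poly s P)).

Lemma reynoldsE s (P : {mpoly C[fd]}) F : F \is d.-homog ->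
  form_eval (reynolds s P) F = omega s (orbit_poly P F).
Proof. exact: (projT2 (cid (reynolds_poly s P))). Qed.

Definition semi_invariant l (I : {mpoly C[fd]}) : Prop :=
  forall F g, F \is d.-homog -> g \in unitmx ->
    form_eval I (lsub g F) = \det g ^+ l * form_eval I F.

Lemma semi_invariant_all l (I : {mpoly C[fd]}) F g : semi_invariant l I ->
  F \is d.-homog -> form_eval I (lsub g F) = \det g ^+ l * form_eval I F.
Proof.
move=> h hF.
have e : orbit_poly I F - form_eval I F *: det_poly _ _ ^+ l = 0.
  apply: (@mpoly_ext0 _ _ _ (det_poly _ n)); first exact: det_poly_neq0.
  move=> x; rewrite det_poly_eval => du.
  have gu : pmat x \in unitmx by rewrite unitmxE unitfE.
  by rewrite mevalB mevalZ rmorphXn /= det_poly_eval orbit_polyE // h // mulrC subrr.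
have := congr1 (meval (pvec g)) e.
rewrite mevalB mevalZ rmorphXn /= det_poly_eval orbit_polyE // pmatK meval0 => /eqP.
by rewrite subr_eq0 mulrC => /eqP.
Qed.

Lemma orbit_poly_lsub (P : {mpoly C[fd]}) F h : F \is d.-homog ->
  orbit_poly P (lsub h F) = lsub (lmat h) (orbit_poly P F).
Proof.
move=> hF; apply: mpoly_eval_inj => x.
rewrite [RHS]lsub_eval.
have hF' := lsub_homog h hF.
rewrite (orbit_polyE _ _ hF').
rewrite (orbit_polyE _ _ hF).
rewrite lsub_lsub.
rewrite pmat_lmat.
by [].
Qed.

(** Replacing [F] by [lsub g F] left-translates its orbit polynomial, and [omega s] turns this
    translation into the factor [\det g ^+ s]. *)
Lemma reynolds_invariant s (P : {mpoly C[fd]}) : semi_invariant s (reynolds s P).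
Proof.
move=> F g hF gu.
by rewrite !reynoldsE ?lsub_homog // orbit_poly_lsub // omega_lmat.
Qed.

Opaque reynolds.

End OrbitCoef.

(** * First-order expansions and the Lie algebra action *)

Section Taylor.
Variable C : numClosedFieldType.

(** This replaces differentiation at 0: two expansions that agree for all [e] outside a finite set
    have the same linear coefficient. *)
Lemma quadratic_unique (a b a' b' : C) (h h' w : {poly C}) : w != 0 ->
  (forall e, w.[e] != 0 ->
     a + e * b + e ^+ 2 * h.[e] = a' + e * b' + e ^+ 2 * h'.[e]) -> b = b'.
Proof.
move=> w0 H; pose p := (a - a')%:P + (b - b') *: 'X + 'X^2 * (h - h').
have p0 : p = 0.
  apply/eqP; apply: contraT => pn0.
  have /closed_nonrootP[e] : p * w != 0 by rewrite mulf_neq0.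
  rewrite /root hornerM mulf_eq0 negb_or => /andP[+ we].
  have {}H := H e we.
  have -> : p.[e] = (a + e * b + e ^+ 2 * h.[e]) - (a' + e * b' + e ^+ 2 * h'.[e]).
    by rewrite /p !hornerE; ring.
  by rewrite H subrr eqxx.
have := congr1 (fun q : {poly C} => q`_1) p0.
rewrite /p coef0 !coefD coefC coefZ coefX /= mulr1 add0r coefXnM /= addr0 => /eqP.
by rewrite subr_eq0 => /eqP.
Qed.

Lemma taylor l (P : {mpoly C[l]}) (x y : 'I_l -> C) (h : 'I_l -> {poly C}) :
  exists k : {poly C}, forall e,
    P.@[fun i => x i + e * y i + e ^+ 2 * (h i).[e]] =
    P.@[x] + e * \sum_i (P^`M(i)).@[x] * y i + e ^+ 2 * k.[e].
Proof.
elim/mpoly_ring_ind: P => [c|i|p q [kp hp] [kq hq]|p q [kp hp] [kq hq]].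
- exists 0 => e; rewrite !mevalC horner0 mulr0 addr0 big1 ?mulr0 ?addr0 // => i _.
  by rewrite mderivC meval0 mul0r.
- exists (h i) => e; rewrite !mevalXU (bigD1 i) //= big1 ?addr0 => [|j ji].
    rewrite mderivX mnm1E eqxx scale1r mevalX big1 ?mul1r // => j _.
    by rewrite mnmBE subnn expr0.
  by rewrite mderivX mnm1E eq_sym (negbTE ji) scale0r meval0 mul0r.
- exists (kp + kq) => e; rewrite !mevalD hp hq hornerD.
  under [in RHS]eq_bigr do rewrite mderivD mevalD mulrDl.
  by rewrite big_split /=; ring.
set dp := \sum_i (p^`M(i)).@[x] * y i in hp; set dq := \sum_i (q^`M(i)).@[x] * y i in hq.
exists (p.@[x] *: kq + q.@[x] *: kp + (dp * dq)%:P + 'X * (dp *: kq + dq *: kp) +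
   'X^2 * (kp * kq)) => e.
rewrite !mevalM hp hq.
have -> : \sum_i ((p * q)^`M(i)).@[x] * y i = dp * q.@[x] + p.@[x] * dq.
  rewrite mulr_suml mulr_sumr -big_split; apply: eq_bigr => i _ /=.
  by rewrite mderivM mevalD !mevalM; ring.
rewrite !(hornerD, hornerZ, hornerM, hornerC, hornerX, hornerXn); ring.
Qed.

Variable n : nat.

(* The derivative of the action of [1 + e E] at [e = 0]. *)
Definition lie (E : 'M[C]_n) (F : {mpoly C[n]}) : {mpoly C[n]} :=
  \sum_i \sum_j E i j *: ('X_j * F^`M(i)).

Lemma lieE E F : lie E F = \sum_i \sum_j E i j *: ('X_j * F^`M(i)).
Proof. by []. Qed.

Lemma lie_sum_basis (u : 'rV[C]_(n * n)) F :
  lie (vec_mx u) F = \sum_a u 0 a *: lie (vec_mx (delta_mx 0 a)) F.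
Proof.
rewrite /lie; under [RHS]eq_bigr do rewrite scaler_sumr.
rewrite [RHS]exchange_big /=; apply: eq_bigr => i _.
under [RHS]eq_bigr do rewrite scaler_sumr.
rewrite [RHS]exchange_big /=; apply: eq_bigr => j _.
under [RHS]eq_bigr do rewrite scalerA.
rewrite -scaler_suml; congr (_ *: _).
rewrite mxE (bigD1 (mxvec_index i j)) //= big1 ?addr0 => [|a ai].
  by rewrite !mxE !eqxx mulr1.
by rewrite !mxE eqxx eq_sym (negbTE ai) mulr0.
Qed.

Lemma coefpoly_lie l (E : 'M[C]_n) (G : ('I_l -> C) -> {mpoly C[n]}) :
  coefpoly G -> coefpoly (fun v => lie E (G v)).
Proof.
move=> hG; rewrite /lie; apply: coefpoly_sum => i; apply: coefpoly_sum => j.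
apply: coefpolyZ; first exact: polyfun_cst.
by apply: coefpolyM; [apply: coefpoly_cst|apply: coefpoly_deriv].
Qed.

Lemma lieD E F G : lie E (F + G) = lie E F + lie E G.
Proof.
rewrite /lie -big_split; apply: eq_bigr => i _; rewrite -big_split; apply: eq_bigr => j _.
by rewrite mderivD mulrDr scalerDr.
Qed.

Lemma lieM E F G : lie E (F * G) = lie E F * G + F * lie E G.
Proof.
rewrite /lie mulr_suml mulr_sumr -big_split; apply: eq_bigr => i _.
rewrite mulr_suml mulr_sumr -big_split; apply: eq_bigr => j _ /=.
rewrite mderivM mulrDr scalerDr -scalerAl -scalerAr; congr (_ *: _ + _ *: _); ring.
Qed.

Lemma lie_homog E F d : F \is d.-homog -> lie E F \is d.-homog.
Proof.
move=> hF; apply: rpred_sum => i _; apply: rpred_sum => j _; rewrite rpredZ //.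
apply/dhomogP => m; rewrite mcoeff_msupp => hm; apply/eqP; apply: contraNT hm => md.
case: (boolP (m j == 0%N)) => mj.
  apply/eqP; apply: memN_msupp_eq0; apply/negP => /msuppM_le/allpairsP[[m1 m2] /= [h1 _ e]].
  move: h1 mj; rewrite msuppX inE => /eqP em1.
  by rewrite e em1 mnmDE mnm1E eqxx.
have [m' em] : exists m', m = (m' + U_(j))%MM.
  exists (m - U_(j))%MM; rewrite submK //; apply/mnm_lepP => l; rewrite mnm1E.
  by case: eqP => // <-; rewrite lt0n.
rewrite em in md *; rewrite mulrC addmC mcoeffMX mcoeff_deriv (dhomog_nemf_coeff hF) ?mul0rn //=.
by rewrite mdegD mdeg1 -(mdeg1 j) -mdegD.
Qed.

Lemma lsub_taylor E F : exists H : {poly {mpoly C[n]}}, forall e,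
  lsub (1%:M + e *: E) F = F + e *: lie E F + e ^+ 2 *: H.[e%:MP].
Proof.
elim/mpoly_ring_ind: F => [c|i|p q [kp hp] [kq hq]|p q [kp hp] [kq hq]].
- exists 0 => e; rewrite lsubC horner0 scaler0 addr0 /lie big1 ?scaler0 ?addr0 // => i _.
  by rewrite big1 // => j _; rewrite mderivC mulr0 scaler0.
- have lieX : lie E 'X_i = \sum_j E i j *: 'X_j.
    rewrite /lie (bigD1 i) //= [X in _ + X]big1 ?addr0 => [|l li]; last first.
      by rewrite big1 // => j _; rewrite mderivX mnm1E eq_sym (negbTE li) scale0r mulr0 scaler0.
    apply: eq_bigr => j _; rewrite mderivX mnm1E eqxx scale1r.
    have -> : (U_(i) - U_(i))%MM = 0%MM :> 'X_{1..n}.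
      by apply/mnmP => a; rewrite mnmBE subnn mnm0E.
    by rewrite mpolyX0 mulr1.
  exists 0 => e; rewrite lsubXU horner0 scaler0 addr0 lieX.
  have -> : \sum_j (1%:M + e *: E) i j *: 'X_j =
      \sum_j (i == j)%:R *: 'X_j + \sum_j (e * E i j) *: 'X_j :> {mpoly C[n]}.
    by rewrite -big_split; apply: eq_bigr => j _; rewrite !mxE scalerDl.
  rewrite (bigD1 i) //= eqxx scale1r big1 ?addr0 => [|j ji]; last first.
    by rewrite eq_sym (negbTE ji) scale0r.
  congr (_ + _); rewrite scaler_sumr; apply: eq_bigr => j _.
  by rewrite scalerA.
- exists (kp + kq) => e; rewrite lsubD hp hq lieD hornerD !scalerDr.
  by rewrite -!mul_mpolyC; ring.
exists (p%:P * kq + q%:P * kp + (lie E p * lie E q)%:P +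
   'X * ((lie E p)%:P * kq + (lie E q)%:P * kp) + 'X^2 * (kp * kq)) => e.
rewrite lsubM hp hq lieM -!mul_mpolyC !(hornerD, hornerM, hornerC, hornerX, hornerXn).
rewrite rmorphXn /=; ring.
Qed.

End Taylor.

Opaque lie.

Lemma coords_lsub_taylor (C : numClosedFieldType) n d (E : 'M[C]_n) (F : {mpoly C[n]}) :
  F \is d.-homog -> exists h : 'I_(form_dim n d) -> {poly C},
  forall e k, form_coords d (lsub (1%:M + e *: E) F) k =
    form_coords d F k + e * form_coords d (lie E F) k + e ^+ 2 * (h k).[e].
Proof.
move=> hF; have [H hH] := lsub_taylor E F.
exists (fun k => \poly_(i < size H) (H`_i)@_(bmnm (enum_val k))) => e k.
rewrite {1}/form_coords hH !mcoeffD !mcoeffZ; congr (_ + _ + _ * _).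
rewrite horner_poly horner_coef raddf_sum; apply: eq_bigr => i _ /=.
by rewrite -rmorphXn /= mulrC mcoeffCM mulrC.
Qed.

Transparent orbit_poly reynolds lie.

(** ** Closed orbits with finite isotropy groups *)

Section PolyTaylor.
Variable C : numClosedFieldType.

Lemma pev_taylor L (P : {poly {mpoly C[L]}}) (y : 'I_L -> C) (h : 'I_L -> {poly C}) (t z : C) :
  exists k : {poly C}, forall e,
    (pev P (fun i => y i + e ^+ 2 * (h i).[e])).[t + e * z] =
    (pev P y).[t] + e * (z * (pev P^`() y).[t]) + e ^+ 2 * k.[e].
Proof.
elim/poly_ind: P => [|P c [kP hP]].
  by exists 0 => e; rewrite deriv0 /pev !rmorph0 !horner0 !(mulr0, addr0).
have [kc hc] := taylor c y (fun=> 0) h.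
exists ((z * (z * (pev P^`() y).[t]))%:P + kP * (t%:P + 'X * z%:P) + kc) => e.
have {}hc : c.@[fun i => y i + e ^+ 2 * (h i).[e]] = c.@[y] + e ^+ 2 * kc.[e].
  have := hc e; rewrite big1 => [|i _] /=; last by rewrite mulr0.
  by rewrite mulr0 addr0 => <-; apply: meval_eq => i /=; rewrite ?mulr0 addr0.
have E (Q : {poly {mpoly C[L]}}) b w s :
    (pev (Q * 'X + b%:P) w).[s] = (pev Q w).[s] * s + b.@[w].
  by rewrite /pev rmorphD rmorphM /= map_polyX map_polyC hornerMXaddC.
rewrite !E hP hc derivMXaddC.
have -> : pev (P + P^`() * 'X) y = pev P y + pev P^`() y * 'X.
  by rewrite /pev rmorphD rmorphM /= map_polyX.
rewrite !(hornerD, hornerM, hornerC, hornerX); ring.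
Qed.

Lemma det_line_neq0 n (E : 'M[C]_n) :
  exists2 p : {poly C}, p != 0 & forall e, p.[e] = \det (1%:M + e *: E).
Proof.
pose M : 'M[{poly C}]_n := \matrix_(i, j) ((i == j)%:R%:P + E i j *: 'X).
have hM e : (\det M).[e] = \det (1%:M + e *: E).
  rewrite -horner_evalE -det_map_mx; congr (\det _); apply/matrixP => i j.
  by rewrite !mxE /= /horner_eval hornerD hornerC hornerZ hornerX mulrC.
exists (\det M) => //; apply/eqP => M0.
by have := hM 0; rewrite M0 horner0 scale0r addr0 det1 => /eqP; rewrite eq_sym oner_eq0.
Qed.

End PolyTaylor.

Section InfinitesimalIsotropy.
Variables (C : numClosedFieldType) (n d : nat).
Local Notation fd := (form_dim n d).
Local Notation crd := (form_coords d).
Implicit Types F G : {mpoly C[n]}.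

Lemma act_coefE F x (k : 'I_fd) : F \is d.-homog ->
  crd (lsub (pmat x) F) k = \sum_a crd F a * (act_coef C a k).@[x].
Proof. by move=> hF; rewrite (projT2 (cid (coords_lsub_poly C n d))). Qed.

Lemma orbit_coordE F x (k : 'I_fd) : F \is d.-homog ->
  (orbit_poly ('X_k : {mpoly C[fd]}) F).@[x] = crd (lsub (pmat x) F) k.
Proof. by move=> hF; rewrite orbit_polyE // /form_eval mevalXU. Qed.

Lemma unit_pmat x : (pmat x \in unitmx) = ((det_poly C n).@[x] != 0).
Proof. by rewrite det_poly_eval unitmxE unitfE. Qed.

(** The general maps have the form [a / w] on the locus where [w] is nonzero. Taking [w] to be the
    determinant restricts the parameters to the invertible matrices, and the factor here cancels the
    denominator. *)
Definition graph_coord F (i j : 'I_n) (t : 'I_fd.+1) : {mpoly C[n * n]} :=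
  det_poly C n * (if unlift ord_max t is Some k then orbit_poly ('X_k : {mpoly C[fd]}) F
                  else 'X_(mxvec_index i j)).

Lemma graph_coord_base F i j x k : F \is d.-homog -> (det_poly C n).@[x] != 0 ->
  graph_base (graph_coord F i j) (det_poly C n) x k = crd (lsub (pmat x) F) k.
Proof.
move=> hF dx; rewrite /graph_base /graph_coord.
have -> : widen_ord (leqnSn fd) k = lift ord_max k.
  by apply: val_inj; rewrite /= /bump leqNgt ltn_ord.
by rewrite liftK mevalM mulrAC mulfV // mul1r orbit_coordE.
Qed.

Lemma graph_coord_val F i j x : (det_poly C n).@[x] != 0 ->
  graph_val (graph_coord F i j) (det_poly C n) x = pmat x i j.
Proof.
move=> dx; rewrite /graph_val /graph_coord unlift_none mevalM mulrAC mulfV // mul1r.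
by rewrite mevalXU pmatE.
Qed.

Definition finite_stabilizer F : Prop :=
  exists l : seq 'M[C]_n, forall g, g \in unitmx -> lsub g F = F -> g \in l.

(** The fibres of the orbit map are cosets of the stabilizer. *)
Lemma finite_stabilizer_graph F i j : F \is d.-homog -> finite_stabilizer F ->
  forall x0, (det_poly C n).@[x0] != 0 -> exists s : seq C, forall x,
    (det_poly C n).@[x] != 0 ->
    graph_base (graph_coord F i j) (det_poly C n) x =1
      graph_base (graph_coord F i j) (det_poly C n) x0 ->
    graph_val (graph_coord F i j) (det_poly C n) x \in s.
Proof.
move=> hF [l hl] x0 dx0.
exists [seq (A *m pmat x0) i j | A <- l] => x dx hu.
have ux : pmat x \in unitmx by rewrite unit_pmat.
have ux0 : pmat x0 \in unitmx by rewrite unit_pmat.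
have e : lsub (pmat x) F = lsub (pmat x0) F.
  apply: (@form_coords_inj _ _ d); [exact: lsub_homog|exact: lsub_homog|move=> k].
  by have := hu k; rewrite (graph_coord_base i j k hF dx) (graph_coord_base i j k hF dx0).
have Al : pmat x *m invmx (pmat x0) \in l.
  apply: hl; first by rewrite unitmx_mul ux unitmx_inv ux0.
  by rewrite -lsub_lsub e lsub_invKV.
rewrite (graph_coord_val _ _ _ dx); apply/mapP; exists (pmat x *m invmx (pmat x0)) => //.
by rewrite -mulmxA mulVmx // mulmx1.
Qed.

(* A derivation of the function field of GL_n that kills the coordinates of the orbit
   map kills everything algebraic over them, here the matrix entries. *)
Lemma finite_stabilizer_lie F : F \is d.-homog -> finite_stabilizer F ->
  forall E, lie E F = 0 -> E = 0.
Proof.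
move=> hF fin E hE.
suff main (i j : 'I_n) x : (det_poly C n).@[x] != 0 -> (E *m pmat x) i j = 0.
  apply/matrixP => i j; have := main i j (pvec 1%:M).
  by rewrite det_poly_eval pmatK det1 oner_eq0 mulmx1 mxE; apply.
pose a := graph_coord F i j; pose w := det_poly C n.
have w0 : w != 0 := det_poly_neq0 C n.
have [mu [vmu _ _ nmu _]] := graph_separable
  (graph_algebraic w0 (finite_stabilizer_graph i j hF fin)).
have [h hh] := @coords_lsub_taylor C n d E F hF.
(* Differentiate the relation [mu] along [(1 + e E) y]. The orbit coordinates are stationary to
   first order because [lie E F = 0], and the matrix entry moves with velocity
   [(E *m pmat y) i j]. *)
have key y : w.@[y] != 0 ->
    (E *m pmat y) i j * (pev mu^`() (graph_base a w y)).[graph_val a w y] = 0.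
  move=> wy; pose g := pmat y.
  pose H k : {poly C} := \sum_b (act_coef C b k).@[y] *: h b.
  have [k hk] := pev_taylor mu (graph_base a w y) H (graph_val a w y) ((E *m g) i j).
  have [p p0 hp] := det_line_neq0 E.
  apply: esym; apply: (@quadratic_unique C 0 0
     (pev mu (graph_base a w y)).[graph_val a w y] _ 0 k p p0) => e; rewrite hp => de.
  pose ye := pvec ((1%:M + e *: E) *m g).
  have wye : w.@[ye] != 0.
    rewrite /w det_poly_eval pmatK det_mulmx; apply: mulf_neq0; first exact: de.
    by rewrite -det_poly_eval; exact: wy.
  have v0 := vmu _ wye; rewrite -hk.
  rewrite mulr0 horner0 mulr0 !addr0 -[LHS]v0; congr (_.[_]); last first.
    rewrite (graph_coord_val F i j wye) (graph_coord_val F i j wy) /ye pmatK.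
    by rewrite mulmxDl mul1mx -scalemxAl [LHS]mxE [X in _ + X]mxE.
  apply: eq_map_poly => c; apply: meval_eq => l.
  rewrite (graph_coord_base i j l hF wye) (graph_coord_base i j l hF wy) /ye pmatK.
  rewrite -lsub_lsub (act_coefE _ _ hF) (act_coefE _ _ (lsub_homog _ hF)).
  rewrite /H horner_sum mulr_sumr -big_split; apply: eq_bigr => b _ /=.
  have c0 : crd (0 : {mpoly C[n]}) b = 0 by apply: mcoeff0.
  rewrite hh hE c0 hornerZ mulr0 addr0 mulrDl; congr (_ + _).
  by ring.
have [x1 [wx1 dx1]] : exists x1, w.@[x1] != 0 /\
    (pev mu^`() (graph_base a w x1)).[graph_val a w x1] != 0.
  have /existsNP[x1 hx1] := nmu; exists x1.
  have [wx1 /eqP //] : w.@[x1] != 0 /\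
    (pev mu^`() (graph_base a w x1)).[graph_val a w x1] <> 0 by apply/not_implyP.
move=> wx; apply: contrapT => /eqP ex.
have rE : ratfun w (fun y => (E *m pmat y) i j).
  apply: ratfun_poly; apply: polyfun_mulmx => i' j'; first exact: polyfun_cst.
  exact: polyfun_pmat.
have [y [wy ey dy]] := ratfun_common rE (ratfun_graph a w mu^`()) wx ex wx1 dx1.
by have /eqP := key y wy; rewrite mulf_eq0 (negbTE ey) (negbTE dy).
Qed.
End InfinitesimalIsotropy.

(** * Dimension and closure of orbits, and separation by invariants *)

Section OrbitClosure.
Variables (C : numClosedFieldType) (n d : nat).
Local Notation fd := (form_dim n d).
Local Notation crd := (form_coords d).
Implicit Types F G : {mpoly C[n]}.

Lemma msize_deriv_lt k (P : {mpoly C[k]}) e i :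
  (msize P <= e.+1)%N -> (msize P^`M(i) <= e)%N.
Proof.
move=> hP; have [->|d0] := eqVneq P^`M(i) 0; first by rewrite msize0.
rewrite -(mlead_deg d0) -ltnS; apply: leq_trans hP.
have : (P^`M(i))@_(mlead P^`M(i)) != 0 by rewrite mleadc_eq0.
rewrite mcoeff_deriv => h.
have : (mlead P^`M(i) + U_(i))%MM \in msupp P.
  by rewrite mcoeff_msupp; apply: contraNneq h => ->; rewrite mul0rn.
by move/msize_mdeg_lt; rewrite mdegD mdeg1 addn1.
Qed.

Lemma deriv_eq0_const k (P : {mpoly C[k]}) : (forall i, P^`M(i) = 0) -> P = (P@_0%MM)%:MP.
Proof.
move=> hP; apply/mpolyP => m; rewrite mcoeffC; have [->|m0] := eqVneq m 0%MM.
  by rewrite mulr1.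
rewrite mulr0; have [i mi] : exists i, m i != 0%N.
  by apply/existsP; apply: contraNT m0 => /existsPn h0; apply/eqP/mnmP => i;
    rewrite mnm0E; apply/eqP; have := h0 i; rewrite negbK.
have em : m = (m - U_(i) + U_(i))%MM.
  by rewrite submK //; apply/mnm_lepP => j; rewrite mnm1E; case: eqP => // <-; rewrite lt0n.
have := congr1 (mcoeff (m - U_(i))%MM) (hP i).
by rewrite mcoeff_deriv -em mcoeff0 => /eqP; rewrite mulrn_eq0 /= => /eqP.
Qed.

Definition orbit_comb (V : 'M[C]_(fd, n * n)) F (g : 'M[C]_n) (b : 'I_(n * n)) : C :=
  \sum_k crd (lsub g F) k * V k b.

(* The orbit map of [F] has the same transcendence degree as the group. *)
Definition full_orbit F : Prop := exists V : 'M[C]_(fd, n * n),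
  forall P : {mpoly C[n * n]}, (forall x, P.@[orbit_comb V F (pmat x)] = 0) -> P = 0.

Lemma full_orbit_lsub F h : full_orbit (lsub h F) -> full_orbit F.
Proof.
move=> [V hV]; exists V => P hP; apply: hV => x.
rewrite -(hP (pvec (h *m pmat x))) pmatK; apply: meval_eq => b.
by rewrite /orbit_comb lsub_lsub.
Qed.

(** The differential of the orbit map at the identity, acting on row vectors. *)
Definition lie_matrix F : 'M[C]_(n * n, fd) :=
  \matrix_(a, k) crd (lie (vec_mx (delta_mx 0 a)) F) k.

Lemma lie_sum (u : 'rV[C]_(n * n)) F :
  lie (vec_mx u) F = \sum_a u 0 a *: lie (vec_mx (delta_mx 0 a)) F.
Proof. exact: lie_sum_basis. Qed.

Lemma mul_lie_matrix (u : 'rV[C]_(n * n)) F k :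
  (u *m lie_matrix F) 0 k = crd (lie (vec_mx u) F) k.
Proof.
rewrite lie_sum mxE /form_coords raddf_sum; apply: eq_bigr => a _ /=.
by rewrite mcoeffZ mxE.
Qed.

Lemma polyfun_lie_matrix a k : polyfun (fun v : 'I_fd -> C => lie_matrix (form_of v) a k).
Proof.
apply: (@polyfun_ext _ _ (fun v => (lie (vec_mx (delta_mx 0 a)) (form_of v))@_(bmnm (enum_val k)))).
  by move=> v; rewrite mxE.
exact: (coefpoly_lie (vec_mx (delta_mx 0 a)) (@coefpoly_form_of C n d)).
Qed.

Lemma lie_matrix_inv F : F \is d.-homog -> (forall E, lie E F = 0 -> E = 0) ->
  exists V, lie_matrix F *m V = 1%:M.
Proof.
move=> hF hE; apply/row_freeP; rewrite -kermx_eq0; apply/rowV0P => u /sub_kermxP hu.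
suff : vec_mx u = 0 :> 'M[C]_n by move/(congr1 mxvec); rewrite vec_mxK linear0.
apply: hE; apply: (@form_coords_inj _ _ d); first exact: lie_homog.
  exact: dhomog0.
by move=> k; rewrite -mul_lie_matrix hu mxE /form_coords mcoeff0.
Qed.

Lemma jacobian_poly_subproof (V : 'M[C]_(fd, n * n)) : exists P : {mpoly C[fd]},
  forall F, F \is d.-homog -> form_eval P F = \det (lie_matrix F *m V).
Proof.
have [P hP] : polyfun (fun v : 'I_fd -> C => \det (lie_matrix (form_of v) *m V)).
  apply: polyfun_det.
  apply: (@polyfun_mulmx _ _ _ _ _ (fun v => lie_matrix (form_of v)) (fun=> V)).
    exact: polyfun_lie_matrix.
  by move=> i j; apply: polyfun_cst.
by exists P => F hF; rewrite /form_eval -hP form_of_coords.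
Qed.

Definition jacobian_poly (V : 'M[C]_(fd, n * n)) := projT1 (cid (jacobian_poly_subproof V)).

Lemma jacobian_polyE (V : 'M[C]_(fd, n * n)) F : F \is d.-homog ->
  form_eval (jacobian_poly V) F = \det (lie_matrix F *m V).
Proof. exact: (projT2 (cid (jacobian_poly_subproof V))). Qed.

(* Jacobian criterion: differentiate an algebraic relation of minimal degree. *)
Lemma jacobian_full_orbit V F : F \is d.-homog ->
  form_eval (jacobian_poly V) F != 0 -> full_orbit F.
Proof.
move=> hF; rewrite jacobian_polyE // => hd; exists V.
pose D := orbit_poly (jacobian_poly V) F.
have DE x : D.@[x] = \det (lie_matrix (lsub (pmat x) F) *m V).
  by rewrite orbit_polyE // jacobian_polyE // lsub_homog.
have D0 : D != 0.
  apply: contraNneq hd => D0; have := DE (pvec 1%:M).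
  by rewrite D0 meval0 pmatK lsub1 => <-.
have polyl (P : {mpoly C[n * n]}) : polyfun (fun x => P.@[orbit_comb V F (pmat x)]).
  apply: polyfun_comp => b; apply: polyfun_sum => k _.
  apply: polyfunM; last exact: polyfun_cst.
  by apply: polyfun_ext (polyfun_meval (orbit_poly ('X_k : {mpoly C[fd]}) F)) => x;
    rewrite orbit_coordE.
suff main e : forall P : {mpoly C[n * n]}, (msize P <= e)%N ->
    (forall x, P.@[orbit_comb V F (pmat x)] = 0) -> P = 0.
  by move=> P; apply: main (leqnn _).
elim: e => [|e IH] P sP hP.
  by apply/eqP; rewrite -msize_poly_eq0; move: sP; rewrite leqn0.
(* The chain rule along each one-parameter direction gives [lie_matrix G *m V *m z = 0] for the
   gradient [z] of [P]. Where [D] is nonzero the matrix is invertible; hence the partial derivatives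
   are again relations, of smaller size. *)
have dP i : P^`M(i) = 0.
  apply: IH; first exact: msize_deriv_lt.
  have [Q hQ] := polyl P^`M(i); move=> x; rewrite hQ.
  suff -> : Q = 0 by rewrite meval0.
  apply: (mpoly_ext0 D0) => {}x; rewrite DE -hQ => hDx.
  set G := lsub (pmat x) F in hDx; have hG : G \is d.-homog by apply: lsub_homog.
  pose z : 'cV[C]_(n * n) := \col_b (P^`M(b)).@[orbit_comb V F (pmat x)].
  have hz : lie_matrix G *m V *m z = 0.
    apply/matrixP => a j; rewrite [RHS]mxE.
    pose E : 'M[C]_n := vec_mx (delta_mx 0 a).
    have [h hh] := coords_lsub_taylor E hG.
    pose y b := \sum_k crd (lie E G) k * V k b.
    pose h' b : {poly C} := \sum_k V k b *: h k.
    have [q hq] := taylor P (orbit_comb V F (pmat x)) y h'.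
    have /esym e0 : 0 = \sum_b (P^`M(b)).@[orbit_comb V F (pmat x)] * y b.
      apply: (@quadratic_unique C 0 0 (P.@[orbit_comb V F (pmat x)]) _ 0 q 1).
        exact: oner_neq0.
      move=> t _; rewrite -hq mulr0 horner0 mulr0 !addr0.
      rewrite -[LHS](hP (pvec (pmat x *m (1%:M + t *: E)))) pmatK.
      apply: meval_eq => b; rewrite /orbit_comb -lsub_lsub -/G.
      rewrite /y /h' horner_sum !mulr_sumr -!big_split; apply: eq_bigr => k _ /=.
      by rewrite hh hornerZ; ring.
    rewrite -[RHS]e0 mxE; apply: eq_bigr => b _; rewrite mulrC; congr (_ * _).
      by rewrite mxE.
    rewrite mxE; apply: eq_bigr => k _; congr (_ * _); by rewrite mxE.
  have : z = 0.
    have uM : lie_matrix G *m V \in unitmx by rewrite unitmxE unitfE.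
    by rewrite -[z]mul1mx -(mulVmx uM) -mulmxA hz mulmx0.
  by move/matrixP/(_ i 0); rewrite !mxE.
have [c eP] : exists c, P = c%:MP by eexists; apply: deriv_eq0_const dP.
have := hP (pvec 1%:M); by rewrite eP mevalC => ->; rewrite mpolyC0.
Qed.

Definition vanish_orbit F (P : {mpoly C[fd]}) : Prop :=
  forall g, g \in unitmx -> form_eval P (lsub g F) = 0.

Lemma orbit_poly_eq0 F (P : {mpoly C[fd]}) : F \is d.-homog -> vanish_orbit F P ->
  orbit_poly P F = 0.
Proof.
move=> hF hP; apply: (mpoly_ext0 (det_poly_neq0 C n)) => x dx.
by rewrite orbit_polyE // hP // unit_pmat.
Qed.

(* A point of the closure of an orbit outside of the orbit has an orbit of smaller
   dimension. *)
Lemma orbit_closure F1 F2 : F1 \is d.-homog -> F2 \is d.-homog -> full_orbit F2 ->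
  (forall P, vanish_orbit F1 P -> form_eval P F2 = 0) ->
  exists2 g, g \in unitmx & F2 = lsub g F1.
Proof.
move=> h1 h2 [V hV] hcl; pose w := det_poly C n; have w0 : w != 0 := det_poly_neq0 C n.
pose a k := w * orbit_poly ('X_k : {mpoly C[fd]}) F1.
have aE x : w.@[x] != 0 ->
    (fun k => (a k).@[x] / w.@[x]) =1 form_coords d (lsub (pmat x) F1).
  by move=> wx k; rewrite mevalM mulrAC mulfV // mul1r orbit_coordE.
have vanE P : vanish_orbit F1 P -> im_vanish a w P.
  by move=> hP x wx; rewrite (meval_eq _ (aE x wx)) -/(form_eval P _) hP // unit_pmat.
have Evan P : im_vanish a w P -> vanish_orbit F1 P.
  move=> hP g gu; have wx : w.@[pvec g] != 0 by rewrite -unit_pmat pmatK.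
  by have := hP _ wx; rewrite (meval_eq _ (aE _ wx)) pmatK.
have clg P g : vanish_orbit F1 P -> g \in unitmx -> form_eval P (lsub g F2) = 0.
  move=> hP gu; have [Q hQ] : polyfun (fun v : 'I_fd -> C => form_eval P (lsub g (form_of v))).
    exists (P \mPo [tuple \sum_b (act_coef C b k).@[pvec g] *: 'X_b | k < fd]) => v.
    rewrite comp_mpoly_meval; apply: meval_eq => k; rewrite tnth_mktuple raddf_sum /=.
    rewrite -[g in LHS]pmatK act_coefE ?form_of_homog //; apply: eq_bigr => b _.
    by rewrite mevalZ mevalXU coords_form_of mulrC.
  rewrite -{1}(form_of_coords h2) hQ; apply: (hcl Q) => g' g'u.
  rewrite /form_eval -hQ form_of_coords ?lsub_homog // lsub_lsub hP //.
  by rewrite unitmx_mul g'u.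
have [h [nh hh]] := chevalley a w0.
(* If the orbit of [F2] meets the open part [h != 0] of the closure, it meets the orbit of [F1] and
   the two coincide. *)
case: (pselect (exists2 g, g \in unitmx & form_eval h (lsub g F2) != 0)) => [[g gu hg]|hno].
  have [P vP|x [wx hx]] := hh (form_coords d (lsub g F2)) hg; first by apply: clg => //;
    apply: Evan.
  have e : lsub g F2 = lsub (pmat x) F1.
    apply: (@form_coords_inj _ _ d); [exact: lsub_homog|exact: lsub_homog|move=> k].
    by rewrite hx; apply: aE.
  exists (pmat x *m invmx g); first by rewrite unitmx_mul unit_pmat wx unitmx_inv.
  by rewrite -lsub_lsub -e lsub_lsub mulmxV // lsub1.
have h0 g : g \in unitmx -> form_eval h (lsub g F2) = 0.
  by move=> gu; apply: contrapT => /eqP hg; apply: hno; exists g.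
pose f b : {mpoly C[n * n]} := \sum_k V k b *: orbit_poly ('X_k : {mpoly C[fd]}) F1.
have fE x : (fun b => (f b).@[x]) =1 orbit_comb V F1 (pmat x).
  move=> b; rewrite raddf_sum; apply: eq_bigr => k _ /=.
  by rewrite mevalZ orbit_coordE // mulrC.
(* Now [h] vanishes on the orbit of [F2]. The functions [f b] and [h] on the orbit of [F1] satisfy a
   relation, which will be shown to be 0 by induction on its degree in [h]. *)
have [P [P0 hP]] := algebraic_dependence f (orbit_poly h F1).
case/eqP: P0; have [e] := ubnP (size P); elim: e P hP => // e IH P hP; rewrite ltnS => sP.
(* The relation persists on the closure. On the orbit of [F2], where [h] is 0, only the constant
   term remains, and [hV] kills it. The relation is then divisible by ['X], and the factor [h] can
   be cancelled on the orbit of [F1]. *)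
have P00 : P`_0 = 0.
  apply: hV => x0.
  have pQ : polyfun (fun v : 'I_fd -> C =>
      (pev P (fun b => \sum_k v k * V k b)).[h.@[v]]).
    elim/poly_ind: P {hP sP} => [|Q c IHQ].
      by apply: polyfun_ext (polyfun_cst _ 0) => v; rewrite /pev rmorph0 horner0.
    apply: (@polyfun_ext _ _ (fun v => (pev Q (fun b => \sum_k v k * V k b)).[h.@[v]] * h.@[v]
       + c.@[fun b => \sum_k v k * V k b])).
      by move=> v; rewrite /pev rmorphD rmorphM /= map_polyX map_polyC hornerMXaddC.
    apply: polyfunD; first by apply: polyfunM => //; apply: polyfun_meval.
    apply: polyfun_comp => b; apply: polyfun_sum => k _.
    by apply: polyfunM; [apply: polyfun_var|apply: polyfun_cst].
  have [Q hQ] := pQ.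
  have vQ : vanish_orbit F1 Q.
    move=> g gu; rewrite /form_eval -hQ.
    transitivity ((pev P (fun i => (f i).@[pvec g])).[(orbit_poly h F1).@[pvec g]]);
      last exact: hP.
    rewrite (orbit_polyE _ _ h1) pmatK; congr (_.[_]); apply: eq_map_poly => c;
      apply: meval_eq => b.
    by rewrite fE pmatK.
  have P0g g : g \in unitmx -> (P`_0).@[orbit_comb V F2 g] = 0.
    move=> gu; have := clg Q g vQ gu; rewrite /form_eval -hQ -/(form_eval h _) h0 //.
    by rewrite horner_coef0 coef_map.
  have [B hB] : polyfun (fun x => (P`_0).@[orbit_comb V F2 (pmat x)]).
    apply: polyfun_comp => b; apply: polyfun_sum => k _.
    apply: polyfunM; last exact: polyfun_cst.
    by apply: polyfun_ext (polyfun_meval (orbit_poly ('X_k : {mpoly C[fd]}) F2)) => x;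
      rewrite orbit_coordE.
  rewrite hB; suff -> : B = 0 by rewrite meval0.
  by apply: (mpoly_ext0 w0) => x wx; rewrite -hB P0g // unit_pmat.
have [-> //|Pn0] := eqVneq P 0.
have [Q eQ] : exists Q, P = Q * 'X.
  exists (\poly_(i < size P) P`_i.+1); apply/polyP => i; rewrite coefMX.
  case: i => [|i] //=; rewrite coef_poly; case: ltnP => // hi.
  by rewrite nth_default // (leq_trans hi).
have sQ : (size Q < e)%N.
  by apply: leq_trans sP; rewrite eQ size_mulX //; apply: contraNneq Pn0 => Q0; rewrite eQ Q0 mul0r.
suff hQ : forall x, (pev Q (fun i => (f i).@[x])).[(orbit_poly h F1).@[x]] = 0.
  by rewrite eQ (IH Q hQ sQ) mul0r.
have [B hB] : polyfun (fun x => (pev Q (fun i => (f i).@[x])).[(orbit_poly h F1).@[x]]).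
  elim/poly_ind: (Q) => [|Q' c IHQ].
    by apply: polyfun_ext (polyfun_cst _ 0) => v; rewrite /pev rmorph0 horner0.
  apply: (@polyfun_ext _ _ (fun x => (pev Q' (fun i => (f i).@[x])).[(orbit_poly h F1).@[x]]
      * (orbit_poly h F1).@[x] + c.@[fun i => (f i).@[x]])).
    by move=> v; rewrite /pev rmorphD rmorphM /= map_polyX map_polyC hornerMXaddC.
  apply: polyfunD; first by apply: polyfunM => //; apply: polyfun_meval.
  by apply: polyfun_comp => b; apply: polyfun_meval.
move=> x; rewrite hB; suff -> : B = 0 by rewrite meval0.
have hn0 : orbit_poly h F1 != 0.
  apply/eqP => e0; apply: nh; apply: vanE => g gu.
  by rewrite -[g]pmatK -orbit_polyE // e0 meval0.
apply: (mpoly_ext0 hn0) => y hy; rewrite -hB.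
have := hP y; rewrite eQ /pev rmorphM /= map_polyX hornerM hornerX => /eqP.
by rewrite mulf_eq0 (negbTE hy) orbF => /eqP.
Qed.

Definition translate (h : 'M[C]_n) (P : {mpoly C[fd]}) : {mpoly C[fd]} :=
  P \mPo [tuple \sum_b (act_coef C b k).@[pvec h] *: 'X_b | k < fd].

Lemma translateE h P F : F \is d.-homog ->
  form_eval (translate h P) F = form_eval P (lsub h F).
Proof.
move=> hF; rewrite /form_eval comp_mpoly_meval; apply: meval_eq => k.
rewrite tnth_mktuple raddf_sum /= -[h in RHS]pmatK act_coefE //; apply: eq_bigr => b _.
by rewrite mevalZ mevalXU mulrC.
Qed.

Opaque translate.

Definition closed_orbit_in (I : {mpoly C[fd]}) F1 : Prop := forall F2, F2 \is d.-homog ->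
  form_eval I F2 != 0 -> (forall P, vanish_orbit F1 P -> form_eval P F2 = 0) ->
  exists2 g, g \in unitmx & F2 = lsub g F1.

Lemma orbit_polyD (P Q : {mpoly C[fd]}) F : orbit_poly (P + Q) F = orbit_poly P F + orbit_poly Q F.
Proof. exact: orbit_poly_add. Qed.

(* The invariant [I ^+ k] lies in the ideal generated by the translates of [a] and the
   equations of the orbit; apply the Reynolds operator to this relation. *)
Lemma separate_orbit l (I a : {mpoly C[fd]}) F1 : uncountable C -> F1 \is d.-homog ->
  semi_invariant l I -> form_eval I F1 != 0 -> closed_orbit_in I F1 ->
  form_eval a F1 != 0 ->
  exists s b h, h \in unitmx /\ form_eval (reynolds s (b * translate h a)) F1 != 0.
Proof.
move=> hC h1 hI I1 hcl a1.
pose id (P : {mpoly C[fd]}) := exists r : seq ({mpoly C[fd]} * 'M[C]_n), exists z,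
  [/\ forall t, t \in r -> t.2 \in unitmx, vanish_orbit F1 z &
      P = \sum_(t <- r) t.1 * translate t.2 a + z].
have idid : is_ideal id.
  split.
  - exists [::], 0; split=> //; last by rewrite big_nil addr0.
    by move=> g gu; rewrite /form_eval meval0.
  - move=> p q [r [z [hr hz ->]]] [r' [z' [hr' hz' ->]]]; exists (r ++ r'), (z + z'); split.
    + by move=> t; rewrite mem_cat => /orP[/hr|/hr'].
    + by move=> g gu; have := hz g gu; have := hz' g gu; rewrite /form_eval mevalD => -> ->;
      rewrite addr0.
    + by rewrite big_cat /= addrACA.
  - move=> p q [r [z [hr hz ->]]].
    exists [seq (q * t.1, t.2) | t <- r], (q * z); split.
    + by move=> t /mapP[t' /hr ? ->].
    + by move=> g gu; have := hz g gu; rewrite /form_eval mevalM => ->; rewrite mulr0.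
    + rewrite big_map mulrDr mulr_sumr; congr (_ + _); apply: eq_bigr => t _.
      by rewrite mulrA.
(* A zero of this ideal outside [I = 0] lies in the closure of the orbit, hence in the orbit by
   closedness; but the translate of [a] that moves it back to [F1] is nonzero there. *)
have [k [r [z [hr hz eI]]]] : exists k, id (I ^+ k).
  apply: nullstellensatz => // x hx; apply: contrapT => /eqP Ix.
  have [||g gu e2] := hcl (form_of x) (form_of_homog x).
  - by rewrite form_eval_form_of.
  - move=> P vP; rewrite form_eval_form_of; apply: hx; exists [::], P; split=> //.
    by rewrite big_nil add0r.
  have /hx : id (translate (invmx g) a).
    exists [:: (1, invmx g)], 0; split.
    + by move=> t; rewrite inE => /eqP ->; rewrite unitmx_inv.
    + by move=> g' _; rewrite /form_eval meval0.
    + by rewrite big_seq1 mul1r addr0.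
  rewrite -form_eval_form_of translateE ?form_of_homog // e2 lsub_invKV // => /eqP.
  by rewrite (negbTE a1).
pose s := (l * k)%N.
(* On the orbit, [I ^+ k] is a nonzero multiple of the power [s = l * k] of the determinant, which
   [omega s] does not kill. *)
have : omega s (orbit_poly (I ^+ k) F1) != 0.
  have -> : orbit_poly (I ^+ k) F1 = form_eval I F1 ^+ k *: det_poly C n ^+ s.
    apply: mpoly_eval_inj => x; rewrite orbit_polyE // mevalZ rmorphXn /= det_poly_eval.
    have fX G : form_eval (I ^+ k) G = form_eval I G ^+ k by rewrite /form_eval rmorphXn.
    rewrite fX (semi_invariant_all _ hI h1).
    by rewrite exprMn -exprM mulrC.
  by rewrite omegaZ mulf_neq0 ?expf_neq0 ?omega_det_neq0.
rewrite eI orbit_polyD (orbit_poly_eq0 h1 hz) addr0 => h.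
suff [t tr ht] : exists2 t, t \in r & omega s (orbit_poly (t.1 * translate t.2 a) F1) != 0.
  by exists s, t.1, t.2; split; [apply: hr|rewrite reynoldsE].
apply: contrapT => hno; case/eqP: h.
have {hr eI} : forall t, t \in r -> omega s (orbit_poly (t.1 * translate t.2 a) F1) = 0.
  by move=> t tr; apply: contrapT => /eqP ht; apply: hno; exists t.
elim: r {hno} => [|t r IH] ht.
  by rewrite big_nil orbit_poly_eq0 ?omega0 // => g _; rewrite /form_eval meval0.
rewrite big_cons orbit_polyD omegaD ht ?mem_head // IH ?addr0 // => t' t'r.
by apply: ht; rewrite inE t'r orbT.
Qed.
End OrbitClosure.

Transparent translate.

(** ** Descent of an invariant along an equivariant map *)

Section Descent.
Variables (C : numClosedFieldType) (n m d : nat).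
Local Notation fm := (form_dim n m).
Local Notation fd := (form_dim n d).
Implicit Types F G Q : {mpoly C[n]}.

Variables (good : {mpoly C[n]} -> Prop) (Phi : {mpoly C[n]} -> {mpoly C[n]}).
Variable f : {mpoly C[n]} -> C.

Hypothesis good_homog : forall Q, good Q -> Q \is m.-homog.
Hypothesis Phi_homog : forall Q, good Q -> Phi Q \is d.-homog.
Hypothesis Phi_local : forall Q0, good Q0 ->
  exists (w : {mpoly C[fm]}) (a : 'I_fd -> {mpoly C[fm]}),
  form_eval w Q0 != 0 /\ forall Q, good Q -> form_eval w Q != 0 ->
    forall k, form_coords d (Phi Q) k = form_eval (a k) Q / form_eval w Q.
Hypothesis good_generic : exists2 w : {mpoly C[fm]}, w != 0 &
  forall Q, Q \is m.-homog -> form_eval w Q != 0 -> good Q.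
Hypothesis Phi_equivariant : forall Q g, good Q -> g \in unitmx ->
  exists Q', [/\ good Q', Phi Q' = lsub g (Phi Q) & f Q' = f Q].
Hypothesis f_local : forall Q0, good Q0 -> exists w p q : {mpoly C[fm]},
  form_eval w Q0 != 0 /\ forall Q, good Q -> form_eval w Q != 0 ->
    form_eval q Q != 0 /\ f Q = form_eval p Q / form_eval q Q.
Hypothesis f_fibre : forall Q Q', good Q -> good Q' -> Phi Q = Phi Q' -> f Q = f Q'.

(** The equation [f = (p / q) o Phi] without denominators, so that it also makes sense where [q]
    vanishes. *)
Definition proportional (p q : {mpoly C[fd]}) Q : Prop :=
  form_eval p (Phi Q) = f Q * form_eval q (Phi Q).

Lemma Phi_ratfun Q0 : good Q0 -> exists w : {mpoly C[fm]}, form_eval w Q0 != 0 /\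
  forall P : {mpoly C[fd]}, exists r, ratfun w r /\
    forall Q, good Q -> form_eval w Q != 0 ->
      form_eval P (Phi Q) = r (form_coords m Q).
Proof.
move=> gQ0; have [w [a [w0 hw]]] := Phi_local gQ0; exists w; split=> // P.
exists (fun x => P.@[fun k => (a k).@[x] / w.@[x]]); split.
  by apply: ratfun_comp => k; exists (a k), 1%N => v _; rewrite expr1.
by move=> Q gQ wQ; apply: meval_eq => k; rewrite hw.
Qed.

Lemma good_nonroot (w : {mpoly C[fm]}) : w != 0 -> exists2 Q, good Q & form_eval w Q != 0.
Proof.
have [wg wg0 hg] := good_generic => w0.
have [v] : exists v, (wg * w).@[v] != 0 by apply: mpoly_nonroot; rewrite mulf_neq0.
rewrite mevalM mulf_eq0 negb_or => /andP[gv wv]; exists (form_of v).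
  by apply: hg; rewrite ?form_of_homog // form_eval_form_of.
by rewrite form_eval_form_of.
Qed.

Lemma Phi_open (P : {mpoly C[fd]}) Q0 : good Q0 -> form_eval P (Phi Q0) != 0 ->
  exists2 w : {mpoly C[fm]}, w != 0 &
    forall Q, good Q -> form_eval w Q != 0 -> form_eval P (Phi Q) != 0.
Proof.
move=> gQ0 PQ0; have [w [w0 /(_ P)[r [rr hr]]]] := Phi_ratfun gQ0.
rewrite hr // in PQ0.
have [B B0 hB] := ratfun_nonzero rr w0 PQ0; exists B.
  by apply: contraNneq B0 => ->; rewrite meval0.
by move=> Q gQ /hB[wQ rQ]; rewrite hr.
Qed.

(** Near each good form both sides are rational functions with nonvanishing denominators, so an
    identity on a dense open set extends to it. *)
Lemma proportional_closed p q : (exists2 w : {mpoly C[fm]}, w != 0 &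
    forall Q, good Q -> form_eval w Q != 0 -> proportional p q Q) ->
  forall Q, good Q -> proportional p q Q.
Proof.
move=> [w1 w10 h1] Q0 gQ0; have [w [w0 hw]] := Phi_ratfun gQ0.
have [r [rr hr]] := hw p; have [r' [rr' hr']] := hw q.
have [wf [pf [qf [wf0 hf]]]] := f_local gQ0.
have [wg wg0 hg] := good_generic.
have [qf0 ef0] := hf _ gQ0 wf0.
suff : forall v, w.@[v] != 0 -> r v * qf.@[v] - pf.@[v] * r' v = 0.
  move=> /(_ (form_coords m Q0) w0) /eqP; rewrite subr_eq0 => /eqP e.
  rewrite /proportional hr // hr' // ef0; apply: (mulIf qf0); rewrite [LHS]e.
  by rewrite mulrAC divfK.
apply: (@ratfun_ext0 _ _ w (wf * wg * w1)) => [||v wv].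
- apply: ratfunD; first by apply: ratfunM => //; apply/ratfun_poly/polyfun_meval.
  apply: (@ratfun_ext _ _ w (fun v => (- 1) * (pf.@[v] * r' v))) => [v _|].
    by rewrite mulN1r.
  apply: ratfunM; first exact/ratfun_poly/polyfun_cst.
  by apply: ratfunM => //; apply/ratfun_poly/polyfun_meval.
- by rewrite !mulf_neq0 //; apply: contraNneq wf0 => ->; rewrite /form_eval meval0.
rewrite !mevalM !mulf_eq0 !negb_or => /andP[/andP[wfv wgv] w1v].
have gv : good (form_of v) by apply: hg; [apply: form_of_homog|rewrite form_eval_form_of].
have ev (P : {mpoly C[fm]}) : form_eval P (form_of v) = P.@[v] := form_eval_form_of P v.
have rE (s : ('I_fm -> C) -> C) (B : {mpoly C[fm]}) K :
    (forall v, w.@[v] != 0 -> s v = B.@[v] / w.@[v] ^+ K) ->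
    s (form_coords m (form_of v)) = s v.
  move=> hs; rewrite !hs //; last by rewrite -/(form_eval w _) ev.
  by rewrite -!/(form_eval _ _) !ev.
have [qv efv] : qf.@[v] != 0 /\ f (form_of v) = pf.@[v] / qf.@[v].
  by have := hf _ gv; rewrite !ev; apply.
have {}h1 := h1 _ gv; rewrite ev in h1; have := h1 w1v.
rewrite /proportional hr ?hr' // ?ev // efv.
case: rr => B [K /rE ->]; case: rr' => B' [K' /rE ->] ->.
by rewrite mulrAC divfK // subrr.
Qed.

Lemma exists_rational : exists p q : {mpoly C[fd]},
  (forall Q, good Q -> proportional p q Q) /\
  exists Q, good Q /\ form_eval q (Phi Q) != 0.
Proof.
have [Qs gQs _] := good_nonroot (oner_neq0 _).
have [wP [a [wP0 hP]]] := Phi_local gQs; have [wf [pf [qf [wf0 hf]]]] := f_local gQs.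
have [wg wg0 hg] := good_generic; have [qf0 _] := hf _ gQs wf0.
have nz (P : {mpoly C[fm]}) : form_eval P Qs != 0 -> P != 0.
  by move=> h; apply: contraNneq h => ->; rewrite /form_eval meval0.
(* Common denominator: [Phi] has coordinates [a k / wP] and [f] is [pf / qf], while [wg * wf]
   confines the parameters to good forms where the second formula is valid. *)
pose w := wg * wf * (wP * qf).
have w0 : w != 0 by rewrite !mulf_neq0 //; apply: nz.
pose b (t : 'I_fd.+1) := wg * wf *
  (if unlift ord_max t is Some k then a k * qf else pf * wP).
have wE x : w.@[x] != 0 -> [/\ good (form_of x), wg.@[x] != 0, wf.@[x] != 0,
    wP.@[x] != 0 & qf.@[x] != 0].
  rewrite !mevalM !mulf_eq0 !negb_or => /andP[/andP[h1 h2] /andP[h3 h4]]; split=> //.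
  by apply: hg; [apply: form_of_homog|rewrite form_eval_form_of].
have bE x k : w.@[x] != 0 -> graph_base b w x k = form_coords d (Phi (form_of x)) k.
  move=> wx; have [gx h1 h2 h3 h4] := wE x wx; rewrite hP // ?form_eval_form_of //.
  rewrite /graph_base /b; have -> : widen_ord (leqnSn fd) k = lift ord_max k.
    by apply: val_inj; rewrite /= /bump leqNgt ltn_ord.
  rewrite liftK !mevalM; field.
  by rewrite h1 h2 h3 h4.
have vE x : w.@[x] != 0 -> graph_val b w x = f (form_of x).
  move=> wx; have [gx h1 h2 h3 h4] := wE x wx.
  have [|_ ->] := hf _ gx; first by rewrite form_eval_form_of.
  rewrite /graph_val /b unlift_none !mevalM !form_eval_form_of; field.
  by rewrite h1 h2 h3 h4.
have [|p [q [nq hpq]]] := @graph_rational C fm fd b w w0.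
  move=> x0 x wx0 wx hu; have [g0 _ _ _ _] := wE _ wx0; have [g _ _ _ _] := wE _ wx.
  rewrite !vE //; apply: f_fibre => //.
  apply: (@form_coords_inj _ _ d); [exact: Phi_homog|exact: Phi_homog|move=> k].
  by have := hu k; rewrite !bE.
exists p, q; split.
  apply: proportional_closed; exists w => // Q gQ wQ.
  have eQ : form_of (form_coords m Q) = Q by rewrite form_of_coords // good_homog.
  have := hpq (form_coords m Q) wQ.
  by rewrite vE // !(meval_eq _ (fun k => bE _ k wQ)) eQ mulrC.
have /existsNP[x hx] := nq.
have [wx /eqP qx] : w.@[x] != 0 /\ q.@[graph_base b w x] <> 0 by apply/not_implyP.
have [gx _ _ _ _] := wE _ wx; exists (form_of x); split=> //.
by rewrite /form_eval -(meval_eq _ (fun k => bE x k wx)).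
Qed.

(** Each form in the group orbit of [Phi Q] is the image of a form at which [f] has the value [f Q].
    Proportionality at these forms makes the orbit polynomials proportional with the same scalar. *)
Lemma proportional_translate p q b h Q : (forall Q, good Q -> proportional p q Q) ->
  good Q -> h \in unitmx ->
  orbit_poly (b * translate h p) (Phi Q) = f Q *: orbit_poly (b * translate h q) (Phi Q).
Proof.
move=> hpq gQ hu; have tE (P : {mpoly C[fd]}) F : F \is d.-homog ->
    form_eval (b * translate h P) F = form_eval b F * form_eval P (lsub h F).
  by move=> hF; rewrite -translateE // /form_eval mevalM.
move: (tE p) (tE q); move: (b * translate h p) (b * translate h q) => P1 P2 e1 e2.
apply/eqP; rewrite -subr_eq0; apply/eqP.
apply: (mpoly_ext0 (det_poly_neq0 C n)) => x dx; have hP := Phi_homog gQ.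
have [Q' [gQ' eQ' fQ']] := Phi_equivariant gQ (etrans (unit_pmat x) dx : pmat x \in unitmx).
have [Q2 [gQ2 eQ2 fQ2]] := Phi_equivariant gQ' hu.
rewrite mevalB mevalZ (orbit_polyE P1 x hP) (orbit_polyE P2 x hP) -eQ'.
have hQ' := Phi_homog gQ'.
by rewrite e1 // e2 // -eQ2 (hpq _ gQ2) fQ2 fQ' mulrCA subrr.
Qed.

Variables (l : nat) (I : {mpoly C[fd]}) (Q0 : {mpoly C[n]}).
Hypotheses (hC : uncountable C) (gQ0 : good Q0).
Hypothesis Q0_stabilizer : finite_stabilizer (Phi Q0).
Hypothesis I_inv : semi_invariant l I.
Hypothesis I_Q0 : form_eval I (Phi Q0) != 0.
Hypothesis Q0_closed : closed_orbit_in I (Phi Q0).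

(** Finite isotropy makes a Jacobian determinant of the orbit map nonzero at [Phi Q0]. Some average
    of a multiple of its translate is nonzero there; where this average is nonzero, the determinant
    is nonzero somewhere on the orbit, which therefore has full dimension. *)
Lemma full_orbit_invariant : exists s (J : {mpoly C[fd]}), [/\ semi_invariant s J,
  form_eval J (Phi Q0) != 0 &
  forall F, F \is d.-homog -> form_eval J F != 0 -> full_orbit d F].
Proof.
have hF := Phi_homog gQ0.
have [V hV] := lie_matrix_inv hF (finite_stabilizer_lie hF Q0_stabilizer).
have aV : form_eval (jacobian_poly V) (Phi Q0) != 0.
  by rewrite jacobian_polyE // hV det1 oner_eq0.
have [s [b [h [hu hJ]]]] := separate_orbit hC hF I_inv I_Q0 Q0_closed aV.
exists s, (reynolds s (b * translate h (jacobian_poly V))); split=> //.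
  exact: reynolds_invariant.
move=> F hF'; rewrite reynoldsE // => hom.
have /mpoly_nonroot[x] : orbit_poly (b * translate h (jacobian_poly V)) F != 0.
  by apply: contraNneq hom => ->; rewrite omega0.
rewrite orbit_polyE // /form_eval mevalM mulf_eq0 negb_or -!/(form_eval _ _) => /andP[_].
have hx : lsub (pmat x) F \is d.-homog by apply: lsub_homog.
rewrite translateE // => hh.
by apply: full_orbit_lsub (full_orbit_lsub (jacobian_full_orbit _ hh)); apply: lsub_homog.
Qed.

Theorem descent : exists s (I1 J1 : {mpoly C[fd]}), [/\ semi_invariant s I1,
  semi_invariant s J1, exists Q, good Q /\ form_eval J1 (Phi Q) != 0 &
  forall Q, good Q -> proportional I1 J1 Q].
Proof.
have [p [q [hpq [Qq [gQq qQq]]]]] := exists_rational.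
have [s' [J [hJ JQ0 hJf]]] := full_orbit_invariant.
have [wI wI0 hwI] := Phi_open gQ0 I_Q0.
have [wJ wJ0 hwJ] := Phi_open gQ0 JQ0.
have [wq wq0 hwq] := Phi_open gQq qQq.
have eM (k : nat) (P P' : {mpoly C[form_dim n k]}) G :
    form_eval (P * P') G = form_eval P G * form_eval P' G by rewrite /form_eval mevalM.
(* At [Phi Q1] all of [I], [J] and [q] are nonzero. Since [J] forces full orbits, [orbit_closure]
   makes the orbit of [Phi Q1] closed where [I * J] is nonzero. *)
have [Q1 gQ1] : exists2 Q, good Q & form_eval (wI * wJ * wq) Q != 0.
  by apply: good_nonroot; rewrite !mulf_neq0.
rewrite !eM !mulf_eq0 !negb_or => /andP[/andP[/(hwI _ gQ1) I1 /(hwJ _ gQ1) J1] /(hwq _ gQ1) q1].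
have hF := Phi_homog gQ1.
have [||||s [b [h [hu hR]]]] := @separate_orbit C n d (l + s') (I * J) q (Phi Q1) hC hF.
- by move=> F g hF' gu; rewrite !eM I_inv // hJ // exprD mulrACA.
- by rewrite eM mulf_neq0.
- move=> F2 h2; rewrite eM mulf_eq0 negb_or => /andP[_ /(hJf _ h2) fo] hv.
  exact: orbit_closure hv.
- exact: q1.
have key Q gQ := @proportional_translate p q b h Q hpq gQ hu.
move: hR key; move: (b * translate h p) (b * translate h q) => P1 P2 hR key.
exists s, (reynolds s P1), (reynolds s P2); split.
- exact: reynolds_invariant.
- exact: reynolds_invariant.
- by exists Q1.
move=> Q gQ; have hQ := Phi_homog gQ; rewrite /proportional.
by rewrite (reynoldsE s P1 hQ) (reynoldsE s P2 hQ) key // omegaZ.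
Qed.

End Descent.

(** ** Jacobian ideals and associated forms *)

Section JacobianIdeal.
Variables (C : numClosedFieldType) (n m : nat).
Hypotheses (hn : (2 <= n)%N) (hm : (3 <= m)%N).
Local Notation N := (n * (m - 2))%N.
Local Notation dd := m.-1.
Implicit Types p q F Q : {mpoly C[n]}.

Definition jac Q p : Prop := exists g : 'I_n -> {mpoly C[n]}, p = \sum_j g j * Q^`M(j).

Definition hess Q : {mpoly C[n]} := \det (\matrix_(i < n, j < n) Q^`M(i)^`M(j)).

Lemma jacD Q p q : jac Q p -> jac Q q -> jac Q (p + q).
Proof.
move=> [g ->] [h ->]; exists (fun j => g j + h j).
by rewrite -big_split; apply: eq_bigr => j _; rewrite mulrDl.
Qed.
Lemma jacM Q p q : jac Q p -> jac Q (q * p).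
Proof.
by move=> [g ->]; exists (fun j => q * g j); rewrite mulr_sumr; apply: eq_bigr => j _;
  rewrite mulrA.
Qed.
Lemma jacZ Q c p : jac Q p -> jac Q (c *: p).
Proof. by rewrite -mul_mpolyC; apply: jacM. Qed.
Lemma jac0 Q : jac Q 0.
Proof. by exists (fun=> 0); rewrite big1 // => j _; rewrite mul0r. Qed.
Lemma jacN Q p : jac Q p -> jac Q (- p).
Proof. by rewrite -scaleN1r; apply: jacZ. Qed.
Lemma jac_sum Q (I : Type) (r : seq I) (P : pred I) (F : I -> {mpoly C[n]}) :
  (forall i, P i -> jac Q (F i)) -> jac Q (\sum_(i <- r | P i) F i).
Proof. by move=> h; apply: big_ind => //; [apply: jac0|move=> x y; apply: jacD]. Qed.
Lemma jac_deriv Q i : jac Q Q^`M(i).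
Proof.
exists (fun j => (j == i)%:R); rewrite (bigD1 i) //= eqxx mul1r big1 ?addr0 // => j ji.
by rewrite (negbTE ji) mul0r.
Qed.

Lemma deriv_homog Q k i : Q \is k.-homog -> Q^`M(i) \is k.-1.-homog.
Proof.
move=> hQ; apply/dhomogP => b; rewrite mcoeff_msupp mcoeff_deriv => h.
have : (b + U_(i))%MM \in msupp Q.
  by rewrite mcoeff_msupp; apply: contraNneq h => ->; rewrite mul0rn.
by move=> /(dhomog_mf hQ) /=; rewrite mdegD mdeg1 addn1 => <-.
Qed.

Definition hcomp k p : {mpoly C[n]} := pihomog mdeg k p.

Lemma hcomp_homog k p : hcomp k p \is k.-homog.
Proof. exact: pihomogP. Qed.

Lemma hcomp_id k p : p \is k.-homog -> hcomp k p = p.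
Proof. exact: pihomog_dE. Qed.

Lemma hcompD k p q : hcomp k (p + q) = hcomp k p + hcomp k q.
Proof. exact: raddfD. Qed.

Lemma hcompZ k c p : hcomp k (c *: p) = c *: hcomp k p.
Proof. exact: linearZ. Qed.

Lemma hcomp_sum k (I : Type) (r : seq I) (P : pred I) (F : I -> {mpoly C[n]}) :
  hcomp k (\sum_(i <- r | P i) F i) = \sum_(i <- r | P i) hcomp k (F i).
Proof. exact: raddf_sum. Qed.

Lemma hcomp_ne k e p : k != e -> p \is e.-homog -> hcomp k p = 0.
Proof. by move=> ke hp; apply: (pihomog_ne0 _ hp); rewrite eq_sym. Qed.

Lemma hcompM k e p q : q \is e.-homog -> hcomp k (p * q) =
  if (e <= k)%N then hcomp (k - e) p * q else 0.
Proof.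
move=> hq; elim/mpolyind: p => [|c b p _ _ IH].
  by rewrite mul0r /hcomp !raddf0; case: ifP => // _; rewrite mul0r.
rewrite mulrDl hcompD IH -scalerAl hcompZ.
have hb : ('X_[b] : {mpoly C[n]}) \is (mdeg b).-homog by rewrite dhomogX.
have hbq : 'X_[b] * q \is (mdeg b + e).-homog by apply: dhomogM.
case: ifP => ek; last first.
  rewrite addr0 (hcomp_ne _ hbq) ?scaler0 //; apply/eqP => e1.
  by rewrite e1 leq_addl in ek.
rewrite hcompD mulrDl hcompZ -scalerAl; congr (_ *: _ + _).
have [e1|ne] := eqVneq (k - e)%N (mdeg b).
  by rewrite e1 (hcomp_id hb) (hcomp_id (k := k)) // -(subnK ek) e1.
rewrite (hcomp_ne _ hb) // mul0r (hcomp_ne _ hbq) //.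
by apply: contra_neq ne => ->; rewrite addnK.
Qed.

Lemma mpoly_hcomp p : p = \sum_(k < msize p) hcomp k p.
Proof. by rewrite {1}(pihomog_partitionE (mf := mdeg) (leqnn (msize p))). Qed.

Lemma jac_homog Q k p : Q \is m.-homog -> p \is k.-homog -> jac Q p ->
  if (dd <= k)%N then exists g : 'I_n -> {mpoly C[n]},
    (forall i, g i \is (k - dd).-homog) /\ p = \sum_j g j * Q^`M(j) else p = 0.
Proof.
move=> hQ hp [g ep]; have e : p = \sum_j hcomp k (g j * Q^`M(j)).
  by rewrite -hcomp_sum -ep hcomp_id.
case: ifP => dk.
  exists (fun j => hcomp (k - dd) (g j)); split=> [i|]; first exact: hcomp_homog.
  by rewrite e; apply: eq_bigr => j _; rewrite (hcompM _ _ (deriv_homog j hQ)) dk.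
by rewrite e big1 // => j _; rewrite (hcompM _ _ (deriv_homog j hQ)) dk.
Qed.

Lemma jac_hcomp Q k p : Q \is m.-homog -> jac Q p -> jac Q (hcomp k p).
Proof.
move=> hQ [g ->]; rewrite hcomp_sum; apply: jac_sum => j _.
rewrite (hcompM _ _ (deriv_homog j hQ)); case: ifP => _; last exact: jac0.
by apply: jacM; apply: jac_deriv.
Qed.

Lemma euler Q k : Q \is k.-homog -> \sum_j 'X_j * Q^`M(j) = k%:R *: Q.
Proof.
move=> hQ; apply/mpolyP => b; rewrite mcoeffZ raddf_sum /=.
have e j : ('X_j * Q^`M(j))@_b = Q@_b *+ b j.
  have [b0|bj] := eqVneq (b j) 0%N.
    rewrite b0 mulr0n; apply: memN_msupp_eq0;
      apply/negP => /msuppM_le/allpairsP[[b1 b2] /= [h1 _ e]].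
    move: h1; rewrite msuppX inE => /eqP e1.
    by move: b0; rewrite e e1 mnmDE mnm1E eqxx.
  have [b' eb] : exists b', b = (U_(j) + b')%MM.
    exists (b - U_(j))%MM; rewrite addmC submK //; apply/mnm_lepP => l; rewrite mnm1E.
    by case: eqP => // <-; rewrite lt0n.
  by rewrite eb mulrC mcoeffMX mcoeff_deriv mnmDE mnm1E eqxx addmC.
under eq_bigr do rewrite e.
rewrite sumrMnr -mdegE; have [bk|bk] := eqVneq (mdeg b) k.
  by rewrite bk mulr_natl.
by rewrite (dhomog_nemf_coeff hQ) // mul0rn mulr0.
Qed.

Lemma hess_homog Q : Q \is m.-homog -> hess Q \is N.-homog.
Proof.
move=> hQ; rewrite /hess /determinant; apply: rpred_sum => s _.
suff hp (t : 'I_n -> 'I_n) :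
    \prod_(i < n) (\matrix_(i < n, j < n) Q^`M(i)^`M(j)) i (t i) \is N.-homog.
  by case: (perm.odd_perm s); rewrite ?expr1 ?expr0 ?mulN1r ?mul1r ?rpredN; apply: hp.
have -> : N = (\sum_(i < n) (m - 2))%N by rewrite sum_nat_const card_ord.
elim: (index_enum _) => [|i r IH]; first by rewrite !big_nil dhomog1.
rewrite !big_cons; apply: dhomogM => //; rewrite mxE.
by have := deriv_homog (t i) (deriv_homog i hQ); rewrite subn2.
Qed.

(* Cramer's rule for the Euler relations of the partial derivatives. *)
Lemma hess_socle Q j : Q \is m.-homog -> jac Q ('X_j * hess Q).
Proof.
move=> hQ; pose H := \matrix_(i < n, l < n) Q^`M(i)^`M(l).
pose x : 'cV[{mpoly C[n]}]_n := \col_l 'X_l.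
have e : H *m x = dd%:R *: \col_i Q^`M(i).
  apply/matrixP => i l; rewrite !mxE mulrC.
  have := euler (deriv_homog i hQ); rewrite -mul_mpolyC mpolyC_nat mulrC => <-.
  by apply: eq_bigr => a _; rewrite !mxE mulrC.
have : \adj H *m (H *m x) = hess Q *: x by rewrite mulmxA mul_adj_mx mul_scalar_mx.
move/matrixP/(_ j 0); rewrite [RHS]mxE [X in _ = _ * X]mxE mulrC => <-.
rewrite e -scalemxAr mxE; apply: jacM; rewrite mxE; apply: jac_sum => i _.
by apply: jacM; rewrite mxE; apply: jac_deriv.
Qed.

(* [lam p] is the value of omega on the class of the component of degree [N] of [p]. *)
Record gor Q (lam : {mpoly C[n]} -> C) : Prop := Gor {
  gor_lin : forall c p q, lam (c *: p + q) = c * lam p + lam q;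
  gor_jac : forall p, jac Q p -> lam p = 0;
  gor_hess : lam (hess Q) = 1;
  gor_deg : forall k p, k != N -> p \is k.-homog -> lam p = 0;
  gor_ker : forall p, p \is N.-homog -> lam p = 0 -> jac Q p;
  gor_top : forall k p, (N < k)%N -> p \is k.-homog -> jac Q p;
  gor_soc : forall k p, (k < N)%N -> p \is k.-homog ->
    (forall j, jac Q ('X_j * p)) -> jac Q p }.

Section Gor.
Variables (Q : {mpoly C[n]}) (lam : {mpoly C[n]} -> C).
Hypotheses (hQ : Q \is m.-homog) (hl : gor Q lam).

Lemma lam0 : lam 0 = 0.
Proof. by apply: (gor_jac hl); apply: jac0. Qed.
Lemma lamD p q : lam (p + q) = lam p + lam q.
Proof. by have := gor_lin hl 1 p q; rewrite scale1r mul1r. Qed.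
Lemma lamZ c p : lam (c *: p) = c * lam p.
Proof. by have := gor_lin hl c p 0; rewrite !addr0 lam0 addr0. Qed.
Lemma lam_sum (I : Type) (r : seq I) (P : pred I) (F : I -> {mpoly C[n]}) :
  lam (\sum_(i <- r | P i) F i) = \sum_(i <- r | P i) lam (F i).
Proof.
elim: r => [|i r IH]; first by rewrite !big_nil lam0.
by rewrite !big_cons; case: (P i); rewrite ?lamD IH.
Qed.

Lemma lam_form p : p \is N.-homog -> lam p = \sum_(k < form_dim n N) form_coords N p k *
  lam 'X_[bmnm (enum_val k)].
Proof.
move=> hp; rewrite -{1}(form_of_coords hp) lam_sum; apply: eq_bigr => k _.
by rewrite lamZ.
Qed.

Lemma gor_hess_rep p : p \is N.-homog -> jac Q (p - lam p *: hess Q).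
Proof.
move=> hp; apply: (gor_ker hl).
  by apply: rpredB => //; apply: rpredZ; apply: hess_homog.
by rewrite -scaleN1r lamD !lamZ (gor_hess hl) mulr1 mulN1r subrr.
Qed.

(** Gorenstein duality, by descending induction from degree [N]: each product ['X_j * p] pairs
    trivially in degree one higher, so [p] is annihilated by the variables and [gor_soc] applies. *)
Lemma gor_pairing k p : (k <= N)%N -> p \is k.-homog ->
  (forall b, mdeg b = (N - k)%N -> lam (p * 'X_[b]) = 0) -> jac Q p.
Proof.
have [e] := ubnP (N - k); elim: e k p => // e IH k p; rewrite ltnS => he kN hp hb.
have [ek|ne] := eqVneq k N.
  apply: (gor_ker hl); first by rewrite -ek.
  by have := hb 0%MM; rewrite mdeg0 ek subnn mpolyX0 mulr1; apply.
have kN' : (k < N)%N by rewrite ltn_neqAle ne.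
apply: (gor_soc hl kN' hp) => j.
have hX : ('X_j : {mpoly C[n]}) \is 1.-homog by rewrite dhomogX /= mdeg1.
apply: (IH k.+1) => //.
- by rewrite subnS prednK ?subn_gt0.
- by rewrite -add1n; apply: dhomogM.
move=> b be; rewrite [_ * p]mulrC -mulrA -mpolyXD; apply: hb.
by rewrite mdegD mdeg1 be add1n subnSK.
Qed.
End Gor.

(** In degree [N] every form is a multiple of the Hessian modulo the Jacobian ideal, and both
    functionals are 1 on the Hessian. *)
Lemma gor_unique Q lam lam' p : Q \is m.-homog -> gor Q lam -> gor Q lam' ->
  p \is N.-homog -> lam p = lam' p.
Proof.
move=> hQ h h' hp; have /(gor_jac h') := gor_hess_rep hQ h hp.
rewrite -scaleN1r (lamD h') !(lamZ h') (gor_hess h') mulr1 mulN1r => /eqP.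
by rewrite subr_eq0 => /eqP.
Qed.

Definition multinomial_coef (b : 'X_{1..n}) : C := ((\sum_j 'X_j) ^+ mdeg b)@_b.

Lemma multinomial_coef_neq0 b : multinomial_coef b != 0.
Proof.
rewrite /multinomial_coef.
have [e] := ubnP (mdeg b); elim: e b => // e IH b; rewrite ltnS => be.
have coef (c : 'X_{1..n}) k : 0 <= ((\sum_j 'X_j) ^+ k : {mpoly C[n]})@_c.
  elim: k c => [|k IHk] c; first by rewrite expr0 mcoeff1 ler0n.
  rewrite exprS mulr_suml raddf_sum sumr_ge0 // => j _ /=.
  rewrite mcoeffM sumr_ge0 // => k' _; rewrite mulr_ge0 // mcoeffX ler0n //.
have [->|b0] := eqVneq b 0%MM; first by rewrite mdeg0 expr0 mcoeff1 eqxx oner_eq0.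
have [i bi] : exists i, b i != 0%N.
  by apply/existsP; apply: contraNT b0 => /existsPn h0; apply/eqP/mnmP => i;
    rewrite mnm0E; apply/eqP; have := h0 i; rewrite negbK.
have [b' eb] : exists b', b = (U_(i) + b')%MM.
  exists (b - U_(i))%MM; rewrite addmC submK //; apply/mnm_lepP => l; rewrite mnm1E.
  by case: eqP => // <-; rewrite lt0n.
have lt : (mdeg b' < e)%N by move: be; rewrite eb mdegD mdeg1 add1n.
rewrite eb mdegD mdeg1 add1n exprS mulr_suml raddf_sum /= (bigD1 i) //=.
rewrite mulrC mcoeffMX gt_eqF // ltr_pwDl //; first by rewrite lt_neqAle coef eq_sym IH.
rewrite sumr_ge0 // => j _; rewrite mcoeffM sumr_ge0 // => k' _.
by rewrite mulr_ge0 // mcoeffX ler0n.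
Qed.

Lemma lam_power Q lam z : gor Q lam ->
  lam ((\sum_j z j *: 'X_j) ^+ N) =
  \sum_(k < form_dim n N) multinomial_coef (enum_val k) *
     lam 'X_[bmnm (enum_val k)] * \prod_i z i ^+ bmnm (enum_val k) i.
Proof.
move=> hl; pose sc p : {mpoly C[n]} := p \mPo [tuple z i *: 'X_i | i < n].
have e : (\sum_j z j *: 'X_j) ^+ N = sc ((\sum_j 'X_j) ^+ N).
  rewrite /sc rmorphXn /= rmorph_sum /=; congr (_ ^+ _); apply: eq_bigr => j _.
  by rewrite comp_mpolyXU -tnth_nth tnth_mktuple.
have hS : (\sum_j 'X_j : {mpoly C[n]}) ^+ N \is N.-homog.
  rewrite -[X in X.-homog]mul1n; apply: dhomogMn; apply: rpred_sum => j _.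
  by rewrite dhomogX /= mdeg1.
rewrite e -(form_of_coords hS) /form_of /sc rmorph_sum /= (lam_sum hl).
have eX b : 'X_[b] \mPo [tuple z i *: 'X_i | i < n] =
    (\prod_i z i ^+ b i) *: 'X_[b] :> {mpoly C[n]}.
  rewrite comp_mpolyX mpolyXE_id -scaler_prod; apply: eq_bigr => i _.
  by rewrite tnth_mktuple exprZn.
apply: eq_bigr => k _;
  rewrite comp_mpolyZ eX !(lamZ hl) /form_coords /multinomial_coef mdeg_monomial.
by rewrite -mulrA [X in _ * X]mulrC.
Qed.
End JacobianIdeal.

Section RankOpen.
Variable C : numClosedFieldType.

(** The matrices [U] and [V] compress [M v0] to an identity matrix of size its rank; the determinant
    of the same compression of [M v] is the required polynomial. *)
Lemma rank_open l a b (M : ('I_l -> C) -> 'M[C]_(a, b)) v0 :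
  (forall i j, polyfun (fun v => M v i j)) ->
  exists w : {mpoly C[l]}, w.@[v0] != 0 /\
    forall v, w.@[v] != 0 -> (\rank (M v0) <= \rank (M v))%N.
Proof.
move=> hM; have /row_fullP[U hU] := col_base_full (M v0).
have /row_freeP[V hV] := row_base_free (M v0).
have e : U *m M v0 *m V = 1%:M.
  transitivity (U *m (col_base (M v0) *m row_base (M v0)) *m V); first by rewrite mulmx_base.
  by rewrite mulmxA hU mul1mx hV.
have [w hw] : polyfun (fun v => \det (U *m M v *m V)).
  apply: polyfun_det.
  apply: (@polyfun_mulmx _ _ _ _ _ (fun v => U *m M v) (fun=> V)).
    apply: (@polyfun_mulmx _ _ _ _ _ (fun=> U) M) => // i j; exact: polyfun_cst.
  by move=> i j; apply: polyfun_cst.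
exists w; split; first by rewrite -hw e det1 oner_eq0.
move=> v; rewrite -hw => dv.
have uM : U *m M v *m V \in unitmx by rewrite unitmxE unitfE.
rewrite -(mxrank_unit uM); apply: leq_trans (mxrankM_maxl _ _) _.
exact: mxrankM_maxr.
Qed.
End RankOpen.

(** * The associated form in coordinates, and openness of the good forms *)

Section AssociatedForm.
Variables (C : numClosedFieldType) (n m : nat).
Local Notation N := (n * (m - 2))%N.
Local Notation dd := m.-1.
Local Notation fN := (form_dim n N).
Local Notation fm := (form_dim n m).
Implicit Types p q F Q : {mpoly C[n]}.

(* By the theory of complete intersections, every form of X_n^m is good. This is not
   needed: good forms contain a nonempty open set, and the associated form is 0
   elsewhere. *)
Definition good Q : Prop := Q \is m.-homog /\ exists lam, gor m Q lam.

Definition assoc_of (lam : {mpoly C[n]} -> C) : {mpoly C[n]} :=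
  form_of (fun k : 'I_fN => multinomial_coef C (bmnm (enum_val k)) * lam 'X_[bmnm (enum_val k)]).

Definition Phi Q : {mpoly C[n]} :=
  if pselect (exists lam, gor m Q lam) is left h then assoc_of (projT1 (cid h)) else 0.

Lemma PhiE Q lam : Q \is m.-homog -> gor m Q lam -> Phi Q = assoc_of lam.
Proof.
move=> hQ hl; rewrite /Phi; case: pselect => [h|[]]; last by exists lam.
have hl' := projT2 (cid h); set lam' := projT1 _ in hl' *.
apply: eq_bigr => k _; congr (_ * _ *: _).
by apply: (gor_unique hQ hl' hl); rewrite dhomogX /= mdeg_monomial.
Qed.

Lemma Phi_homog Q : good Q -> Phi Q \is N.-homog.
Proof. by move=> [hQ [lam hl]]; rewrite (PhiE hQ hl); apply: form_of_homog. Qed.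

Lemma Phi_eval Q lam z : Q \is m.-homog -> gor m Q lam ->
  (Phi Q).@[z] = lam ((\sum_j z j *: 'X_j) ^+ N).
Proof.
move=> hQ hl; rewrite (PhiE hQ hl) (lam_power _ hl) /assoc_of /form_of raddf_sum /=.
by apply: eq_bigr => k _; rewrite mevalZ mevalX.
Qed.

Lemma form_of_coords_hcomp k p : form_of (form_coords k p) = hcomp k p.
Proof.
apply: (@form_coords_inj _ _ k); first exact: form_of_homog.
  exact: hcomp_homog.
move=> b; rewrite coords_form_of /form_coords.
rewrite {1}[p]mpoly_hcomp raddf_sum /=.
have [km|km] := ltnP k (msize p).
  rewrite (bigD1 (Ordinal km)) //= big1 ?addr0 // => i ik.
  apply: (dhomog_nemf_coeff (hcomp_homog _ _)); rewrite /= mdeg_monomial.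
  by rewrite eq_sym; apply: contra_neq ik => e; apply: val_inj.
rewrite big1 => [|i _].
  rewrite /hcomp pihomogE raddf_sum big_seq_cond big1 // => c /andP[cp /eqP ck].
  by have := msize_mdeg_lt cp; rewrite ltnNge (_ : mdeg c = k :> nat) ?km.
apply: (dhomog_nemf_coeff (hcomp_homog _ _)); rewrite /= mdeg_monomial.
by rewrite gtn_eqF // (leq_trans (ltn_ord i)).
Qed.

Definition crow k p : 'rV[C]_(form_dim n k) := \row_b form_coords k p b.

Lemma crowD k p q : crow k (p + q) = crow k p + crow k q.
Proof. by apply/rowP => b; rewrite !mxE /form_coords mcoeffD. Qed.
Lemma crowZ k c p : crow k (c *: p) = c *: crow k p.
Proof. by apply/rowP => b; rewrite !mxE /form_coords mcoeffZ. Qed.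
Lemma crow0 k : crow k 0 = 0.
Proof. by apply/rowP => b; rewrite !mxE /form_coords mcoeff0. Qed.
Lemma crow_sum k (I : Type) (r : seq I) (P : pred I) (F : I -> {mpoly C[n]}) :
  crow k (\sum_(i <- r | P i) F i) = \sum_(i <- r | P i) crow k (F i).
Proof. by apply: big_morph; [apply: crowD|apply: crow0]. Qed.

Lemma crow_hcomp k p : crow k (hcomp k p) = crow k p.
Proof. by apply/rowP => b; rewrite !mxE -form_of_coords_hcomp coords_form_of. Qed.

Lemma crow_inj k p q : p \is k.-homog -> q \is k.-homog -> crow k p = crow k q -> p = q.
Proof.
by move=> hp hq /rowP e; apply: (form_coords_inj hp hq) => b; have := e b; rewrite !mxE.
Qed.

(** For [k < dd] the truncated difference leaves the partial derivatives themselves, of degree [dd];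
    for a form of degree [m] their rows in degree [k] are 0, as they should be. *)
Definition gens k : finType := ('I_(form_dim n (k - dd)) * 'I_n)%type.

Definition gen k Q (t : gens k) : {mpoly C[n]} :=
  'X_[bmnm (enum_val t.1)] * Q^`M(t.2).

Definition gradmx k Q : 'M[C]_(#|gens k|, form_dim n k) :=
  \matrix_(a < #|gens k|) crow k (gen Q (enum_val a : gens k)).

Lemma gen_jac k Q (t : gens k) : jac Q (gen Q t).
Proof. by apply: jacM; apply: jac_deriv. Qed.

Lemma jac_span k Q p : Q \is m.-homog -> p \is k.-homog ->
  jac Q p <-> (crow k p <= gradmx k Q)%MS.
Proof.
move=> hQ hp; split=> [/(jac_homog hQ hp)|].
  case: ifP => dk; last by move=> ->; rewrite crow0 sub0mx.
  move=> [g [hg ->]]; rewrite crow_sum; apply: summx_sub => j _.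
  rewrite -(form_of_coords (hg j)) mulr_suml crow_sum; apply: summx_sub => b _.
  rewrite -scalerAl crowZ; apply: scalemx_sub.
  have -> : crow k ('X_[bmnm (enum_val b)] * Q^`M(j)) =
      row (enum_rank ((b, j) : gens k)) (gradmx k Q) by rewrite rowK enum_rankK.
  exact: row_sub.
move=> /submxP[D eD]; rewrite -(hcomp_id hp) -form_of_coords_hcomp.
have -> : form_of (form_coords k p) = \sum_a D 0 a *: hcomp k (gen Q (enum_val a : gens k)).
  apply: (@crow_inj k); first exact: form_of_homog.
    by apply: rpred_sum => a _; apply: rpredZ; apply: hcomp_homog.
  rewrite form_of_coords // eD crow_sum mulmx_sum_row; apply: eq_bigr => a _.
  by rewrite rowK crowZ crow_hcomp.
by apply: jac_sum => a _; apply: jacZ; apply: (jac_hcomp _ hQ); apply: gen_jac.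
Qed.

Lemma row_full_forms k a (A : 'M[C]_(a, form_dim n k)) :
  (forall p, p \is k.-homog -> (crow k p <= A)%MS) -> row_full A.
Proof.
move=> h; rewrite -sub1mx; apply/row_subP => b.
have -> : row b 1%:M = crow k 'X_[bmnm (enum_val b)].
  apply/rowP => c; rewrite !mxE /form_coords mcoeffX; congr (nat_of_bool _)%:R.
  by apply/eqP/eqP => [->//|/monomial_inj].
by apply: h; rewrite dhomogX /= mdeg_monomial.
Qed.

Lemma polyfun_gradmx k a b : polyfun (fun v : 'I_fm -> C => gradmx k (form_of v) a b).
Proof.
apply: (@polyfun_ext _ _ (fun v => (gen (form_of v) (enum_val a : gens k))@_(bmnm (enum_val b)))).
  by move=> v; rewrite !mxE.
have h : coefpoly (fun v : 'I_fm -> C => gen (form_of v) (enum_val a : gens k)).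
  apply: coefpolyM; first exact: coefpoly_cst.
  exact: (coefpoly_deriv _ (@coefpoly_form_of C n m)).
exact: h.
Qed.

(** The values of the socle functional on monomials of degree [N] solve this linear system with
    right-hand side 0 on the Jacobian ideal and 1 on the Hessian. *)
Definition dualmx Q : 'M[C]_(#|gens N| + 1, fN) := col_mx (gradmx N Q) (crow N (hess Q)).

Lemma polyfun_dualmx a b : polyfun (fun v : 'I_fm -> C => dualmx (form_of v) a b).
Proof.
case: (splitP a) => [i ei|i ei].
  have -> : a = lshift 1 i by apply: val_inj.
  apply: polyfun_ext (polyfun_gradmx i b) => v; by rewrite col_mxEu.
have -> : a = rshift _ i by apply: val_inj.
apply: (@polyfun_ext _ _ (fun v : 'I_fm -> C => (hess (form_of v))@_(bmnm (enum_val b)))).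
  by move=> v; rewrite col_mxEd mxE.
have h : coefpoly (fun v : 'I_fm -> C => hess (form_of v)).
  apply: coefpoly_det => i' j'.
  apply: (@coefpoly_ext _ _ _ (fun v : 'I_fm -> C => (form_of v)^`M(i')^`M(j'))).
    by move=> v; rewrite mxE.
  exact: (coefpoly_deriv _ (coefpoly_deriv _ (@coefpoly_form_of C n m))).
exact: h.
Qed.

Definition lamcol (lam : {mpoly C[n]} -> C) : 'cV[C]_fN := \col_b lam 'X_[bmnm (enum_val b)].

Lemma crow_lamcol Q lam p : gor m Q lam -> p \is N.-homog ->
  crow N p *m lamcol lam = (lam p)%:M.
Proof.
move=> hl hp; apply/matrixP => i j; rewrite !ord1 [RHS]mxE eqxx mulr1n (lam_form hl hp).
by rewrite mxE; apply: eq_bigr => b _; rewrite !mxE.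
Qed.

Lemma dualmx_lamcol Q lam : Q \is m.-homog -> gor m Q lam ->
  dualmx Q *m lamcol lam = col_mx 0 1%:M.
Proof.
move=> hQ hl; rewrite mul_col_mx; congr col_mx; last first.
  by rewrite (crow_lamcol hl (hess_homog hQ)) (gor_hess hl).
apply/row_matrixP => a; rewrite row_mul rowK row0 -crow_hcomp.
rewrite (crow_lamcol hl (hcomp_homog _ _)) (gor_jac hl) ?raddf0 //.
by apply: (jac_hcomp _ hQ); apply: gen_jac.
Qed.

Lemma dualmx_full Q : good Q -> row_full (dualmx Q).
Proof.
move=> [hQ [lam hl]]; apply: row_full_forms => p hp.
have -> : p = (p - lam p *: hess Q) + lam p *: hess Q by rewrite subrK.
have hp' : p - lam p *: hess Q \is N.-homog.
  by apply: rpredB => //; apply: rpredZ; apply: hess_homog.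
rewrite crowD crowZ; apply: addmx_sub.
  apply: submx_trans (proj1 (jac_span hQ hp') (gor_hess_rep hQ hl hp)) _.
  by rewrite /dualmx -addsmxE addsmxSl.
by apply: scalemx_sub; rewrite /dualmx -addsmxE addsmxSr.
Qed.

(** A left inverse [U] at [Q0] makes [U *m dualmx Q] invertible near [Q0], and Cramer's rule gives
    the solution as a fraction of polynomials in the coefficients. *)
Lemma dual_formula Q0 : good Q0 -> exists (w : {mpoly C[fm]}) (c : 'I_fN -> {mpoly C[fm]}),
  form_eval w Q0 != 0 /\ forall Q, Q \is m.-homog -> form_eval w Q != 0 ->
    row_full (dualmx Q) /\ forall u : 'cV[C]_fN, dualmx Q *m u = col_mx 0 1%:M ->
      forall b, u b 0 = form_eval (c b) Q / form_eval w Q.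
Proof.
move=> gQ0; have /row_fullP[U hU] := dualmx_full gQ0.
pose e : 'cV[C]_(#|gens N| + 1) := col_mx 0 1%:M.
have pU : forall i j, polyfun (fun v : 'I_fm -> C => (U *m dualmx (form_of v)) i j).
  apply: (@polyfun_mulmx _ _ _ _ _ (fun=> U)).
    by move=> i j; apply: polyfun_cst.
  exact: polyfun_dualmx.
have [w hw] := polyfun_det pU.
have /choice[c hc] : forall b, polyfun (fun v : 'I_fm -> C =>
    (\adj (U *m dualmx (form_of v)) *m (U *m e)) b 0).
  move=> b; apply: (@polyfun_mulmx _ _ _ _ _ _ (fun=> U *m e)).
    exact: polyfun_adj.
  by move=> i j; apply: polyfun_cst.
have wE Q : Q \is m.-homog -> form_eval w Q = \det (U *m dualmx Q).
  by move=> hQ; rewrite /form_eval -hw form_of_coords.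
exists w, c; split; first by rewrite wE ?hU ?det1 ?oner_eq0 //; case: gQ0.
move=> Q hQ wQ; have dQ := wQ; rewrite wE // in dQ.
have uQ : U *m dualmx Q \in unitmx by rewrite unitmxE unitfE.
split.
  by apply/row_fullP; exists (invmx (U *m dualmx Q) *m U); rewrite -mulmxA mulVmx.
move=> u hu b; have := congr1 (fun A => (\adj (U *m dualmx Q) *m (U *m A)) b 0) hu.
rewrite /= [U *m (_ *m u)]mulmxA [LHS](congr1 (fun A => fun_of_matrix A b 0) (mulmxA _ _ _))
  mul_adj_mx mul_scalar_mx mxE.
rewrite -wE // => h; apply: (mulfI wQ); rewrite h mulrCA mulfV // mulr1.
by rewrite /form_eval -hc form_of_coords // mulmxA.
Qed.

Lemma Phi_local Q0 : good Q0 -> exists (w : {mpoly C[fm]}) (a : 'I_fN -> {mpoly C[fm]}),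
  form_eval w Q0 != 0 /\ forall Q, good Q -> form_eval w Q != 0 ->
    forall k, form_coords N (Phi Q) k = form_eval (a k) Q / form_eval w Q.
Proof.
move=> gQ0; have [w [c [w0 hw]]] := dual_formula gQ0.
exists w, (fun k => multinomial_coef C (bmnm (enum_val k)) *: c k); split=> //.
move=> Q [hQ [lam hl]] wQ k; have [_ hu] := hw _ hQ wQ.
rewrite (PhiE hQ hl) coords_form_of /form_eval mevalZ -mulrA; congr (_ * _).
by have := hu _ (dualmx_lamcol hQ hl) k; rewrite mxE.
Qed.

Lemma jac_monomials k Q : (forall p, p \is k.-homog -> jac Q p) ->
  forall e p, (k <= e)%N -> p \is e.-homog -> jac Q p.
Proof.
move=> hk; elim=> [|e IH] p ke hp.
  by apply: hk; move: ke; rewrite leqn0 => /eqP ->.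
move: ke; rewrite leq_eqVlt => /orP[/eqP ek|ke]; first by apply: hk; rewrite ek.
rewrite [p]mpolyE big_seq; apply: jac_sum => b bp; apply: jacZ.
have db : mdeg b = e.+1 := dhomog_mf hp bp.
have [i bi] : exists i, b i != 0%N.
  apply/existsP; apply: contraT => /existsPn h0; move: db.
  suff -> : b = 0%MM by rewrite mdeg0.
  by apply/mnmP => i; rewrite mnm0E; apply/eqP; have := h0 i; rewrite negbK.
have [b' eb] : exists b', b = (U_(i) + b')%MM.
  exists (b - U_(i))%MM; rewrite addmC submK //; apply/mnm_lepP => l; rewrite mnm1E.
  by case: eqP => // <-; rewrite lt0n.
rewrite eb mpolyXD; apply: jacM; apply: IH; first exact: ke.
by rewrite dhomogX /=; move: db; rewrite eb mdegD mdeg1 add1n => -[->].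
Qed.

(** The catalecticant matrix: the multiplication pairing between degrees [k] and [N - k]. *)
Definition pairmx k (c : 'X_{1..n} -> C) : 'M[C]_(form_dim n k, form_dim n (N - k)) :=
  \matrix_(a, b) c (bmnm (enum_val a) + bmnm (enum_val b))%MM.

Lemma crow_pairmx k (lam : {mpoly C[n]} -> C) p :
  (forall c p q, lam (c *: p + q) = c * lam p + lam q) -> p \is k.-homog ->
  forall b, (crow k p *m pairmx k (fun mu => lam 'X_[mu])) 0 b = lam (p * 'X_[bmnm (enum_val b)]).
Proof.
move=> hlin hp b; rewrite mxE -{2}(form_of_coords hp) mulr_suml.
have l0 : lam 0 = 0.
  have := hlin 1 0 0; rewrite scale1r addr0 mul1r => /eqP.
  by rewrite -subr_eq0 opprD addrA subrr sub0r oppr_eq0 => /eqP.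
transitivity (\sum_(j < form_dim n k) lam (form_coords k p j *: 'X_[bmnm (enum_val j)] *
    'X_[bmnm (enum_val b)])).
  apply: eq_bigr => j _; rewrite !mxE mpolyXD -scalerAl -[X in _ = lam X]addr0.
  by rewrite hlin l0 addr0.
symmetry; apply: (big_morph lam) => // x y.
by rewrite -[x]scale1r hlin mul1r scale1r.
Qed.

Lemma pairmx_rank Q lam k : Q \is m.-homog -> gor m Q lam -> (k <= N)%N ->
  (form_dim n k <= \rank (gradmx k Q) + \rank (pairmx k (fun mu => lam 'X_[mu])))%N.
Proof.
move=> hQ hl kN; set B := pairmx _ _.
have sub : (kermx B <= gradmx k Q)%MS.
  apply/row_subP => i; set r := row i _.
  have hr : r *m B = 0 by rewrite -row_mul mulmx_ker row0.
  pose p := form_of (fun b => r 0 b) : {mpoly C[n]}.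
  have hp : p \is k.-homog by apply: form_of_homog.
  have er : r = crow k p by apply/rowP => b; rewrite [RHS]mxE coords_form_of.
  rewrite er; apply/(jac_span hQ hp); apply: (gor_pairing hl kN hp) => b db.
  have [c <-] := monomialP db.
  by rewrite -(crow_pairmx (gor_lin hl) hp) -er hr mxE.
by have := mxrankS sub; rewrite mxrank_ker leq_subLR addnC.
Qed.

(** Ranks cannot drop near [Q0]. This keeps degree [N + 1] inside the Jacobian ideal and the
    pairings perfect; the assumed rank bound in degree [N] leaves room for a functional that kills
    the ideal. *)
Lemma good_generic_of Q0 : good Q0 ->
  (exists2 w : {mpoly C[fm]}, w != 0 & forall Q, Q \is m.-homog -> form_eval w Q != 0 ->
     (\rank (gradmx N Q) < fN)%N) ->
  exists2 w : {mpoly C[fm]}, w != 0 &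
    forall Q, Q \is m.-homog -> form_eval w Q != 0 -> good Q.
Proof.
move=> gQ0 [w3 w30 hw3]; have [hQ0 [lam0 hl0]] := gQ0.
have [wd [c [wd0 hwd]]] := dual_formula gQ0.
have openM a b (M : {mpoly C[n]} -> 'M[C]_(a, b)) :
    (forall i j, polyfun (fun v : 'I_fm -> C => M (form_of v) i j)) ->
    exists w : {mpoly C[fm]}, form_eval w Q0 != 0 /\ forall Q, Q \is m.-homog ->
      form_eval w Q != 0 -> (\rank (M Q0) <= \rank (M Q))%N.
  move=> hM; have [w [ww0 hw]] := rank_open (form_coords m Q0) hM.
  exists w; split=> // Q hQ wQ.
  by have := hw _ wQ; rewrite !form_of_coords.
have [wt [wt0 hwt]] := openM _ _ _ (@polyfun_gradmx N.+1).
have /choice[wA hwA] : forall k : nat, exists w : {mpoly C[fm]}, form_eval w Q0 != 0 /\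
    forall Q, Q \is m.-homog -> form_eval w Q != 0 ->
      (\rank (gradmx k Q0) <= \rank (gradmx k Q))%N.
  by move=> k; apply: openM; apply: polyfun_gradmx.
(* Numerators of the functional of [dual_formula] on all monomials, with value 0 outside degree
   [N]. *)
pose cm Q mu := \sum_(b < fN) (bmnm (enum_val b) == mu)%:R * form_eval (c b) Q.
have /choice[wB hwB] : forall k : nat, exists w : {mpoly C[fm]}, form_eval w Q0 != 0 /\
    forall Q, Q \is m.-homog -> form_eval w Q != 0 ->
      (\rank (pairmx k (cm Q0)) <= \rank (pairmx k (cm Q)))%N.
  move=> k; apply: (openM _ _ (fun Q => pairmx k (cm Q))) => i j.
  apply: (@polyfun_ext _ _ (fun v => cm (form_of v)
     (bmnm (enum_val i) + bmnm (enum_val j))%MM)); first by move=> v; rewrite mxE.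
  apply: polyfun_sum => b _; apply: polyfunZ.
  by exists (c b) => v; rewrite form_eval_form_of.
pose w := wt * wd * w3 * \prod_(k < N) (wA k * wB k).
have nz (P : {mpoly C[fm]}) : form_eval P Q0 != 0 -> P != 0.
  by move=> h; apply: contraNneq h => ->; rewrite /form_eval meval0.
exists w.
  rewrite !mulf_neq0 //; try exact: nz.
  rewrite prodf_seq_neq0; apply/allP => k _ /=.
  by rewrite mulf_neq0 // nz //; [case: (hwA k)|case: (hwB k)].
move=> Q hQ; rewrite /form_eval !mevalM rmorph_prod /= !mulf_eq0 !negb_or.
case/andP=> /andP[/andP[wtQ wdQ] w3Q] wABQ; split=> //.
have [full hu] := hwd _ hQ wdQ.
(* A functional killing the ideal in degree [N]. Fullness of [dualmx Q] prevents it from killing the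
   Hessian too, so it can be normalized. *)
have [u0 u0n hu0] : exists2 u : 'cV[C]_fN, u != 0 & gradmx N Q *m u = 0.
  have : kermx (gradmx N Q)^T != 0.
    by rewrite -mxrank_eq0 mxrank_ker mxrank_tr subn_eq0 -ltnNge hw3.
  case/rowV0Pn => r /sub_kermxP hr r0; exists r^T; first by rewrite trmx_eq0.
  by apply: trmx_inj; rewrite trmx_mul trmxK hr trmx0.
pose h0 := (crow N (hess Q) *m u0) 0 0.
have h0n : h0 != 0.
  apply: contraNneq u0n => e; have /row_fullP[B hB] := full.
  rewrite -[u0]mul1mx -hB -mulmxA mul_col_mx hu0.
  have -> : crow N (hess Q) *m u0 = 0 by apply/matrixP => i j; rewrite !ord1 [RHS]mxE; exact: e.
  by rewrite col_mx0 mulmx0.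
pose u := h0^-1 *: u0.
have hgu : gradmx N Q *m u = 0 by rewrite -scalemxAr hu0 scaler0.
have hhu : crow N (hess Q) *m u = 1%:M.
  apply/matrixP => i j; rewrite !ord1 -scalemxAr mxE -/h0 mulVf // mxE eqxx //.
have hdu : dualmx Q *m u = col_mx 0 1%:M by rewrite mul_col_mx hgu hhu.
pose lam p := (crow N p *m u) 0 0.
have lin a p q : lam (a *: p + q) = a * lam p + lam q.
  by rewrite /lam crowD crowZ mulmxDl -scalemxAl !mxE.
have ljac p : jac Q p -> lam p = 0.
  move=> jp; rewrite /lam -crow_hcomp.
  have /(jac_span hQ (hcomp_homog _ _))/submxP[D ->] := jac_hcomp N hQ jp.
  by rewrite -mulmxA hgu mulmx0 mxE.
have lX mu : lam 'X_[mu] = cm Q mu / form_eval wd Q.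
  rewrite /lam /cm mxE mulr_suml; apply: eq_bigr => b _.
  rewrite (hu _ hdu) [crow _ _ _ _]mxE mulrA /form_coords mcoeffX; congr (_ * _ / _).
  by rewrite eq_sym.
have l0X mu : lam0 'X_[mu] = cm Q0 mu / form_eval wd Q0.
  have [_ hu0'] := hwd _ hQ0 wd0.
  have [dmu|dmu] := eqVneq (mdeg mu) N; last first.
    rewrite (gor_deg hl0 dmu) ?dhomogX //= /cm big1 ?mul0r // => b _.
    case: eqP => [e|]; last by rewrite mul0r.
    by case/eqP: dmu; rewrite -e mdeg_monomial.
  have [b0 eb0] := monomialP dmu.
  have := hu0' _ (dualmx_lamcol hQ0 hl0) b0; rewrite mxE eb0 => ->; congr (_ / _).
  rewrite /cm (bigD1 b0) //= eb0 eqxx mul1r big1 ?addr0 // => b bb0.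
  case: eqP => [e|]; last by rewrite mul0r.
  by case/eqP: bb0; apply: monomial_inj; rewrite e eb0.
exists lam; split=> //.
- by rewrite /lam hhu mxE eqxx.
- move=> k p kN hp; rewrite /lam -crow_hcomp (hcomp_ne _ hp) 1?eq_sym //.
  by rewrite crow0 mul0mx mxE.
- move=> p hp lp; apply/(jac_span hQ hp).
  have /submxP[D eD] : (crow N p <= dualmx Q)%MS by apply: submx_full.
  rewrite -[D]hsubmxK mul_row_col in eD.
  have : (crow N p *m u) 0 0 = 0 by [].
  rewrite eD mulmxDl -!mulmxA hgu hhu mulmx0 mulmx1 add0r => d0.
  have -> : rsubmx D = 0 by apply/matrixP => i j; rewrite !ord1 d0 mxE.
  rewrite mul0mx addr0.
  exact: submxMl.
- move=> k p kN hp; apply: (@jac_monomials N.+1 Q _ k p kN hp) => q hq.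
  apply/(jac_span hQ hq); apply: submx_full.
  rewrite /row_full eqn_leq rank_leq_col /=; apply: leq_trans (hwt _ hQ wtQ).
  suff /eqP -> : row_full (gradmx N.+1 Q0) by [].
  apply: row_full_forms => q' hq'; apply/(jac_span hQ0 hq').
  exact: (gor_top hl0 (ltnSn N)).
- move=> k p kN hp hj; apply/(jac_span hQ hp).
  have wk : form_eval (wA k) Q != 0 /\ form_eval (wB k) Q != 0.
    apply/andP; rewrite -negb_or -mulf_eq0; move: wABQ; rewrite prodf_seq_neq0.
    by move=> /allP/(_ (Ordinal kN) (mem_index_enum _)); rewrite /= mevalM.
  have [wAk wBk] := wk; set B := pairmx k (cm Q).
  have lamB : pairmx k (fun mu => lam 'X_[mu]) = (form_eval wd Q)^-1 *: B.
    by apply/matrixP => i j; rewrite !mxE lX mulrC.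
  have lamB0 : pairmx k (fun mu => lam0 'X_[mu]) = (form_eval wd Q0)^-1 *: pairmx k (cm Q0).
    by apply/matrixP => i j; rewrite !mxE l0X mulrC.
  have van q : q \is k.-homog -> jac Q q -> crow k q *m B = 0.
    move=> hq jq; have wdi : (form_eval wd Q)^-1 != 0 by rewrite invr_eq0.
    apply: (can_inj (scalerK wdi)); rewrite scaler0 scalemxAr -lamB.
    apply/rowP => b; rewrite (crow_pairmx lin hq) mxE; apply: ljac.
    by rewrite mulrC; apply: jacM.
  have subB : (gradmx k Q <= kermx B)%MS.
    apply/row_subP => a; apply/sub_kermxP; rewrite rowK -crow_hcomp van //.
      exact: hcomp_homog.
    by apply: (jac_hcomp _ hQ); apply: gen_jac.
  have pB : crow k p *m B = 0.
    have wdi : (form_eval wd Q)^-1 != 0 by rewrite invr_eq0.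
    apply: (can_inj (scalerK wdi)); rewrite scaler0 scalemxAr -lamB.
    apply/rowP => b; rewrite (crow_pairmx lin hp) mxE; apply: ljac.
    have db := mdeg_monomial b; set mu := bmnm _ in db *.
    have [i bi] : exists i, mu i != 0%N.
      apply/existsP; apply: contraT => /existsPn hz; move: db.
      suff -> : mu = 0%MM by rewrite mdeg0 => /eqP; rewrite eq_sym subn_eq0 leqNgt kN.
      by apply/mnmP => i; rewrite mnm0E; apply/eqP; have := hz i; rewrite negbK.
    have [b' eb] : exists b', mu = (U_(i) + b')%MM.
      exists (mu - U_(i))%MM; rewrite addmC submK //; apply/mnm_lepP => l; rewrite mnm1E.
      by case: eqP => // <-; rewrite lt0n.
    rewrite eb mpolyXD mulrA mulrC (mulrC p 'X_i); apply: jacM; exact: hj.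
  (* The ideal in degree [k] lies in the kernel of the pairing. At [Q0] the two ranks add up to at
     least the dimension, and neither is smaller at [Q]; hence ideal and kernel coincide. *)
  have rk : (\rank (kermx B) <= \rank (gradmx k Q))%N.
    rewrite mxrank_ker leq_subLR addnC.
    apply: leq_trans (pairmx_rank hQ0 hl0 (ltnW kN)) _.
    rewrite lamB0 mxrank_scale_nz ?invr_eq0 // leq_add //.
      by case: (hwA k) => _; apply.
    by case: (hwB k) => _; apply.
  have := mxrank_leqif_sup subB; rewrite /leqif eqn_leq rk andbT mxrankS // => -[_ /esym].
  by apply: submx_trans; apply/sub_kermxP.
Qed.
End AssociatedForm.

(** ** Fibres of the associated form map *)

Section LogDerivative.
Variable C : numClosedFieldType.

(** If 0 were a zero of [w] of multiplicity [k + 1], then [w^]() *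
    v[would vanish there to order exactly]k[, and]w * v^[()] to higher order. *)
Lemma wronskian_eq0 (w v : {poly C}) : v.[0] != 0 -> w.[0] = 0 ->
  w^`() * v = w * v^`() -> w = 0.
Proof.
move=> v0 w0 e; apply/eqP; apply: contraT => wn0.
have [k [w1]] := multiplicity_XsubC w 0; rewrite wn0 /= => r1 ew.
rewrite subr0 in ew; case: k => [|k] in ew *.
  by move: r1; rewrite /root; move: w0; rewrite ew expr0 mulr1 => ->; rewrite eqxx.
have X0 : 'X^k != 0 :> {poly C} by rewrite expf_neq0 // polyX_eq0.
have : 'X^k * (w1^`() * 'X * v + (w1 * v) *+ k.+1 - w1 * 'X * v^`()) = 0.
  have -> : 'X^k * (w1^`() * 'X * v + (w1 * v) *+ k.+1 - w1 * 'X * v^`()) =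
      w^`() * v - w * v^`().
    rewrite ew derivM derivXn [k.+1.-1]/= exprS -(mulr_natr (w1 * v)) -(mulr_natr 'X^k).
    move: w1^`() v^`() {e ew r1 v0 w0 wn0 X0 w} => a b.
    move: ('X : {poly C}) => x; move: (x ^+ k) (k.+1%:R : {poly C}) => A c; ring.
  by rewrite e subrr.
move=> /eqP; rewrite mulf_eq0 (negbTE X0) /= => /eqP /(congr1 (horner^~ 0)).
rewrite !(hornerD, hornerN, hornerMn, hornerM, hornerX, horner0) !(mulr0, mul0r) add0r subr0.
rewrite -mulr_natr => /eqP.
by rewrite !mulf_eq0 pnatr_eq0 (negbTE v0) !orbF; move: r1; rewrite /root => /negbTE ->.
Qed.

Lemma wronskian_proportional (u v : {poly C}) : v.[0] != 0 ->
  u^`() * v = u * v^`() -> u = (u.[0] / v.[0]) *: v.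
Proof.
move=> v0 e; apply/eqP; rewrite -subr_eq0; apply/eqP.
apply: (wronskian_eq0 v0); first by rewrite !hornerE divfK // subrr.
by rewrite derivB derivZ mulrBl e mulrBl -!scalerAl [v * _]mulrC.
Qed.

Lemma line_poly l (P : {mpoly C[l]}) (x y : 'I_l -> C) : exists u : {poly C}, forall t,
  u.[t] = P.@[fun i => x i + t * y i] /\
  u^`().[t] = \sum_i (P^`M(i)).@[fun i => x i + t * y i] * y i.
Proof.
elim/mpoly_ring_ind: P => [c|i|p q [kp hp] [kq hq]|p q [kp hp] [kq hq]].
- exists c%:P => t; rewrite hornerC mevalC derivC horner0 big1 // => i _.
  by rewrite mderivC meval0 mul0r.
- exists ((x i)%:P + (y i) *: 'X) => t; rewrite !hornerE mevalXU mulrC; split=> //.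
  rewrite derivD derivC derivZ derivX add0r hornerZ hornerC mulr1.
  rewrite (bigD1 i) //= big1 ?addr0 => [|j ji].
    rewrite mderivX mnm1E eqxx scale1r mevalX big1 ?mul1r // => j _.
    by rewrite mnmBE subnn expr0.
  by rewrite mderivX mnm1E eq_sym (negbTE ji) scale0r meval0 mul0r.
- exists (kp + kq) => t; have [hp1 hp2] := hp t; have [hq1 hq2] := hq t.
  rewrite hornerD derivD hornerD mevalD hp1 hq1 hp2 hq2; split=> //.
  by rewrite -big_split; apply: eq_bigr => i _ /=; rewrite mderivD mevalD mulrDl.
exists (kp * kq) => t; have [hp1 hp2] := hp t; have [hq1 hq2] := hq t.
rewrite hornerM derivM hornerD !hornerM mevalM hp1 hq1 hp2 hq2; split=> //.
rewrite mulr_suml mulr_sumr -big_split; apply: eq_bigr => i _ /=.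
by rewrite mderivM mevalD !mevalM; ring.
Qed.
End LogDerivative.

(** * Forms with proportional gradients and the pencil joining them *)

Section Pencil.
Variables (C : numClosedFieldType) (n m : nat).
Hypotheses (hn : (2 <= n)%N) (hm : (3 <= m)%N).
Local Notation N := (n * (m - 2))%N.
Local Notation dd := m.-1.
Local Notation fm := (form_dim n m).
Local Notation fN := (form_dim n N).
Implicit Types p q F Q : {mpoly C[n]}.

Definition grad_related Q Q' (B : 'M[C]_n) : Prop :=
  forall i, Q'^`M(i) = \sum_j B i j *: Q^`M(j).

Lemma hess_grad Q Q' B : grad_related Q Q' B -> hess Q' = \det B *: hess Q.
Proof.
move=> h; rewrite /hess; set H := (X in _ = _ *: \det X).
have -> : \matrix_(i, j) Q'^`M(i)^`M(j) = map_mx (@mpolyC n C) B *m H.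
  apply/matrixP => i j; rewrite !mxE h raddf_sum /=; apply: eq_bigr => k _.
  by rewrite !mxE mderivZ mul_mpolyC.
by rewrite det_mulmx det_map_mx mul_mpolyC.
Qed.

Lemma grad_related_jac Q Q' B : grad_related Q Q' B -> forall p, jac Q' p -> jac Q p.
Proof.
move=> h p [g ->]; apply: jac_sum => j _; apply: jacM; rewrite h.
by apply: jac_sum => i _; apply: jacZ; apply: jac_deriv.
Qed.

Lemma grad_related_inv Q Q' B : B \in unitmx -> grad_related Q Q' B ->
  grad_related Q' Q (invmx B).
Proof.
move=> uB h i; under eq_bigr do rewrite h scaler_sumr.
rewrite exchange_big /=.
transitivity (\sum_k (invmx B *m B) i k *: Q^`M(k)).
  rewrite mulVmx // (bigD1 i) //= mxE eqxx scale1r big1 ?addr0 // => k ki.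
  by rewrite mxE eq_sym (negbTE ki) scale0r.
apply: eq_bigr => k _; rewrite mxE scaler_suml; apply: eq_bigr => j _.
by rewrite scalerA.
Qed.

(** The gradients generate the same ideal and the Hessians differ by the factor [\det B], so
    rescaling the functional suffices. *)
Lemma grad_related_good Q Q' B : good m Q -> Q' \is m.-homog -> B \in unitmx ->
  grad_related Q Q' B -> good m Q'.
Proof.
move=> [hQ [lam hl]] hQ' uB h; split=> //.
have dB : \det B != 0 by rewrite -unitfE -unitmxE.
have h' := grad_related_inv uB h.
exists (fun p => (\det B)^-1 * lam p); split.
- by move=> c p q; rewrite (gor_lin hl); ring.
- by move=> p /(grad_related_jac h)/(gor_jac hl) ->; rewrite mulr0.
- by rewrite (hess_grad h) (lamZ hl) (gor_hess hl) mulr1 mulVf.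
- by move=> k p kN hp; rewrite (gor_deg hl kN hp) mulr0.
- move=> p hp /eqP; rewrite mulf_eq0 invr_eq0 (negbTE dB) /= => /eqP /(gor_ker hl hp).
  exact: grad_related_jac h' _.
- by move=> k p kN hp; apply: (grad_related_jac h'); apply: gor_top hl _ _ kN hp.
move=> k p kN hp hj; apply: (grad_related_jac h'); apply: (gor_soc hl kN hp) => j.
exact: (grad_related_jac h).
Qed.

Lemma grad_related_lie Q Q' B : Q \is m.-homog -> Q' \is m.-homog ->
  grad_related Q Q' B -> Q' = lie (m%:R^-1 *: B^T) Q.
Proof.
move=> hQ hQ' h; have m0 : m%:R != 0 :> C by rewrite pnatr_eq0; case: (m) hm.
apply: (can_inj (scalerK m0)); rewrite -(euler hQ') lieE.
under eq_bigr do rewrite h mulr_sumr.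
rewrite scaler_sumr exchange_big /=; apply: eq_bigr => i _; rewrite scaler_sumr.
by apply: eq_bigr => j _; rewrite !mxE scalerA mulrA mulfV // mul1r scalerAr.
Qed.

Section Invariant.
Variable f : {mpoly C[n]} -> C.
Hypothesis f_local : forall Q0, good m Q0 -> exists w p q : {mpoly C[fm]},
  form_eval w Q0 != 0 /\ forall Q, good m Q -> form_eval w Q != 0 ->
    form_eval q Q != 0 /\ f Q = form_eval p Q / form_eval q Q.
Hypothesis f_inv : forall Q g, good m Q -> g \in unitmx ->
  good m (lsub g Q) /\ f (lsub g Q) = f Q.

(* The direction [Q' - Q] is tangent at [Q + t (Q' - Q)] to the orbit of that form, so the
   derivative of [f] along the pencil vanishes. *)
Lemma pencil_constant Q Q' B : good m Q -> Q' \is m.-homog -> grad_related Q Q' B ->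
  exists2 z : {poly C}, z != 0 & forall t, z.[t] != 0 -> f (Q + t *: (Q' - Q)) = f Q.
Proof.
move=> gQ hQ' hB; have hQ : Q \is m.-homog by case: gQ.
have [w [p [q [w0 hw]]]] := f_local gQ; have [q0 fQ] := hw _ gQ w0.
pose D := Q' - Q; have hD : D \is m.-homog by apply: rpredB.
pose E := B - 1%:M; have [dE dE0 hdE] := det_line_neq0 E.
pose L t := Q + t *: D.
have hL t : L t \is m.-homog by apply: rpredD => //; apply: rpredZ.
have grL t : grad_related Q (L t) (1%:M + t *: E).
  move=> i; rewrite /L /D mderivD mderivZ mderivB (hB i).
  under [RHS]eq_bigr do rewrite !mxE scalerDl.
  rewrite big_split /=; congr (_ + _).
    rewrite (bigD1 i) //= eqxx scale1r big1 ?addr0 // => j ji.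
    by rewrite eq_sym (negbTE ji) scale0r.
  under [RHS]eq_bigr do rewrite -scalerA; rewrite -scaler_sumr; congr (_ *: _).
  under [RHS]eq_bigr do rewrite scalerBl.
  rewrite sumrB; congr (_ - _); rewrite (bigD1 i) //= eqxx scale1r big1 ?addr0 // => j ji.
  by rewrite eq_sym (negbTE ji) scale0r.
have grD : grad_related Q D E.
  move=> i; rewrite /D mderivB (hB i); under [RHS]eq_bigr do rewrite !mxE scalerBl.
  rewrite sumrB; congr (_ - _); rewrite (bigD1 i) //= eqxx scale1r big1 ?addr0 // => j ji.
  by rewrite eq_sym (negbTE ji) scale0r.
have gL t : dE.[t] != 0 -> good m (L t).
  rewrite hdE => dt; apply: (grad_related_good gQ (hL t) _ (grL t)).
  by rewrite unitmxE unitfE.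
pose x := form_coords m Q; pose y := form_coords m D.
have ev (P : {mpoly C[fm]}) t : form_eval P (L t) = P.@[fun i => x i + t * y i].
  by apply: meval_eq => k; rewrite /form_coords /L mcoeffD mcoeffZ.
have [u hu] := line_poly p x y; have [v hv] := line_poly q x y.
have [om hom] := line_poly w x y.
have L0 : L 0 = Q by rewrite /L scale0r addr0.
have v0 : v.[0] != 0 by rewrite (proj1 (hv 0)) -ev L0.
have u0 : u.[0] / v.[0] = f Q by rewrite (proj1 (hv 0)) (proj1 (hu 0)) -!ev L0.
have om0 : om != 0.
  by apply: contraNneq w0 => om0; rewrite -L0 ev -(proj1 (hom 0)) om0 horner0.
have fL t : dE.[t] != 0 -> om.[t] != 0 -> v.[t] != 0 /\ f (L t) = u.[t] / v.[t].
  move=> dt; rewrite (proj1 (hv t)) (proj1 (hom t)) (proj1 (hu t)) -!ev => wt.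
  exact: hw (gL _ dt) wt.
(* Here [u / v] is the restriction of [f] to the pencil. At a general [t], the direction [D] equals
   [lie G (L t)]; comparing the pencil with the group curve [1 + e G], along which [f] is constant,
   kills the Wronskian. *)
have wr : u^`() * v = u * v^`().
  apply/eqP; rewrite -subr_eq0; apply: contraT => ne.
  have /closed_nonrootP[t] := mulf_neq0 ne (mulf_neq0 dE0 om0).
  rewrite /root !hornerM !mulf_eq0 !negb_or => /and3P[nt dt omt]; case/negP: nt.
  rewrite hornerD hornerN !hornerM subr_eq0; apply/eqP.
  have [vt fLt] := fL t dt omt.
  have uM : 1%:M + t *: E \in unitmx by rewrite unitmxE unitfE -hdE.
  have grt : grad_related (L t) D (E *m invmx (1%:M + t *: E)).
    move=> i; rewrite grD.
    under eq_bigr do rewrite (grad_related_inv uM (grL t)) scaler_sumr.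
    rewrite exchange_big /=; apply: eq_bigr => k _; rewrite mxE scaler_suml.
    by apply: eq_bigr => j _; rewrite scalerA.
  have eD := grad_related_lie (hL t) hD grt; set G := _ *: _ in eD.
  have [h hh] := coords_lsub_taylor G (hL t).
  pose xt k := form_coords m (L t) k.
  have tay P := taylor P xt y h.
  have evG P e : form_eval P (lsub (1%:M + e *: G) (L t)) =
      P.@[fun i => xt i + e * y i + e ^+ 2 * (h i).[e]].
    by apply: meval_eq => k; rewrite hh -eD.
  have [kp hkp] := tay p; have [kq hkq] := tay q; have [kw hkw] := tay w.
  have xtE P : P.@[xt] = P.@[fun i => x i + t * y i] by rewrite -ev.
  have dxt P : \sum_i (P^`M(i)).@[xt] * y i =
      \sum_i (P^`M(i)).@[fun i => x i + t * y i] * y i.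
    by apply: eq_bigr => i _; rewrite xtE.
  have [dG dG0 hdG] := det_line_neq0 G.
  pose pw := (om.[t])%:P + om^`().[t] *: 'X + 'X^2 * kw.
  have pw0 : pw != 0.
    apply: contraNneq omt => pw0; have := congr1 (horner^~ 0) pw0.
    rewrite /pw !(hornerD, hornerXn, hornerM, hornerZ, hornerX, hornerC) expr0n.
    by rewrite !(mulr0, mul0r, addr0, horner0) => ->.
  have := @quadratic_unique C (u.[t] * v.[t]) (u^`().[t] * v.[t]) (u.[t] * v.[t])
     (u.[t] * v^`().[t]) (v.[t] *: kp) (u.[t] *: kq) _ (mulf_neq0 dG0 pw0).
  apply=> e; rewrite hornerM mulf_eq0 negb_or => /andP[de pe].
  have ge : 1%:M + e *: G \in unitmx by rewrite unitmxE unitfE -hdG.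
  have [gG fG] := f_inv (gL t dt) ge.
  have we : form_eval w (lsub (1%:M + e *: G) (L t)) != 0.
    rewrite evG hkw xtE dxt -(proj1 (hom t)) -(proj2 (hom t)).
    move: pe; rewrite /pw !(hornerD, hornerXn, hornerM, hornerZ, hornerX, hornerC).
    by rewrite [_ * e]mulrC.
  have [qe fe] := hw _ gG we.
  have : form_eval p (lsub (1%:M + e *: G) (L t)) * v.[t] =
         u.[t] * form_eval q (lsub (1%:M + e *: G) (L t)).
    apply: (mulIf (invr_neq0 qe)); rewrite mulrAC -fe fG fLt divfK //.
    by rewrite mulfK.
  rewrite !evG hkp hkq !xtE !dxt -(proj1 (hv t)) -(proj2 (hv t)).
  rewrite -(proj1 (hu t)) -(proj2 (hu t)) !hornerZ => e0.
  by apply: etrans (etrans _ e0) _; ring.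
exists (dE * om); first exact: mulf_neq0.
move=> t; rewrite hornerM mulf_eq0 negb_or => /andP[dt omt].
have [vt ->] := fL t dt omt.
by rewrite [u](wronskian_proportional v0 wr) hornerZ mulfK.
Qed.

Lemma homog0_const p : p \is 0.-homog -> p = p@_0%MM *: 1.
Proof.
move=> hp; apply/mpolyP => b; rewrite mcoeffZ mcoeff1.
have [->|b0] := eqVneq b 0%MM; first by rewrite mulr1.
by rewrite mulr0 (dhomog_nemf_coeff hp) //= mdeg_eq0.
Qed.

(** Multinomial coefficients are nonzero, so the functionals agree in degree [N]. Each partial
    derivative of [Q'] then pairs trivially for [Q], hence lies in its Jacobian ideal in the lowest
    degree [m - 1], with constant coefficients. Normalization on the Hessian of [Q'] excludes
    determinant 0. *)
Lemma Phi_grad_related Q Q' : good m Q -> good m Q' -> Phi m Q = Phi m Q' ->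
  exists2 B, B \in unitmx & grad_related Q Q' B.
Proof.
move=> [hQ [lam hl]] [hQ' [lam' hl']] e.
have lamE p : p \is N.-homog -> lam p = lam' p.
  move=> hp; rewrite (lam_form hl hp) (lam_form hl' hp); apply: eq_bigr => k _.
  congr (_ * _); have := congr1 (fun F => form_coords N F k) e.
  rewrite (PhiE hQ hl) (PhiE hQ' hl') /assoc_of !coords_form_of.
  by apply: mulfI; apply: multinomial_coef_neq0.
have ddN : (dd <= N)%N.
  apply: (@leq_trans (2 * (m - 2))); last by rewrite leq_mul2r hn orbT.
  by case: m hm => [|[|[|k]]] // _; rewrite subn2 /=; lia.
have /choice[B hB] : forall i, exists b : 'I_n -> C, Q'^`M(i) = \sum_j b j *: Q^`M(j).
  move=> i; have hi := deriv_homog i hQ'.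
  have ji : jac Q Q'^`M(i).
    apply: (gor_pairing hl ddN hi) => b db.
    have hb : Q'^`M(i) * 'X_[b] \is N.-homog.
      by rewrite -[X in X.-homog](subnKC ddN); apply: dhomogM => //; rewrite dhomogX /= db.
    rewrite lamE //; apply: (gor_jac hl'); rewrite mulrC; apply: jacM; exact: jac_deriv.
  have := jac_homog hQ hi ji; rewrite leqnn subnn => -[g [hg ->]].
  exists (fun j => (g j)@_0%MM); apply: eq_bigr => j _.
  by rewrite {1}(homog0_const (hg j)) -scalerAl mul1r.
have gr : grad_related Q Q' (\matrix_(i, j) B i j).
  by move=> i; rewrite hB; apply: eq_bigr => j _; rewrite mxE.
exists (\matrix_(i, j) B i j) => //; rewrite unitmxE unitfE.
apply/eqP => d0; have := gor_hess hl'; rewrite (hess_grad gr) d0 scale0r (lam0 hl').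
by move/eqP; rewrite eq_sym oner_eq0.
Qed.

Lemma f_fibre Q Q' : good m Q -> good m Q' -> Phi m Q = Phi m Q' -> f Q = f Q'.
Proof.
move=> gQ gQ' /(Phi_grad_related gQ gQ')[B uB hB].
have [hQ hQ'] : Q \is m.-homog /\ Q' \is m.-homog by case: gQ; case: gQ'.
have [z z0 hz] := pencil_constant gQ hQ' hB.
have [z' z'0 hz'] := pencil_constant gQ' hQ (grad_related_inv uB hB).
(* The exceptional polynomial [z] may vanish at [t = 1]. So the pencil is also run backwards from
   [Q'], with parameter [1 - t], and the two values of [f] are compared at a common point. *)
have zc : z' \Po (1 - 'X) != 0.
  apply: contraNneq z'0 => /(congr1 (fun p : {poly C} => p \Po (1 - 'X))).
  rewrite -comp_polyA comp_polyB comp_polyX comp_polyC comp_poly0 => <-.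
  by rewrite opprB addrC subrK comp_polyXr.
have /closed_nonrootP[t] := mulf_neq0 z0 zc.
rewrite /root hornerM mulf_eq0 negb_or horner_comp !hornerE => /andP[zt z't].
rewrite -(hz _ zt) -(hz' _ z't); congr (f _).
by rewrite scalerBl scale1r addrA [Q' + (Q - Q')]addrC subrK -scalerN opprB.
Qed.
End Invariant.
End Pencil.

(** ** Equivariance and genericity *)

Section Equivariance.
Variables (C : numClosedFieldType) (n m : nat).
Hypotheses (hn : (2 <= n)%N) (hm : (3 <= m)%N).
Local Notation N := (n * (m - 2))%N.
Implicit Types p q F Q : {mpoly C[n]}.

Lemma meval_scale d F c (y : 'I_n -> C) : F \is d.-homog ->
  F.@[fun i => c * y i] = c ^+ d * F.@[y].
Proof.
move=> hF; rewrite !mevalE mulr_sumr !big_seq; apply: eq_bigr => b bF.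
rewrite mulrCA; congr (_ * _); rewrite -(dhomog_mf hF bF) /= mdegE -prodrXr -big_split.
by apply: eq_bigr => i _; rewrite exprMn.
Qed.

Lemma lsub_scale d F c (g : 'M[C]_n) : F \is d.-homog ->
  lsub (c *: g) F = c ^+ d *: lsub g F.
Proof.
move=> hF; apply: mpoly_eval_inj => x; rewrite mevalZ !lsub_eval -(meval_scale _ _ hF).
apply: meval_eq => i; rewrite /mapply mulr_sumr; apply: eq_bigr => j _.
by rewrite mxE mulrA.
Qed.

Lemma jac_lsub k Q q : k \in unitmx -> jac Q q -> jac (lsub k Q) (lsub k q).
Proof.
move=> uk [g ->]; rewrite lsub_sum; apply: jac_sum => j _; rewrite lsubM; apply: jacM.
have -> : lsub k Q^`M(j) = \sum_i invmx k i j *: (lsub k Q)^`M(i).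
  rewrite -{1}(lsub_invKV Q uk) lsub_deriv lsub_sum; apply: eq_bigr => i _.
  by rewrite lsubZ lsub_invK.
by apply: jac_sum => i _; apply: jacZ; apply: jac_deriv.
Qed.

Lemma jac_lsubV k Q q : k \in unitmx -> jac (lsub k Q) q -> jac Q (lsub (invmx k) q).
Proof.
move=> uk jq; rewrite -(lsub_invKV Q uk); apply: jac_lsub => //.
by rewrite unitmx_inv.
Qed.

Lemma hess_lsub k Q : hess (lsub k Q) = \det k ^+ 2 *: lsub k (hess Q).
Proof.
rewrite /hess; set H := (X in _ = _ *: lsub k (\det X)).
have -> : \matrix_(i, j) (lsub k Q)^`M(i)^`M(j) =
    (map_mx (@mpolyC n C) k)^T *m map_mx (lsub k) H *m map_mx (@mpolyC n C) k.
  apply/matrixP => i j; rewrite !mxE lsub_deriv raddf_sum /=.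
  under eq_bigr do rewrite mderivZ lsub_deriv scaler_sumr.
  rewrite exchange_big /=; apply: eq_bigr => b _; rewrite !mxE mulr_suml.
  apply: eq_bigr => a _; rewrite !mxE -!mul_mpolyC -[RHS]mulrA.
  congr (_ * _); exact: mulrC.
rewrite !det_mulmx det_tr det_map_mx mulrAC -rmorphM /= mul_mpolyC -expr2; congr (_ *: _).
by rewrite lsubE -det_map_mx.
Qed.

Lemma gor_lsub k Q lam : k \in unitmx -> gor m Q lam ->
  gor m (lsub k Q) (fun p => (\det k ^+ 2)^-1 * lam (lsub (invmx k) p)).
Proof.
move=> uk hl; have dk : \det k ^+ 2 != 0 by rewrite expf_neq0 // -unitfE -unitmxE.
split.
- by move=> c p q; rewrite lsubD lsubZ (gor_lin hl); ring.
- by move=> p /(jac_lsubV uk)/(gor_jac hl) ->; rewrite mulr0.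
- by rewrite hess_lsub lsubZ lsub_invKV // (lamZ hl) (gor_hess hl) mulr1 mulVf.
- by move=> j p jN hp; rewrite (gor_deg hl jN (lsub_homog _ hp)) mulr0.
- move=> p hp /eqP; rewrite mulf_eq0 invr_eq0 (negbTE dk) /= => /eqP.
  by move=> /(gor_ker hl (lsub_homog _ hp))/(jac_lsub uk); rewrite lsub_invK.
- move=> j p jN hp; rewrite -(lsub_invK p uk); apply: (jac_lsub uk).
  exact: (gor_top hl jN (lsub_homog _ hp)).
move=> j p jN hp hj; rewrite -(lsub_invK p uk); apply: (jac_lsub uk).
apply: (gor_soc hl jN (lsub_homog _ hp)) => i.
have : jac (lsub k Q) (lsub k 'X_i * p).
  by rewrite lsubXU mulr_suml; apply: jac_sum => l _; rewrite -scalerAl; apply: jacZ.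
by move/(jac_lsubV uk); rewrite lsubM lsub_invKV.
Qed.

Lemma good_lsub k Q : k \in unitmx -> good m Q -> good m (lsub k Q).
Proof.
move=> uk [hQ [lam hl]]; split; first exact: lsub_homog.
by eexists; apply: gor_lsub uk hl.
Qed.

(** The functional is transported by [invmx k]. On the linear form with coefficients [z] this acts
    as the transpose on [z], and the Hessian contributes the square of the determinant. *)
Lemma Phi_lsub k Q : k \in unitmx -> good m Q ->
  Phi m (lsub k Q) = (\det k ^+ 2)^-1 *: lsub (invmx k)^T (Phi m Q).
Proof.
move=> uk [hQ [lam hl]]; apply: mpoly_eval_inj => z; rewrite mevalZ lsub_eval.
rewrite (Phi_eval z (lsub_homog _ hQ) (gor_lsub uk hl)) (Phi_eval _ hQ hl).
congr (_ * lam _); rewrite lsubXn lsub_sum; congr (_ ^+ _).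
under eq_bigr do rewrite lsubZ lsubXU scaler_sumr.
rewrite exchange_big /=; apply: eq_bigr => j _; rewrite /mapply scaler_suml.
by apply: eq_bigr => i _; rewrite mxE scalerA mulrC.
Qed.

Lemma Phi_equivariant Q g : good m Q -> g \in unitmx ->
  exists2 k, k \in unitmx & Phi m (lsub k Q) = lsub g (Phi m Q).
Proof.
(* For [k = t (g^-1)^T], the factor [(\det k)^-2] is [t^(-2n) (det g)^2], and homogeneity of [Phi]
   contributes [t^-N]; the exponent [2 n + N] makes the product 1. *)
move=> gQ ug; pose e := (2 * n + N)%N; pose t := e.-root (\det g ^+ 2).
have e0 : (0 < e)%N by rewrite /e addn_gt0 muln_gt0 /=; case: n hn.
have te : t ^+ e = \det g ^+ 2 by rewrite /t rootCK.
have dg : \det g != 0 by rewrite -unitfE -unitmxE.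
have t0 : t != 0 by rewrite /t rootC_eq0 // expf_neq0.
have uk : t *: (invmx g)^T \in unitmx.
  by rewrite unitmxZ ?unitfE // unitmx_tr unitmx_inv.
exists (t *: (invmx g)^T) => //; rewrite Phi_lsub //.
have -> : (invmx (t *: (invmx g)^T))^T = t^-1 *: g.
  by rewrite invmxZ // linearZ /= trmx_inv trmxK invmxK.
rewrite (lsub_scale _ _ (Phi_homog gQ)) scalerA -[RHS]scale1r; congr (_ *: _).
rewrite detZ det_tr det_inv exprMn -exprM [(n * 2)%N]mulnC !exprVn -invfM.
by rewrite mulrAC -exprD te mulfV ?invr1 // expf_neq0.
Qed.
End Equivariance.

(** * Positive codimension of the Jacobian ideal in degree [N], by specialization to the Fermat
    form *)

Section GenericRank.
Variables (C : numClosedFieldType) (n m : nat).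
Hypotheses (hn : (2 <= n)%N) (hm : (3 <= m)%N).
Local Notation N := (n * (m - 2))%N.
Local Notation dd := m.-1.
Local Notation e := (N - m.-1)%N.
Local Notation fm := (form_dim n m).
Implicit Types p q F Q : {mpoly C[n]}.

(** The monomial ['X_[b]] with every power ['X_i ^+ (m - 1)] replaced by a partial derivative. For
    the Fermat form this is a nonzero multiple of ['X_[b]], so for general [Q] these products form a
    basis in the given degree. *)
Definition xi Q (b : 'X_{1..n}) : {mpoly C[n]} :=
  \prod_i (Q^`M(i) ^+ (b i %/ dd) * 'X_i ^+ (b i %% dd)).

Lemma xi_homog Q k (b : 'X_{1..n}) : Q \is m.-homog -> mdeg b = k -> xi Q b \is k.-homog.
Proof.
move=> hQ <-; rewrite /xi mdegE; elim: (index_enum _) => [|i r IH].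
  by rewrite !big_nil dhomog1.
rewrite !big_cons; apply: dhomogM => //.
have : Q^`M(i) ^+ (b i %/ dd) * 'X_i ^+ (b i %% dd) \is (dd * (b i %/ dd) + 1 * (b i %% dd)).-homog.
  apply: dhomogM; apply: dhomogMn; first exact: deriv_homog.
  by rewrite dhomogX /= mdeg1.
by rewrite mul1n mulnC -divn_eq.
Qed.

Lemma xi_mul Q b j : xi Q b * Q^`M(j) = xi Q (b + U_(j) *+ dd)%MM.
Proof.
have d0 : (0 < dd)%N by case: m hm => [|[]].
rewrite /xi (bigD1 j) //= [RHS](bigD1 j) //= mulrC mulrA; congr (_ * _).
  rewrite mnmDE mulmnE mnm1E eqxx mul1n divnDr // divnn d0 modnDr addn1 exprS.
  exact: mulrA.
apply: eq_bigr => i ij; rewrite mnmDE mulmnE mnm1E eq_sym (negbTE ij) mul0n addn0 //.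
Qed.

Definition ximx k Q : 'M[C]_(form_dim n k) :=
  \matrix_a crow k (xi Q (bmnm (enum_val a))).

Definition fermat : {mpoly C[n]} := \sum_i 'X_i ^+ m.

Lemma fermat_homog : fermat \is m.-homog.
Proof.
apply: rpred_sum => i _.
have hX : ('X_i : {mpoly C[n]}) \is 1.-homog by rewrite dhomogX /= mdeg1.
by have := dhomogMn m hX; rewrite mul1n.
Qed.

Lemma fermat_deriv i : fermat^`M(i) = m%:R *: 'X_i ^+ dd.
Proof.
rewrite /fermat raddf_sum /= (bigD1 i) //= big1 ?addr0 => [|j ji].
  rewrite mpolyXn mderivX mulmnE mnm1E eqxx mul1n; congr (_ *: _).
  rewrite mpolyXn; congr 'X_[_]; apply/mnmP => j; rewrite mnmBE !mulmnE mnm1E.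
  by case: (i == j); rewrite ?mul1n ?subn1 ?mul0n.
rewrite mpolyXn mderivX mulmnE mnm1E (negbTE ji) mul0n scale0r //.
Qed.

Lemma ximx_fermat k : ximx k fermat \in unitmx.
Proof.
have m0 : m%:R != 0 :> C by rewrite pnatr_eq0; case: m hm.
have -> : ximx k fermat = diag_mx (\row_a \prod_i m%:R ^+ (bmnm (enum_val a) i %/ dd)).
  apply/row_matrixP => a; rewrite rowK; apply/rowP => b; rewrite !mxE.
  have -> : xi fermat (bmnm (enum_val a)) =
      \prod_i m%:R ^+ (bmnm (enum_val a) i %/ dd) *: 'X_[bmnm (enum_val a)].
    rewrite mpolyXE_id -scaler_prod; apply: eq_bigr => i _.
    by rewrite fermat_deriv exprZn -scalerAl -exprM -exprD mulnC -divn_eq.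
  rewrite /form_coords mcoeffZ mcoeffX mulr_natr; congr (_ *+ nat_of_bool _).
  by apply/eqP/eqP => [/monomial_inj|->].
rewrite unitmxE det_diag unitfE prodf_seq_neq0; apply/allP => a _ /=.
rewrite mxE prodf_seq_neq0; apply/allP => i _ /=.
by rewrite expf_neq0.
Qed.

Lemma dd_le_N : (dd <= N)%N.
Proof.
apply: (@leq_trans (2 * (m - 2))); last by rewrite leq_mul2r hn orbT.
by case: m hm => [|[|[|k]]] // _; rewrite subn2 /=; lia.
Qed.

(* The multiples [xi Q b] of the partial derivatives omit only the exponent
   [b = (m - 2, ..., m - 2)], so the Jacobian ideal has positive codimension in degree N. *)
Lemma gradmx_rank Q : Q \is m.-homog -> ximx e Q \in unitmx ->
  (\rank (gradmx m N Q) < form_dim n N)%N.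
Proof.
move=> hQ uX; pose top : 'X_{1..n} := [multinom (m - 2)%N | i < n].
have [b0 eb0] : exists b : 'I_(form_dim n N), bmnm (enum_val b) = top.
  apply: monomialP; rewrite mdegE; under eq_bigr do rewrite mnmE.
  by rewrite sum_nat_const card_ord.
pose S : 'M[C]_(form_dim n N) := \matrix_a
  (if a == b0 then 0 else crow N (xi Q (bmnm (enum_val a)))).
have sub : (gradmx m N Q <= S)%MS.
  apply/row_subP => a; rewrite rowK; case: (enum_val a) => b j; rewrite /gen /=.
  have hb : ('X_[bmnm (enum_val b)] : {mpoly C[n]}) \is e.-homog.
    by rewrite dhomogX /= mdeg_monomial.
  have /submxP[D eD] : (crow e 'X_[bmnm (enum_val b)] <= ximx e Q)%MS.
    by apply: submx_full; rewrite row_full_unit.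
  have -> : 'X_[bmnm (enum_val b)] = \sum_c D 0 c *: xi Q (bmnm (enum_val c)).
    apply: (crow_inj hb).
      apply: rpred_sum => c _; apply: rpredZ; apply: xi_homog => //.
      exact: mdeg_monomial.
    rewrite eD crow_sum mulmx_sum_row; apply: eq_bigr => c _.
    by rewrite rowK crowZ.
  rewrite mulr_suml crow_sum; apply: summx_sub => c _.
  rewrite -scalerAl crowZ xi_mul; apply: scalemx_sub.
  set mu := (_ + _)%MM; have dmu : mdeg mu = N.
    by rewrite mdegD mdeg_monomial mdegMn mdeg1 mul1n subnK // dd_le_N.
  have [k ek] := monomialP dmu.
  have kb : k != b0.
    apply/eqP => ekb; have := congr1 (fun mu : 'X_{1..n} => mu j) ek.
    rewrite ekb eb0 mnmE mnmDE mulmnE mnm1E eqxx mul1n => h.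
    by have : (m - 2 < dd)%N by [case: m hm => [|[|[|k']]] // _; rewrite subn2];
      rewrite h ltnNge leq_addl.
  by rewrite -ek; have := row_sub k S; rewrite rowK (negbTE kb).
apply: leq_ltn_trans (mxrankS sub) _; rewrite ltn_neqAle rank_leq_row andbT.
apply/negP => /row_freeP[U hU]; have := congr1 (fun A => row b0 A) hU.
rewrite row_mul rowK eqxx mul0mx => /rowP/(_ b0); rewrite !mxE eqxx => /eqP.
by rewrite eq_sym oner_eq0.
Qed.

Lemma gradmx_rank_generic : exists2 w : {mpoly C[fm]}, w != 0 &
  forall Q, Q \is m.-homog -> form_eval w Q != 0 ->
    (\rank (gradmx m N Q) < form_dim n N)%N.
Proof.
have h a b : polyfun (fun v : 'I_fm -> C => ximx e (form_of v) a b).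
  have h0 : coefpoly (fun v : 'I_fm -> C => xi (form_of v) (bmnm (enum_val a))).
    apply: coefpoly_prod => i; apply: coefpolyM; last exact: coefpoly_cst.
    apply: coefpolyX; exact: (coefpoly_deriv _ (@coefpoly_form_of C n m)).
  apply: polyfun_ext (h0 (bmnm (enum_val b))) => v.
  by rewrite !mxE.
have [w hw] := polyfun_det h.
have we Q : Q \is m.-homog -> form_eval w Q = \det (ximx e Q).
  by move=> hQ; rewrite /form_eval -hw form_of_coords.
exists w.
  have := ximx_fermat e; rewrite unitmxE unitfE -(we _ fermat_homog).
  by apply: contraNneq => ->; rewrite /form_eval meval0.
move=> Q hQ wQ; apply: gradmx_rank => //.
by rewrite unitmxE unitfE -we.
Qed.

Lemma good_generic Q0 : good m Q0 -> exists2 w : {mpoly C[fm]}, w != 0 &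
  forall Q, Q \is m.-homog -> form_eval w Q != 0 -> good m Q.
Proof. by move=> gQ0; apply: good_generic_of gQ0 gradmx_rank_generic. Qed.
End GenericRank.

(** ** Socles of Milnor algebras *)

Section Socle.
Variables (C : numClosedFieldType) (n m : nat).
Hypotheses (hn : (2 <= n)%N) (hm : (3 <= m)%N) (hC : uncountable C).
Local Notation N := (n * (m - 2))%N.
Local Notation dd := m.-1.
Implicit Types p q F Q : {mpoly C[n]}.

Definition nondegenerate Q : Prop := Q \is m.-homog /\
  forall z : 'I_n -> C, (forall j, Q^`M(j).@[z] = 0) -> forall j, z j = 0.

Definition socle Q p : Prop := p@_0%MM = 0 /\ forall j, jac Q ('X_j * p).

Lemma N_gt0 : (0 < N)%N.
Proof. by rewrite muln_gt0 subn_gt0; case: n hn => // n' _; case: m hm => [|[|[]]]. Qed.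

Lemma jac_mcoeff0 Q p : Q \is m.-homog -> jac Q p -> p@_0%MM = 0.
Proof.
move=> hQ jp; have := jac_hcomp 0 hQ jp => /(jac_homog hQ (hcomp_homog _ _)).
rewrite leqn0 (_ : (dd == 0)%N = false); last by case: m hm => [|[]].
move=> h0; have := congr1 (mcoeff 0%MM) h0; rewrite mcoeff0 => <-.
rewrite -form_of_coords_hcomp; have [k ek] := @monomialP n 0 0%MM mdeg0.
by rewrite -ek; symmetry; apply: (coords_form_of (form_coords 0 p) k).
Qed.

Lemma good_nondegenerate Q : good m Q -> nondegenerate Q.
Proof.
move=> [hQ [lam hl]]; split=> // z hz j.
have hX : ('X_j : {mpoly C[n]}) \is 1.-homog by rewrite dhomogX /= mdeg1.
have := dhomogMn N.+1 hX; rewrite mul1n => /(gor_top hl (ltnSn N))[g].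
move/(congr1 (meval z)); rewrite rmorphXn /= mevalXU raddf_sum big1 => [/eqP|i _ /=].
  by rewrite expf_eq0 /= => /eqP.
by rewrite mevalM hz mulr0.
Qed.

Lemma jac_ideal Q : is_ideal (jac Q).
Proof. by split; [apply: jac0|move=> p q; apply: jacD|move=> p q; apply: jacM]. Qed.

Lemma jac_mul_aug Q p q : (forall j, jac Q ('X_j * p)) -> q@_0%MM = 0 -> jac Q (p * q).
Proof.
move=> hp q0; rewrite [q]mpolyE big_seq mulr_sumr; apply: jac_sum => b bq.
have b0 : b != 0%MM by apply: contraTneq bq => ->; rewrite mcoeff_msupp q0 eqxx.
have [i bi] : exists i, b i != 0%N.
  apply/existsP; apply: contraNT b0 => /existsPn h0; apply/eqP/mnmP => i.
  by rewrite mnm0E; apply/eqP; have := h0 i; rewrite negbK.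
have -> : b = (U_(i) + (b - U_(i)))%MM.
  rewrite addmC submK //; apply/mnm_lepP => l; rewrite mnm1E.
  by case: eqP => // <-; rewrite lt0n.
rewrite mpolyXD -scalerAr; apply: jacZ; rewrite mulrA mulrC; apply: jacM.
by rewrite mulrC.
Qed.

(** The only zero of the Jacobian ideal is the origin, where [p] does not vanish. By the
    Nullstellensatz the ideal generated together with [p] contains 1. *)
Lemma unit_mod_jac Q p : nondegenerate Q -> p@_0%MM != 0 -> exists q, jac Q (q * p - 1).
Proof.
move=> [hQ hz] p0; pose a r := exists q, jac Q (r - q * p).
have ha : is_ideal a.
  split; first by exists 0; rewrite mul0r subr0; apply: jac0.
    move=> r r' [q jq] [q' jq']; exists (q + q').
    by rewrite mulrDl opprD addrACA; apply: jacD.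
  by move=> r s [q jq]; exists (s * q); rewrite -mulrA -mulrBr; apply: jacM.
have [x hx|k [q jq]] := nullstellensatz (I := 1) hC ha; last first.
  by exists q; rewrite -[_ - 1]opprB; apply: jacN; rewrite expr1n in jq.
have x0 j : x j = 0.
  apply: hz => i; apply: hx; exists 0; rewrite mul0r subr0; exact: jac_deriv.
have : p.@[x] = 0 by apply: hx; exists 1; rewrite mul1r subrr; apply: jac0.
rewrite (meval_eq _ x0) -mcoeff0_eval => /eqP; rewrite (negbTE p0) //.
Qed.

(** The Nullstellensatz puts a power of each variable into the ideal, and a monomial of large degree
    is divisible by one of these powers. *)
Lemma nondegenerate_nilpotent Q : nondegenerate Q -> exists K, forall k p, (K <= k)%N ->
  p \is k.-homog -> jac Q p.
Proof.
move=> [hQ hz].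
have /choice[e he] : forall j, exists k, jac Q ('X_j ^+ k).
  move=> j; apply: (nullstellensatz hC (jac_ideal Q)) => x hx.
  by rewrite mevalXU; apply: hz => i; apply: hx; apply: jac_deriv.
exists (\sum_j e j).+1 => k p kK hp; rewrite [p]mpolyE big_seq.
apply: jac_sum => b bp; apply: jacZ; have db : mdeg b = k := dhomog_mf hp bp.
have [j bj] : exists j, (e j <= b j)%N.
  apply/existsP; apply: contraT => /existsPn h; have : (mdeg b <= \sum_j e j)%N.
    by rewrite mdegE; apply: leq_sum => j _; apply: ltnW; rewrite ltnNge.
  by rewrite db leqNgt kK.
rewrite mpolyXE_id (bigD1 j) //= mulrC -(subnK bj) exprD mulrA; apply: jacM.
exact: he.
Qed.

Lemma hess_in_socle Q : Q \is m.-homog -> socle Q (hess Q).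
Proof.
move=> hQ; split=> [|j]; last exact: (hess_socle j hQ).
by apply: (dhomog_nemf_coeff (hess_homog hQ)); rewrite /= mdeg0 eq_sym -lt0n N_gt0.
Qed.

Lemma socle_lin Q c p q : socle Q p -> socle Q q -> socle Q (c *: p + q).
Proof.
move=> [p0 hp] [q0 hq]; split=> [|j]; first by rewrite mcoeffD mcoeffZ p0 q0 mulr0 addr0.
by rewrite mulrDr -scalerAr; apply: jacD => //; apply: jacZ.
Qed.

Lemma socle_jac Q p : Q \is m.-homog -> jac Q p -> socle Q p.
Proof. by move=> hQ jp; split=> [|j]; [apply: jac_mcoeff0 jp|apply: jacM]. Qed.

Lemma socle_ker Q lam p : Q \is m.-homog -> gor m Q lam -> (forall j, jac Q ('X_j * p)) ->
  lam p = 0 -> jac Q p.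
Proof.
move=> hQ hl hp lp; rewrite [p]mpoly_hcomp; apply: jac_sum => k _.
have hX (j : 'I_n) : ('X_j : {mpoly C[n]}) \is 1.-homog by rewrite dhomogX /= mdeg1.
have soc (i : nat) j : jac Q ('X_j * hcomp i p).
  have := jac_hcomp i.+1 hQ (hp j); rewrite mulrC (hcompM _ _ (hX j)) /= subn1 /=.
  by rewrite mulrC.
have [kN|Nk|kN] := ltngtP k N.
- exact: (gor_soc hl kN (hcomp_homog _ _)).
- exact: (gor_top hl Nk (hcomp_homog _ _)).
apply: (gor_ker hl); first by rewrite -kN; apply: hcomp_homog.
move: lp; rewrite {1}[p]mpoly_hcomp (lam_sum hl) (bigD1 k) //= big1 ?addr0 // => i ik.
apply: (gor_deg hl _ (hcomp_homog _ _)); apply: contra_neq ik => iN.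
by apply: val_inj; rewrite /= iN kN.
Qed.

(** An injective functional makes the socle a line spanned by the Hessian. As the Hessian is
    homogeneous of degree [N], the graded components of the socle in other degrees vanish, which
    yields all clauses of [gor]. *)
Lemma gor_of_socle Q (w : {mpoly C[n]} -> C) : nondegenerate Q ->
  (forall c p q, socle Q p -> socle Q q -> w (c *: p + q) = c * w p + w q) ->
  (forall p, jac Q p -> w p = 0) ->
  (forall p, socle Q p -> w p = 0 -> jac Q p) ->
  w (hess Q) = 1 -> gor m Q (fun p => w (hcomp N p)).
Proof.
move=> nQ wlin wjac wker whess; have [hQ _] := nQ.
have hnj : ~ jac Q (hess Q) by move=> /wjac/eqP; rewrite whess oner_eq0.
have rep p : socle Q p -> jac Q (p - w p *: hess Q).
  move=> sp; have sh := hess_in_socle hQ; rewrite addrC -scaleNr.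
  apply: wker; first exact: (socle_lin _ sh sp).
  by rewrite (wlin _ _ _ sh sp) whess mulr1 addrC subrr.
have hX (j : 'I_n) : ('X_j : {mpoly C[n]}) \is 1.-homog by rewrite dhomogX /= mdeg1.
have off k p : (0 < k)%N -> k != N -> p \is k.-homog -> (forall j, jac Q ('X_j * p)) ->
    jac Q p.
  move=> k0 kN hp hj; have sp : socle Q p.
    split=> //; apply: (dhomog_nemf_coeff hp); by rewrite /= mdeg0 eq_sym -lt0n.
  have := jac_hcomp k hQ (rep p sp).
  rewrite hcompD -scaleNr hcompZ (hcomp_id hp) (hcomp_ne _ (hess_homog hQ)) //.
  by rewrite scaler0 addr0.
(* Descending induction from the degree [K] of nilpotency: in a degree above [N] every form is
   annihilated by the variables, hence lies in the ideal by [off]. *)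
have top k p : (N < k)%N -> p \is k.-homog -> jac Q p.
  have [K hK] := nondegenerate_nilpotent nQ.
  have [e] := ubnP (K - k); elim: e k p => // e IH k p; rewrite ltnS => he Nk hp.
  have [Kk|kK] := leqP K k; first exact: (hK _ _ Kk hp).
  apply: (off k p (leq_trans N_gt0 (ltnW Nk)) (negbT (gtn_eqF Nk)) hp) => j.
  apply: (IH k.+1); last by rewrite -add1n; apply: dhomogM.
    by rewrite subnS prednK ?subn_gt0.
  exact: ltnW.
have socN p : p \is N.-homog -> socle Q p.
  move=> hp; split=> [|j].
    by apply: (dhomog_nemf_coeff hp); rewrite /= mdeg0 eq_sym -lt0n N_gt0.
  by apply: (top N.+1 _ (ltnSn N)); rewrite -add1n; apply: dhomogM.
split=> //.
- by move=> c p q; rewrite hcompD hcompZ wlin //; apply: socN; apply: hcomp_homog.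
- by move=> p jp; apply: wjac; apply: (jac_hcomp _ hQ).
- by rewrite (hcomp_id (hess_homog hQ)).
- by move=> k p kN hp; rewrite (hcomp_ne _ hp) 1?eq_sym // (wjac _ (jac0 _)).
- by move=> p hp; rewrite (hcomp_id hp); apply: (wker _ (socN _ hp)).
(* In degree 0, a nonzero constant in the socle would put every variable, and hence the Hessian,
   into the ideal. *)
move=> [|k] p kN hp hj; last by apply: off hp hj => //; rewrite ltn_eqF.
have [p0|p0] := eqVneq p@_0%MM 0.
  by rewrite (homog0_const hp) p0 scale0r; apply: jac0.
case: hnj; apply: (wker _ (hess_in_socle hQ)); apply: wjac.
rewrite -[hess Q]mul1r; apply: jac_mul_aug => [j|]; last by case: (hess_in_socle hQ).
have := hj j; have := homog0_const hp; move: p@_0%MM p0 => c c0 ->.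
by move/(jacZ c^-1); rewrite -scalerAr scalerA mulVf // scale1r.
Qed.
End Socle.

(** * Descent for nondegenerate forms, including the zeros of [Phi] *)

Section InvariantDescent.
Variables (C : numClosedFieldType) (n m : nat).
Hypotheses (hn : (2 <= n)%N) (hm : (3 <= m)%N) (hC : uncountable C).
Local Notation N := (n * (m - 2))%N.
Local Notation fm := (form_dim n m).
Local Notation fN := (form_dim n N).
Implicit Types p q F Q : {mpoly C[n]}.

Variable f : {mpoly C[n]} -> C.
Hypothesis f_local : forall Q0, nondegenerate m Q0 -> exists w p q : {mpoly C[fm]},
  form_eval w Q0 != 0 /\ forall Q, nondegenerate m Q -> form_eval w Q != 0 ->
    form_eval q Q != 0 /\ f Q = form_eval p Q / form_eval q Q.
Hypothesis f_inv : forall Q g, good m Q -> g \in unitmx -> f (lsub g Q) = f Q.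

Variables (l : nat) (I : {mpoly C[fN]}) (Q0 : {mpoly C[n]}).
Hypothesis gQ0 : good m Q0.
Hypothesis Q0_stabilizer : finite_stabilizer (Phi m Q0).
Hypothesis I_inv : semi_invariant l I.
Hypothesis I_Q0 : form_eval I (Phi m Q0) != 0.
Hypothesis Q0_closed : closed_orbit_in I (Phi m Q0).

Lemma generically_constant c : (exists2 w : {mpoly C[fm]}, w != 0 &
    forall Q, good m Q -> form_eval w Q != 0 -> f Q = c) ->
  forall Q, nondegenerate m Q -> f Q = c.
Proof.
move=> [w1 w10 hw1] Q nQ; have [w [p [q [w0 hw]]]] := f_local nQ.
have [q0 ->] := hw _ nQ w0; have [wg wg0 hg] := good_generic hn hm gQ0.
have e : p - c *: q = 0.
  have wn : w * (wg * w1) != 0.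
    rewrite !mulf_neq0 //; apply: contraNneq w0 => ->; by rewrite /form_eval meval0.
  apply: (mpoly_ext0 wn) => v.
  rewrite !mevalM !mulf_eq0 !negb_or => /and3P[wv gv w1v].
  have gF : good m (form_of v).
    by apply: hg; [apply: form_of_homog|rewrite form_eval_form_of].
  have [|qv fv] := hw _ (good_nondegenerate gF); first by rewrite form_eval_form_of.
  have := hw1 _ gF; rewrite form_eval_form_of fv => /(_ w1v) <-.
  rewrite !form_eval_form_of in qv *.
  by rewrite mevalB mevalZ divfK // subrr.
move/eqP: e; rewrite subr_eq0 => /eqP ->.
by rewrite /form_eval mevalZ mulfK.
Qed.

Theorem invariant_descent : exists s (I1 J1 : {mpoly C[fN]}), [/\ semi_invariant s I1,
  semi_invariant s J1, exists Q, good m Q /\ form_eval J1 (Phi m Q) != 0 &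
  forall p q : {mpoly C[fN]}, I1 * q = J1 * p -> forall Q, nondegenerate m Q ->
    form_eval q (Phi m Q) != 0 -> form_eval p (Phi m Q) / form_eval q (Phi m Q) = f Q].
Proof.
have gn Q := @good_nondegenerate C n m Q.
have f_local' P : good m P -> exists w p q : {mpoly C[fm]},
    form_eval w P != 0 /\ forall Q, good m Q -> form_eval w Q != 0 ->
      form_eval q Q != 0 /\ f Q = form_eval p Q / form_eval q Q.
  move=> /gn/f_local[w [p [q [w0 hw]]]]; exists w, p, q; split=> // Q /gn; exact: hw.
have f_inv' Q g : good m Q -> g \in unitmx -> good m (lsub g Q) /\ f (lsub g Q) = f Q.
  by move=> gQ ug; split; [apply: good_lsub|apply: f_inv].
have gH Q : good m Q -> Q \is m.-homog by case.
have Phi_eq Q g : good m Q -> g \in unitmx ->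
    exists Q', [/\ good m Q', Phi m Q' = lsub g (Phi m Q) & f Q' = f Q].
  move=> gQ ug; have [k uk ek] := Phi_equivariant hn gQ ug.
  by exists (lsub k Q); split; [apply: good_lsub|exact: ek|apply: f_inv].
have gg := good_generic hn hm gQ0.
have [s [I1 [J1 [hI hJ hex hprop]]]] := descent gH (@Phi_homog C n m) (@Phi_local C n m) gg
  Phi_eq f_local' (f_fibre hn hm f_local' f_inv') hC gQ0 Q0_stabilizer I_inv I_Q0 Q0_closed.
exists s, I1, J1; split=> // p q epq.
have [Q1 [gQ1 JQ1]] := hex.
have [wJ wJ0 hwJ] := Phi_open (@Phi_local C n m) gQ1 JQ1.
have goodP Q : good m Q -> form_eval J1 (Phi m Q) != 0 ->
    form_eval p (Phi m Q) = f Q * form_eval q (Phi m Q).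
  move=> gQ JQ; have := congr1 (meval (form_coords N (Phi m Q))) epq.
  rewrite !mevalM -!/(form_eval _ (Phi m Q)) (hprop _ gQ) mulrAC mulrC => e.
  by apply: (mulfI JQ).
have prop Q : good m Q -> form_eval p (Phi m Q) = f Q * form_eval q (Phi m Q).
  move=> gQ; apply: (proportional_closed (f := f) (@Phi_local C n m) gg f_local' _ gQ).
  by exists wJ => // Q' gQ' wQ'; apply: goodP => //; apply: hwJ.
(* If [Q] is not good, the fraction is evaluated at 0. For a general good [Q'], the identity on the
   orbit of [Phi Q'] extends to the matrix 0, which sends [Phi Q'] to 0; so [f Q'] equals [p / q] at
   0, and [f] is constant. *)
move=> Q nQ qQ; have [gQ|ngQ] := pselect (good m Q); first by rewrite prop // mulfK.
have P0 : Phi m Q = 0.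
  by rewrite /Phi; case: pselect => // h; case: ngQ; split=> //; case: nQ.
rewrite P0 in qQ *; symmetry; apply: generically_constant nQ.
exists wJ => // Q' gQ' wQ'; apply: (mulIf qQ); rewrite divfK //.
have hP := Phi_homog gQ'.
have e : orbit_poly p (Phi m Q') = f Q' *: orbit_poly q (Phi m Q').
  apply/eqP; rewrite -subr_eq0; apply/eqP; apply: (mpoly_ext0 (det_poly_neq0 C n)) => x dx.
  have ux : pmat x \in unitmx by rewrite unit_pmat.
  have [Q2 [gQ2 eQ2 fQ2]] := Phi_eq _ _ gQ' ux.
  by rewrite mevalB mevalZ !orbit_polyE // -eQ2 prop // fQ2 subrr.
have := congr1 (meval (pvec 0)) e; rewrite mevalZ !orbit_polyE // pmatK.
suff -> : lsub 0 (Phi m Q') = 0 by [].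
rewrite -(scale0r (0 : 'M[C]_n)) (lsub_scale _ _ hP) expr0n gtn_eqF ?scale0r //.
exact: N_gt0.
Qed.
End InvariantDescent.

(** ** Complex forms *)

Section UncountableReals.
Variable R : realType.
Local Open Scope classical_set_scope.

(** Passes to the outer third of the interval in the half away from [u k]. *)
Definition avoid_step (u : nat -> R) k (I : R * R) : R * R :=
  if u k <= (I.1 + I.2) / 2 then ((I.1 + 2 * I.2) / 3, I.2) else (I.1, (2 * I.1 + I.2) / 3).

Fixpoint avoid_seq (u : nat -> R) k : R * R :=
  if k is k'.+1 then avoid_step u k' (avoid_seq u k') else (0, 1).

Lemma avoid_lt u k : (avoid_seq u k).1 < (avoid_seq u k).2.
Proof.
elim: k => [|k] /=; first exact: ltr01.
rewrite /avoid_step; move: (avoid_seq u k) => [a b] /= ab; case: ifP => _ /=; lra.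
Qed.

Lemma avoid_mono u k j : (avoid_seq u k).1 <= (avoid_seq u (j + k)).1 /\
  (avoid_seq u (j + k)).2 <= (avoid_seq u k).2.
Proof.
elim: j => [|j [ha hb]]; first by rewrite add0n.
rewrite addSn /= /avoid_step; have := avoid_lt u (j + k).
move: (avoid_seq u (j + k)) ha hb => [a b] /=.
move: (avoid_seq u k) => [a' b'] /= *; case: ifP => _ /=; split; lra.
Qed.

Lemma real_uncountable (u : nat -> R) : exists x, forall k, u k <> x.
Proof.
pose A := [set (avoid_seq u k).1 | k in [set: nat]].
have ubA k : ubound A (avoid_seq u k).2.
  move=> _ [j _ <-].
  have [h1 _] := avoid_mono u j k; have [_ h2] := avoid_mono u k j.
  have h3 := avoid_lt u (j + k); rewrite addnC in h1.
  by apply: le_trans h1 (le_trans (ltW h3) h2).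
have hs : has_sup A by split; [exists 0, 0%N|exists 1; apply: (ubA 0%N)].
have lo k : (avoid_seq u k).1 <= sup A.
  by apply: (sup_upper_bound hs); exists k.
have hi k : sup A <= (avoid_seq u k).2.
  by apply: ge_sup => //; exists 0, 0%N.
exists (sup A) => k e; have := lo k.+1; have := hi k.+1; have := avoid_lt u k.
rewrite -e /= /avoid_step; move: (avoid_seq u k) => [a b] /=; move: (u k) => x.
by case: ifP => /= [h|/negbT]; rewrite -?ltNge => *; lra.
Qed.
End UncountableReals.

Lemma complex_uncountable (R : realType) : uncountable (R[i] : numClosedFieldType).
Proof.
move=> u; have [x hx] := real_uncountable (fun k => complex.Re (u k)).
by exists (x%:C)%C => k e; apply: (hx k); rewrite e.
Qed.

(** * The Milnor algebra as an abstract quotient, and its normalized socle functionals *)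

Section MilnorQuotient.
Variables (C : numClosedFieldType) (n m : nat).
Hypotheses (hn : (2 <= n)%N) (hm : (3 <= m)%N) (hC : uncountable C).
Local Notation N := (n * (m - 2))%N.
Implicit Types p q F : {mpoly C[n]}.
Variables (Q : {mpoly C[n]}) (A : comNzRingType) (pi : {mpoly C[n]} -> A).
Hypotheses (nQ : nondegenerate m Q) (piD : forall p q, pi (p + q) = pi p + pi q)
  (piM : forall p q, pi (p * q) = pi p * pi q) (pi1 : pi 1 = 1)
  (pi_surj : forall x, exists p, pi p = x) (pi_ker : forall p, pi p = 0 <-> jac Q p).
Local Open Scope classical_set_scope.

Definition nonunits : set A := [set x | ~ exists y, y * x = 1].
Definition annihilated : set A :=
  [set x | nonunits x /\ forall y, nonunits y -> x * y = 0].
Definition normalized (w : A -> C) : Prop :=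
  [/\ forall c x y, annihilated x -> annihilated y -> w (pi c%:MP * x + y) = c * w x + w y,
      set_bij annihilated setT w & w (pi (hess Q)) = 1].

Lemma pi0 : pi 0 = 0.
Proof. by apply/pi_ker/jac0. Qed.

Lemma piB p q : pi (p - q) = pi p - pi q.
Proof. by apply: (addIr (pi q)); rewrite -piD !subrK. Qed.

Lemma pi_eq p q : pi p = pi q <-> jac Q (p - q).
Proof.
rewrite -pi_ker piB; split=> [->|/eqP]; first by rewrite subrr.
by rewrite subr_eq0 => /eqP.
Qed.

Lemma nonunitsE p : nonunits (pi p) <-> p@_0%MM = 0.
Proof.
have hQ : Q \is m.-homog by case: nQ.
split=> [h|p0 [y]].
  apply/eqP; apply: contrapT => /negP p0; apply: h.
  have [q jq] := unit_mod_jac hC nQ p0; exists (pi q).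
  by rewrite -piM -pi1; apply/pi_eq.
have [q <-] := pi_surj y; rewrite -piM -pi1 => /pi_eq/(jac_mcoeff0 hm hQ)/eqP.
by rewrite mcoeffB rmorphM /= p0 mulr0 sub0r mcoeff1 eqxx oppr_eq0 oner_eq0.
Qed.

Lemma annihilatedE p : annihilated (pi p) <-> socle Q p.
Proof.
split=> [[/nonunitsE p0 hp]|[p0 hp]]; split=> //; first move=> j.
- apply/pi_ker; rewrite mulrC piM; apply: hp; apply/nonunitsE.
  by rewrite mcoeffX -mdeg_eq0 mdeg1.
- exact/nonunitsE.
move=> y; have [q <-] := pi_surj y => /nonunitsE q0.
by rewrite -piM; apply/pi_ker/jac_mul_aug.
Qed.

Lemma pi_linear z : \sum_j pi (z j)%:MP * pi 'X_j = pi (\sum_j z j *: 'X_j).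
Proof.
rewrite (big_morph pi piD pi0); apply: eq_bigr => j _.
by rewrite -piM mul_mpolyC.
Qed.

Lemma piXn p k : pi p ^+ k = pi (p ^+ k).
Proof. by elim: k => [|k IH]; rewrite ?expr0 ?pi1 // !exprS piM IH. Qed.

(** Precomposed with the projection to degree [N], a normalized functional satisfies [gor];
    uniqueness of the latter identifies the form with [Phi m Q]. *)
Lemma normalized_good (w : A -> C) F : normalized w -> F \is N.-homog ->
  (forall z : 'I_n -> C, F.@[z] = w ((\sum_j pi (z j)%:MP * pi 'X_j) ^+ N)) ->
  good m Q /\ F = Phi m Q.
Proof.
move=> [wl [_ wi _] wh] hF hw; have hQ : Q \is m.-homog by case: nQ.
have lin c p q : socle Q p -> socle Q q -> w (pi (c *: p + q)) = c * w (pi p) + w (pi q).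
  by move=> /annihilatedE sp /annihilatedE sq; rewrite -wl // -mul_mpolyC piD piM.
have s0 : socle Q 0 by apply: (socle_jac hm hQ); apply: jac0.
have w0 : w (pi 0) = 0.
  have := lin 1 _ _ s0 s0; rewrite scale1r addr0 mul1r => /eqP.
  by rewrite -subr_eq0 opprD addrA subrr sub0r oppr_eq0 => /eqP.
have hl := @gor_of_socle C n m hn hm hC Q (fun p => w (pi p)) nQ lin.
have {}hl : gor m Q (fun p => w (pi (hcomp N p))).
  apply: hl => // [p /pi_ker ->|p sp wp]; first by rewrite -pi0.
  apply/pi_ker; rewrite -pi0; apply: wi; rewrite ?inE ?wp ?w0 //; exact/annihilatedE.
split; first by split=> //; eexists; apply: hl.
apply: mpoly_eval_inj => z; rewrite hw (Phi_eval z hQ hl) pi_linear piXn hcomp_id //.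
have hX : \sum_j z j *: 'X_j \is 1.-homog.
  by apply: rpred_sum => j _; apply: rpredZ; rewrite dhomogX /= mdeg1.
by have := dhomogMn N hX; rewrite mul1n.
Qed.

Lemma good_normalized : good m Q -> exists2 w : A -> C, normalized w &
  forall z : 'I_n -> C, (Phi m Q).@[z] = w ((\sum_j pi (z j)%:MP * pi 'X_j) ^+ N).
Proof.
move=> [hQ [lam hl]]; have /choice[s hs] := pi_surj.
have wE p : lam (s (pi p)) = lam p.
  have /pi_eq/(gor_jac hl) := hs (pi p).
  by rewrite -scaleN1r (lamD hl) (lamZ hl) mulN1r => /eqP; rewrite subr_eq0 => /eqP.
exists (fun x => lam (s x)); last first.
  by move=> z; rewrite pi_linear piXn wE (Phi_eval z hQ hl).
split; last by rewrite wE (gor_hess hl).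
  move=> c x y _ _; have [p <-] := pi_surj x; have [q <-] := pi_surj y.
  by rewrite -piM -piD !wE mul_mpolyC (gor_lin hl).
split=> // [x y|c _].
  have [p <-] := pi_surj x; have [q <-] := pi_surj y.
  rewrite !inE => /annihilatedE sp /annihilatedE sq; rewrite !wE => e.
  apply/pi_eq; apply: (socle_ker hQ hl).
    by move=> j; have [_ h] := socle_lin (-1) sq sp; have := h j; rewrite scaleN1r addrC.
  by rewrite -scaleN1r (lamD hl) (lamZ hl) e mulN1r subrr.
exists (pi (c *: hess Q)); last by rewrite wE (lamZ hl) (gor_hess hl) mulr1.
apply/annihilatedE; rewrite -[_ *: _]addr0; apply: socle_lin.
  exact: (hess_in_socle hn hm hQ).
by apply: (socle_jac hm hQ); apply: jac0.
Qed.
End MilnorQuotient.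

Lemma comp_lsub (C : numClosedFieldType) n (A : 'M[C]_n) (F : {mpoly C[n]}) :
  F \mPo [tuple \sum_(j < n) (A^T j i) *: 'X_j | i < n] = lsub A F.
Proof.
rewrite lsubE; congr (_ \mPo _); apply: eq_from_tnth => i.
by rewrite !tnth_mktuple; apply: eq_bigr => j _; rewrite mxE.
Qed.

Local Open Scope classical_set_scope.
Local Open Scope quotient_scope.

(** * Translation to the records and quotients of the statement *)

Section Bridge.
Variables (R : realType) (n m : nat).
Hypotheses (hn : (2 <= n)%N) (hm : (3 <= m)%N).
Local Notation C := R[i].
Local Notation N := (n * (m - 2))%N.
Local Notation X := (ndform R n m).

Lemma ndform_nondegenerate (Q : X) : nondegenerate m (ndform_val Q).
Proof. by split; [apply: ndform_homog|apply: ndform_disc]. Qed.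

Lemma ndform_exists (F : {mpoly C[n]}) : nondegenerate m F -> exists Q : X, ndform_val Q = F.
Proof. by move=> [hF hd]; exists (NDForm hF hm hd). Qed.

Lemma ndform_inj (Q Q' : X) : ndform_val Q = ndform_val Q' -> Q = Q'.
Proof.
case: Q Q' => [F h1 h2 h3] [F' h1' h2' h3'] /= e; case: F' / e h1' h2' h3' => *.
by congr NDForm; apply: Prop_irrelevance.
Qed.

Lemma glactE (A : 'M[C]_n) (F : {mpoly C[n]}) : glact A F = @lsub R[i] n (invmx A) F.
Proof.
exact: (@comp_lsub R[i] n (invmx A) F).
Qed.

Section MilnorPi.
Variable Q : X.
Local Notation piQ := (\pi_({ideal_quot (jacobian_ideal Q)})).

Lemma milnor_piD p q : milnor_pi Q (p + q) = milnor_pi Q p + milnor_pi Q q.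
Proof. exact: (rmorphD piQ). Qed.

Lemma milnor_piM p q : milnor_pi Q (p * q) = milnor_pi Q p * milnor_pi Q q.
Proof. exact: (rmorphM piQ). Qed.

Lemma milnor_pi1 : milnor_pi Q 1 = 1.
Proof. exact: (rmorph1 piQ). Qed.

Lemma milnor_pi_surj x : exists p, milnor_pi Q p = x.
Proof. by exists (repr x); apply: reprK. Qed.

Lemma milnor_pi_ker p : milnor_pi Q p = 0 <-> @jac R[i] n (ndform_val Q) p.
Proof.
have e : (p \in jacobian_ideal Q) = (milnor_pi Q p == 0).
  rewrite -[p in LHS]subr0 Quotient.idealrBE.
  by rewrite -(rmorph0 piQ).
by split=> [/eqP|h]; [rewrite -e => /asboolP|apply/eqP; rewrite -e; apply/asboolP].
Qed.
End MilnorPi.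

Lemma is_assoc_formP (Q : X) F : is_assoc_form Q F -> 
  @good R[i] n m (ndform_val Q) /\ F = @Phi R[i] n m (ndform_val Q).
Proof.
move=> [hF [w hw hz]].
exact: (normalized_good hn hm (@complex_uncountable R) (ndform_nondegenerate Q) (milnor_piD Q)
  (milnor_piM Q) (milnor_pi1 Q) (@milnor_pi_surj Q) (@milnor_pi_ker Q) hw hF hz).
Qed.

Lemma good_is_assoc_form (Q : X) : @good R[i] n m (ndform_val Q) ->
  is_assoc_form Q (@Phi R[i] n m (ndform_val Q)).
Proof.
move=> gQ; split; first exact: (Phi_homog gQ).
have [w hw hz] := good_normalized hn hm (@complex_uncountable R) (ndform_nondegenerate Q)
  (milnor_piD Q) (milnor_piM Q) (milnor_pi1 Q) (@milnor_pi_surj Q) (@milnor_pi_ker Q) gQ.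
by exists w.
Qed.

(** Outside the good forms no associated form satisfies the specification, and the default 0 of
    [xget] agrees with that of [Phi]. *)
Lemma assoc_formE (Q : X) : assoc_form Q = @Phi R[i] n m (ndform_val Q).
Proof.
rewrite /assoc_form; case: xgetP => [F _ /is_assoc_formP[]//|h].
have ng : ~ @good R[i] n m (ndform_val Q) by move=> /good_is_assoc_form; apply: h.
rewrite /Phi; case: pselect => // hl; case: ng; split=> //.
exact: ndform_homog.
Qed.
End Bridge.

Section Stability.
Variables (R : realType) (n d : nat).
Local Notation C := R[i].

Lemma rel_semi_invariant l (I : {mpoly C[form_dim n d]}) :
  rel_invariant l I <-> @semi_invariant R[i] n d l I.
Proof.
split=> h F g hF ug.
  have := h (@lsub R[i] n g F) g (lsub_homog _ hF) ug.
  by rewrite glactE lsub_invKV.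
have := h (@lsub R[i] n (invmx g) F) g (lsub_homog _ hF) ug.
by rewrite glactE lsub_invK.
Qed.

Lemma glact_invmx (g : 'M[C]_n) (F : {mpoly C[n]}) : glact (invmx g) F = @lsub R[i] n g F.
Proof. by rewrite glactE invmxK. Qed.

Lemma glorbitP (F G : {mpoly C[n]}) : glorbit F G <->
  exists2 g, g \in unitmx & G = @lsub R[i] n g F.
Proof.
split=> [[A uA <-]|[g ug ->]].
  by exists (invmx A); [rewrite unitmx_inv|rewrite glactE].
by exists (invmx g); [rewrite /= unitmx_inv|rewrite glact_invmx].
Qed.

Lemma stable_finite_stabilizer (F : {mpoly C[n]}) : finite_set (isotropy F) ->
  @finite_stabilizer R[i] n F.
Proof.
move=> /finite_seqP[s hs]; exists s => g ug eg.
have e : glact g F = F.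
  by rewrite glactE; apply: etrans (lsub_invKV F ug); rewrite eg.
have : isotropy F g by split; [exact: ug|exact: e].
by rewrite hs; apply.
Qed.

Lemma stable_closed_orbit (F : {mpoly C[n]}) (I : {mpoly C[form_dim n d]}) :
  zclosed_in d [set G | G \is d.-homog /\ pfun_at I G != 0] (glorbit F) ->
  @closed_orbit_in R[i] n d I F.
Proof.
move=> [_ [S ->] eS] F2 hF2 IF2 hv.
have : glorbit F F2.
  rewrite eS; split=> //; split=> // P SP; apply: hv => g ug.
  have : glorbit F (@lsub R[i] n g F) by apply/glorbitP; exists g.
  by rewrite eS => -[[_ h] _]; apply: h.
by move/glorbitP.
Qed.
End Stability.

Section RegularInvariant.
Variables (R : realType) (n m : nat) (hm : (3 <= m)%N).
Local Notation C := R[i].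
Local Notation X := (ndform R n m).
Variables (f : X -> C) (f_reg : regular_fun f) (f_inv : gl_invariant f).

Definition fun_of_forms (F : {mpoly C[n]}) : C :=
  if pselect (exists Q : X, ndform_val Q = F) is left h then f (projT1 (cid h)) else 0.

Lemma fun_of_formsE (Q : X) : fun_of_forms (ndform_val Q) = f Q.
Proof.
rewrite /fun_of_forms; case: pselect => [h|[]]; last by exists Q.
by congr f; apply: ndform_inj; apply: (projT2 (cid h)).
Qed.

(** The complement of the given neighbourhood is cut out by polynomials; one that is nonzero at [F0]
    defines a principal open neighbourhood inside it. *)
Lemma fun_of_forms_local (F0 : {mpoly C[n]}) : @nondegenerate R[i] n m F0 ->
  exists w p q : {mpoly C[form_dim n m]}, @form_eval R[i] n m w F0 != 0 /\
    forall F, @nondegenerate R[i] n m F -> @form_eval R[i] n m w F != 0 ->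
    @form_eval R[i] n m q F != 0 /\
    fun_of_forms F = @form_eval R[i] n m p F / @form_eval R[i] n m q F.
Proof.
move=> /(ndform_exists hm)[Q0 <-].
have [U [[hU [S eS]] UQ0 [p [q hpq]]]] := f_reg Q0.
have [w Sw w0] : exists2 w, S w & pfun_at w (ndform_val Q0) != 0.
  apply: contrapT => h.
  have : ([set F | F \is m.-homog] `\` U) (ndform_val Q0); last by case.
  rewrite eS; split; first exact: ndform_homog.
  move=> w Sw; apply/eqP; apply: contrapT => /negP w0; apply: h; by exists w.
exists w, p, q; split; first exact: w0.
move=> F /(ndform_exists hm)[Q <-] wQ.
rewrite fun_of_formsE; apply: hpq; apply: contrapT => nU.
have : ([set F | F \is m.-homog] `\` U) (ndform_val Q) by split=> //; apply: ndform_homog.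
rewrite eS => -[_ /(_ w Sw) e].
by case/eqP: wQ.
Qed.

Lemma fun_of_forms_inv F g : @good R[i] n m F -> g \in unitmx ->
  fun_of_forms (@lsub R[i] n g F) = fun_of_forms F.
Proof.
move=> gF ug; have /good_nondegenerate/(ndform_exists hm)[Q' eQ'] := good_lsub ug gF.
have [Q eQ] := ndform_exists hm (good_nondegenerate gF).
rewrite -eQ' -eQ !fun_of_formsE; apply: (f_inv (A := invmx g)).
  by rewrite unitmx_inv.
by rewrite eQ' eQ glact_invmx.
Qed.
End RegularInvariant.

Theorem proposition4p2 (R : realType) (n m : nat) (hn : (2 <= n)%N)
    (hm : (3 <= m)%N)
    (hstable : exists Q : ndform R n m,
        stable (n * (m - 2))%N (assoc_form Q))
    (f : ndform R n m -> R[i]) (f_reg : regular_fun f)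
    (f_inv : gl_invariant f) :
  exists r : {fraction {mpoly R[i][form_dim n (n * (m - 2))]}},
    abs_invariant r /\ comp_assoc_eq r f.
Proof.
have [Q0 [fin [I [[l hI] _ IQ0 hcl]]]] := hstable.
have {}fin := stable_finite_stabilizer fin.
have {}hI := proj1 (rel_semi_invariant l I) hI.
have {}hcl := stable_closed_orbit hcl.
rewrite (assoc_formE hn hm) in fin IQ0 hcl.
(* Otherwise the associated form is 0, and the identity matrix is a nonzero infinitesimal stabilizer
   of 0, against finite isotropy. *)
have gQ0 : @good R[i] n m (ndform_val Q0).
  apply: contrapT => ng; have P0 : @Phi R[i] n m (ndform_val Q0) = 0.
    by rewrite /Phi; case: pselect => // hl; case: ng; split=> //; apply: ndform_homog.
  rewrite P0 in fin.
  have hl : @lie R[i] n 1%:M 0 = 0.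
    by rewrite lieE big1 // => i _; rewrite big1 // => j _; rewrite mderiv0 mulr0 scaler0.
  have := finite_stabilizer_lie (dhomog0 _ _ 0%N) fin hl.
  move/matrixP/(_ (Ordinal (ltnW hn)) (Ordinal (ltnW hn)))/eqP.
  by rewrite !mxE eqxx oner_eq0.
have [s [I1 [J1 [hI1 hJ1 [Q1 [gQ1 JQ1]] hmain]]]] :=
  invariant_descent hn hm (@complex_uncountable R) (fun_of_forms_local hm f_reg)
    (fun_of_forms_inv hm f_inv) gQ0 fin hI IQ0 hcl.
have J0 : J1 != 0 by apply: contraNneq JQ1 => ->; rewrite /form_eval meval0.
exists (FracField.tofrac I1 / FracField.tofrac J1); split.
  exists s, I1, J1; split; [exact/rel_semi_invariant|exact/rel_semi_invariant|exact: J0|].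
  exact: erefl.
split.
  have [Q eQ] := ndform_exists hm (good_nondegenerate gQ1).
  eexists Q, _, I1, J1; split; [exact: erefl| |exact: erefl].
  by rewrite (assoc_formE hn hm) eQ; exact: JQ1.
(* The value may come from any representation [p / q] of the fraction, which is related to [I1 / J1]
   only by cross-multiplication; [hmain] is stated for exactly this. *)
move=> Q c [p [q [er qQ ->]]]; rewrite (assoc_formE hn hm) in qQ *.
rewrite -fun_of_formsE; apply: hmain => //; last exact: ndform_nondegenerate.
have q0 : q != 0 by apply: contraNneq qQ => ->; rewrite /pfun_at meval0.
move/eqP: er; rewrite eqr_div ?tofrac_eq0 // -!tofracM tofrac_eq => /eqP ->.
by rewrite mulrC.
Qed.
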